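(* Let the mark space be $\mathbb{R}^+$ and let $\mathcal{R}$ be the relation $\le$ on $\mathbb{R}^+$. Let $\mu_1,\mu_2\in\mathcal{U}$ have edge weights (edge marks) that are the same at both ends of each edge. Suppose that there is a unimodular $\mathcal{R}$-coupling $\nu$ of $\mu_1$ to $\mu_2$. Let $P^{(i)}_t$ be the transition operators corresponding to the edge weights ($i=1,2$). Then $$\int P^{(1)}_t(o,o)\,d\mu_1(G,o)\;\ge\;\int P^{(2)}_t(o,o)\,d\mu_2(G,o)$$ for all $t>0$.
   Context: A network is a (multi-)graph with marks in a complete separable metric space $\Xi$ on its vertices and two marks on each edge, one at each endpoint. $\mathcal{G}_*$ is the set of rooted-isomorphism classes of rooted connected locally finite networks $(G,o)$ with the topology of local convergence; $\mathcal{G}_{**}$ is the analogous space of networks $(G,x,y)$ with an ordered pair of distinguished vertices. A Borel probability measure $\mu$ on $\mathcal{G}_*$ is unimodular if $\int\sum_{x\in V(G)} f(G,o,x)\,d\mu=\int\sum_{x\in V(G)} f(G,x,o)\,d\mu$ for all Borel $f:\mathcal{G}_{**}\to[0,\infty]$. $\mathcal{U}$ is the set of unimodular probability measures. For a closed set $\mathcal{R}\subseteq\Xi\times\Xi$ and $\mu_1,\mu_2\in\mathcal{U}$, an $\mathcal{R}$-coupling of $\mu_1$ to $\mu_2$ is a probability measure $\nu$ on rooted networks with mark space $\Xi\times\Xi$ that is concentrated on networks all of whose marks lie in $\mathcal{R}$ and whose marginal given by taking the $i$th coordinate of each mark is $\mu_i$ for $i=1,2$. It is a unimodular $\mathcal{R}$-coupling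 if $\nu$ is unimodular. Given a network with edge weights in $\mathbb{R}^+$ and a time $t>0$, $P_t$ is the transition operator of continuous-time random walk on the vertices whose jump rates are the edge weights (the rate of jumping from $x$ to $y$ is the sum of the weights of the edges joining $x$ and $y$); in the case of unbounded weights or degrees, one takes the minimal process, which dies after an explosion. $P_t(x,y)$ denotes its transition probability from $x$ to $y$. *)

(* Defs.v *)
From HB Require Import structures.
From mathcomp Require Import all_boot all_order all_algebra.
From mathcomp Require Import all_classical all_reals all_analysis.
From mathcomp Require Import measurable_realfun.

Set Implicit Arguments.
Unset Strict Implicit.
Unset Printing Implicit Defensive.

Import Order.TTheory GRing.Theory Num.Theory.
Import numFieldNormedType.Exports.

Local Open Scope classical_set_scope.
Local Open Scope ring_scope.
Local Open Scope quotient_scope.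

(* Multigraphs are encoded by darts (half-edges): an edge is a pair           *)
(* {d, drev d} of distinct darts, dart d being attached to the endpoint       *)
(* dsrc d, and dmark d is the mark of the edge at that endpoint.  Loops and   *)
(* multiple edges are allowed.  Vertices and darts are taken in nat, which    *)
(* loses nothing up to isomorphism: connected locally finite networks are     *)
(* countable.  The values of dsrc, drev, dmark outside darts and of vmark     *)
(* outside verts are irrelevant (isomorphisms ignore them).                   *)
Record network (Xi : Type) := Network {
  verts : set nat ;
  darts : set nat ;
  dsrc : nat -> nat ;
  drev : nat -> nat ;
  vmark : nat -> Xi ;
  dmark : nat -> Xi ;
  dsrc_verts : forall d, darts d -> verts (dsrc d) ;
  drev_darts : forall d, darts d -> darts (drev d) ;
  drevK : forall d, darts d -> drev (drev d) = d ;
  drev_neq : forall d, darts d -> drev d <> d }.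

Definition dtgt (Xi : Type) (G : network Xi) (d : nat) : nat :=
  dsrc G (drev G d).

Fixpoint gball (Xi : Type) (G : network Xi) (x : nat) (r : nat) : set nat :=
  match r with
  | 0 => [set x]
  | r'.+1 => gball G x r' `|`
      [set y | exists d, [/\ darts G d, gball G x r' (dsrc G d) & dtgt G d = y]]
  end.

Definition connected_network (Xi : Type) (G : network Xi) : Prop :=
  forall x y, verts G x -> verts G y -> exists r, gball G x r y.

Definition locally_finite (Xi : Type) (G : network Xi) : Prop :=
  forall x, verts G x -> finite_set [set d | darts G d /\ dsrc G d = x].

Record rooted (k : nat) (Xi : Type) := Rooted {
  net :> network Xi ;
  roots : k.-tuple nat ;
  roots_verts : forall i, verts net (tnth roots i) ;
  rooted_connected : connected_network net ;
  rooted_locally_finite : locally_finite net }.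

HB.instance Definition _ k Xi := gen_eqMixin (rooted k Xi).
HB.instance Definition _ k Xi := gen_choiceMixin (rooted k Xi).

Section isomorphism.
Variables (k : nat) (Xi : Type).
Implicit Types (G H K : rooted k Xi) (A B C : set nat) (S : Xi -> Xi -> Prop).

Definition induced_darts (G : network Xi) A : set nat :=
  [set d | [/\ darts G d, A (dsrc G d) & A (dtgt G d)]].

(* A rooted isomorphism from the subnetwork of G induced by A to the          *)
(* subnetwork of H induced by B, corresponding marks being related by S.      *)
Definition sub_iso S G A H B (phi psi : nat -> nat) : Prop :=
  [/\ set_bij A B phi,
      set_bij (induced_darts G A) (induced_darts H B) psi,
      forall d, induced_darts G A d ->
        dsrc H (psi d) = phi (dsrc G d) /\ drev H (psi d) = psi (drev G d),
      map_tuple phi (roots G) = roots H &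
      (forall v, A v -> S (vmark G v) (vmark H (phi v))) /\
      (forall d, induced_darts G A d -> S (dmark G d) (dmark H (psi d)))].

Definition sub_isomorphic S G A H B : Prop :=
  exists phi psi, sub_iso S G A H B phi psi.

Definition isomorphic G H : Prop :=
  sub_isomorphic eq G (verts G) H (verts H).

Definition rball G (r : nat) : set nat :=
  [set v | exists i, gball G (tnth (roots G) i) r v].

Lemma induced_drev (G : network Xi) A d :
  induced_darts G A d -> induced_darts G A (drev G d).
Proof.
move=> [Dd As At]; split; [exact: drev_darts | exact: At | ].
by rewrite /dtgt drevK.
Qed.

Lemma gball_verts (G : network Xi) x r : verts G x -> gball G x r `<=` verts G.
Proof.
move=> Vx; elim: r => [|r IH] /= v; first by move=> ->.
move=> [/IH//|[d [Dd _ <-]]]; exact/dsrc_verts/drev_darts.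
Qed.

Lemma rball_verts G r : rball G r `<=` verts G.
Proof. by move=> v [i]; apply: gball_verts; exact: roots_verts. Qed.

Lemma gballS (Y : Type) (G : network Y) x m n :
  (m <= n)%N -> gball G x m `<=` gball G x n.
Proof.
move=> mn; rewrite -(subnKC mn); elim: (n - m)%N => [|j IH]; first by rewrite addn0.
by rewrite addnS => v /IH; left.
Qed.

Lemma rball_le G m n : (m <= n)%N -> rball G m `<=` rball G n.
Proof. by move=> mn v [i vi]; exists i; apply: gballS vi. Qed.

Lemma roots_rball G i r : rball G r (tnth (roots G) i).
Proof. by exists i; apply: (gballS (leq0n r)). Qed.

Lemma sub_iso_refl S G A : (forall x, S x x) -> sub_isomorphic S G A G A.
Proof.
move=> Sx; exists id, id; split=> //; [by split=> // v Av; exists v..|].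
by apply: eq_from_tnth => i; rewrite tnth_map.
Qed.

Lemma bij_inverse A B phi : set_bij A B phi ->
  exists2 phi', set_bij B A phi' &
    (forall v, A v -> phi' (phi v) = v) /\ (forall w, B w -> phi (phi' w) = w).
Proof.
move=> [fA iA sA].
have /choice [g hg] : forall w, exists v, B w -> A v /\ phi v = w.
  move=> w; have [Bw|nBw] := pselect (B w); last by exists 0%N.
  by have [v Av <-] := sA _ Bw; exists v.
have gK v : A v -> g (phi v) = v.
  by move=> Av; have [Ag e] := hg _ (fA _ Av); apply: iA; rewrite ?inE.
exists g; last by split=> // w /hg[].
split=> [w /hg[]//| w w'|v Av].
- by rewrite !inE => /hg[_ {2}<-] /hg[_ {2}<-] ->.
- by exists (phi v); [exact: fA|exact: gK].
Qed.

Lemma sub_iso_inv S S' G A H B phi psi : (forall x y, S x y -> S' y x) ->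
  (forall i, A (tnth (roots G) i)) -> sub_iso S G A H B phi psi ->
  exists phi' psi', sub_iso S' H B G A phi' psi' /\
    (forall v, A v -> phi' (phi v) = v).
Proof.
move=> SS' rA [bphi bpsi hd hr [hv hm]].
have [phi' bphi' [K1 K2]] := bij_inverse bphi.
have [psi' bpsi' [L1 L2]] := bij_inverse bpsi.
have [fpsi' _ _] := bpsi'; have [fphi' _ _] := bphi'.
exists phi', psi'; split=> //; split=> //.
- move=> d Hd; have Gd := fpsi' _ Hd; have [e1 e2] := hd _ Gd.
  rewrite L2// in e1 e2; rewrite e1 e2; split; first by rewrite K1//; case: Gd.
  by rewrite L1//; exact: induced_drev.
- apply: eq_from_tnth => i; rewrite -hr !tnth_map K1//.
- split=> [v Bv|d Hd]; apply: SS'.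
    by rewrite -{2}(K2 v Bv); apply: hv; exact: fphi'.
  by rewrite -{2}(L2 d Hd); apply: hm; exact: fpsi'.
Qed.

Lemma sub_iso_sym S S' G A H B : (forall x y, S x y -> S' y x) ->
  (forall i, A (tnth (roots G) i)) ->
  sub_isomorphic S G A H B -> sub_isomorphic S' H B G A.
Proof.
move=> SS' rA [phi [psi h]].
by have [phi' [psi' [h' _]]] := sub_iso_inv SS' rA h; exists phi', psi'.
Qed.

Lemma sub_iso_trans S1 S2 S G A H B K C :
  (forall x y z, S1 x y -> S2 y z -> S x z) ->
  sub_isomorphic S1 G A H B -> sub_isomorphic S2 H B K C ->
  sub_isomorphic S G A K C.
Proof.
move=> SS [p [q [bp bq hd hr [hv hm]]]] [p' [q' [bp' bq' hd' hr' [hv' hm']]]].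
exists (p' \o p), (q' \o q).
have [fp _ _] := bp; have [fq _ _] := bq.
split; [exact: set_bij_comp bp bp'|exact: set_bij_comp bq bq'| | |].
- move=> d Gd /=; have [e1 e2] := hd _ Gd; have [e1' e2'] := hd' _ (fq _ Gd).
  by rewrite e1' e1 e2' e2.
- by rewrite -hr' -hr; apply: eq_from_tnth => i; rewrite !tnth_map.
- split=> [v Av|d Ad]; first exact: SS (hv _ Av) (hv' _ (fp _ Av)).
  exact: SS (hm _ Ad) (hm' _ (fq _ Ad)).
Qed.

Lemma sub_iso_rball_sub S G H R r phi psi : (r <= R)%N ->
  sub_iso S G (rball G R) H (rball H R) phi psi ->
  forall v, rball G r v -> rball H r (phi v).
Proof.
move=> rR [[fphi _ _] [fpsi _ _] hd hr _].
elim: r rR => [|r IH] rR v [i].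
  by move=> ->; exists i; rewrite -hr tnth_map.
have {}IH := IH (ltnW rR).
move=> /= [vi|[d [Dd di <-]]].
  have [j wj] := IH v (ex_intro _ i vi).
  by exists j; left.
have [j wj] := IH _ (ex_intro _ i di).
have Ad : induced_darts G (rball G R) d.
  split=> //; first by apply: (rball_le (ltnW rR)); exists i.
  by apply: (rball_le rR); exists i; right; exists d.
have [e1 e2] := hd _ Ad; have [e1' _] := hd _ (induced_drev Ad).
have [Hd _ _] := fpsi _ Ad.
exists j; right; exists (psi d); split=> //; first by rewrite e1.
by rewrite /dtgt e2 e1'.
Qed.

Lemma sub_iso_rball_le S S' G H r R :
  (forall x y, S x y -> S' x y) -> (r <= R)%N ->
  sub_isomorphic S G (rball G R) H (rball H R) ->
  sub_isomorphic S' G (rball G r) H (rball H r).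
Proof.
move=> SS rR [phi [psi h]].
have [[fphi iphi sphi] [fpsi ipsi spsi] hd hr [hv hm]] := h.
have fwd := sub_iso_rball_sub rR h.
have bwd v : rball G R v -> rball H r (phi v) -> rball G r v.
  move=> Gv Hv; have [phi' [psi' [h' K1]]] :=
    @sub_iso_inv S (fun x y => S y x) _ _ _ _ _ _ (fun _ _ => id)
      (fun i => roots_rball G i R) h.
  by have := sub_iso_rball_sub rR h' Hv; rewrite K1.
have sI : induced_darts G (rball G r) `<=` induced_darts G (rball G R).
  by move=> d [? ? ?]; split=> //; apply: rball_le rR _ _.
exists phi, psi; split=> //.
- split=> [v /fwd//|v w|w Hw].
    rewrite !inE => Gv Gw; apply: iphi; rewrite inE; exact: (rball_le rR).
  have [v Gv e] := sphi _ (rball_le rR Hw).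
  by exists v => //; apply: bwd => //; rewrite e.
- split=> [d Gd|d d'|d Hd].
  + have [e1 _] := hd _ (sI _ Gd); have [_ e2] := hd _ (sI _ Gd).
    have [e3 _] := hd _ (induced_drev (sI _ Gd)).
    have [Dd _ _] := fpsi _ (sI _ Gd); have [_ Gs Gt] := Gd.
    split=> //; first by rewrite e1; exact: fwd.
    by rewrite /dtgt e2 e3; exact: fwd.
  + rewrite !inE => Gd Gd'; apply: ipsi; rewrite inE; exact: sI.
  + have [Dd Hs Ht] := Hd.
    have [|d' Gd' e] := spsi d; first by split=> //; apply: rball_le rR _ _.
    exists d' => //; have [e1 e2] := hd _ Gd'.
    have [e3 _] := hd _ (induced_drev Gd').
    have [Dd' Gs Gt] := Gd'; split=> //; apply: bwd => //.
      by rewrite -e1 e.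
    by rewrite /dtgt -e3 -e2 e.
- by move=> d /sI /hd.
- split=> [v Gv|d Gd]; apply: SS; [apply: hv|apply: hm; exact: sI].
  exact: (rball_le rR).
Qed.

Lemma isomorphic_refl G : isomorphic G G.
Proof. exact: sub_iso_refl. Qed.

Lemma isomorphic_sym G H : isomorphic G H -> isomorphic H G.
Proof. by apply: sub_iso_sym => // i; exact: roots_verts. Qed.

Lemma isomorphic_trans G H K :
  isomorphic G H -> isomorphic H K -> isomorphic G K.
Proof. by apply: sub_iso_trans => x y z ->. Qed.

Definition isomorphicb (G H : rooted k Xi) : bool := `[< isomorphic G H >].

Lemma isomorphicb_refl : reflexive isomorphicb.
Proof. by move=> G; apply/asboolP; exact: isomorphic_refl. Qed.

Lemma isomorphicb_sym : symmetric isomorphicb.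
Proof. by move=> G H; apply/asboolP/asboolP; exact: isomorphic_sym. Qed.

Lemma isomorphicb_trans : transitive isomorphicb.
Proof.
move=> H G K /asboolP h1 /asboolP h2; apply/asboolP.
exact: isomorphic_trans h1 h2.
Qed.

Definition isomorphic_equiv : equiv_rel (rooted k Xi) :=
  EquivRel isomorphicb isomorphicb_refl isomorphicb_sym isomorphicb_trans.

Definition rooted_class : Type := {eq_quot isomorphic_equiv}.

HB.instance Definition _ := Choice.on rooted_class.
HB.instance Definition _ := Quotient.on rooted_class.

End isomorphism.

Arguments rooted_class : clear implicits.

HB.instance Definition _ (R : realType) (X Y : pseudoPMetricType R) :=
  Pointed.on (X * Y)%type.

Section one_vertex_network.
Variables (k : nat) (Xi : pointedType).

Definition one_vertex_network : network Xi :=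
  @Network Xi [set 0%N] set0 id id (fun=> point) (fun=> point)
    (fun _ => False_ind _) (fun _ => False_ind _) (fun _ => False_ind _)
    (fun _ => False_ind _).

Lemma one_vertex_roots i :
  verts one_vertex_network (tnth [tuple of nseq k 0%N] i).
Proof. by rewrite (tnth_nth 0%N) /= nth_nseq if_same. Qed.

Lemma one_vertex_connected : connected_network one_vertex_network.
Proof. by move=> x y -> ->; exists 0%N. Qed.

Lemma one_vertex_locally_finite : locally_finite one_vertex_network.
Proof. by move=> x _; apply: sub_finite_set (finite_set0 _) => d []. Qed.

Definition one_vertex_rooted : rooted k Xi :=
  Rooted one_vertex_roots one_vertex_connected one_vertex_locally_finite.

HB.instance Definition _ := isPointed.Build (rooted_class k Xi)
  (\pi_(rooted_class k Xi) one_vertex_rooted).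

End one_vertex_network.

Section local_topology.
Variables (k : nat) (R : realType) (Xi : pseudoPMetricType R).
Implicit Types (U : set (rooted_class k Xi)) (G H : rooted k Xi).

(* The r-balls around the roots are rootedly isomorphic, corresponding marks  *)
(* being at distance less than e.  For several roots, the union of the        *)
(* r-balls is used.                                                           *)
Definition locally_close (r : nat) (e : R) G H : Prop :=
  sub_isomorphic (fun a b => ball a e b) G (rball G r) H (rball H r).

Definition local_open U : Prop :=
  forall g, U g -> exists r e, 0 < e /\
    forall h, locally_close r e (repr g) (repr h) -> U h.

Lemma locally_close_le r r' e e' G H : (r <= r')%N -> e' <= e ->
  locally_close r' e' G H -> locally_close r e G H.
Proof.
by move=> rr' ee'; apply: sub_iso_rball_le => // x y; exact: le_ball.
Qed.

Lemma local_openT : local_open setT.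
Proof. by move=> g _; exists 0%N, 1. Qed.

Lemma local_openI : setI_closed local_open.
Proof.
move=> U V oU oV g [/oU[r [e [e0 hU]]] /oV[r' [e' [e'0 hV]]]].
exists (maxn r r'), (Num.min e e'); split; first by rewrite lt_min e0.
move=> h gh; split.
  by apply/hU/(locally_close_le _ _ gh); rewrite ?leq_maxl ?ge_min ?lexx.
by apply/hV/(locally_close_le _ _ gh); rewrite ?leq_maxr ?ge_min ?lexx ?orbT.
Qed.

Lemma local_open_bigcup (I : Type) (f : I -> set (rooted_class k Xi)) :
  (forall i, local_open (f i)) -> local_open (\bigcup_i f i).
Proof.
move=> of_ g [i _ /of_[r [e [e0 h]]]]; exists r, e; split=> // g' /h.
by exists i.
Qed.

HB.instance Definition _ := isOpenTopological.Build (rooted_class k Xi)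
  local_openT local_openI local_open_bigcup.

End local_topology.

(* G_* (k = 1) and G_** (k = 2) with their Borel sigma-algebras.              *)
Notation borel_class k Xi :=
  (g_sigma_algebraType (@open (rooted_class k Xi))).
Notation Gstar Xi := (borel_class 1 Xi).
Notation Gstarstar Xi := (borel_class 2 Xi).

Definition root (Xi : Type) (G : rooted 1 Xi) : nat := tnth (roots G) ord0.

Lemma root_verts (Xi : Type) (G : rooted 1 Xi) : root G \in verts G.
Proof. by rewrite inE; exact: roots_verts. Qed.

Definition rootv (Xi : Type) (G : rooted 1 Xi) : verts G :=
  exist _ (root G) (root_verts G).

Lemma reroot_verts (Xi : Type) (G : network Xi) (x y : verts G) (i : 'I_2) :
  verts G (tnth [tuple val x; val y] i).
Proof.
by case: i => -[|[|//]] ?; rewrite (tnth_nth 0%N) /=; exact: set_valP.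
Qed.

Definition birooted (Xi : Type) (G : rooted 1 Xi) (x y : verts G) :
    rooted 2 Xi :=
  Rooted (@reroot_verts Xi G x y)
    (@rooted_connected _ _ G) (@rooted_locally_finite _ _ G).

Definition birooted_class (Xi : Type) (G : rooted 1 Xi) (x y : verts G) :
  rooted_class 2 Xi := \pi_(rooted_class 2 Xi) (birooted x y).

Definition unimodular (R : realType) (Xi : pseudoPMetricType R)
    (mu : probability (Gstar Xi) R) : Prop :=
  forall f : Gstarstar Xi -> \bar R, measurable_fun setT f ->
    (forall z, 0 <= f z)%E ->
    (\int[mu]_g (\esum_(x in [set: verts (repr g)])
                   f (birooted_class (rootv (repr g)) x)) =
     \int[mu]_g (\esum_(x in [set: verts (repr g)])
                   f (birooted_class x (rootv (repr g)))))%E.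

Section map_marks.
Variables (k : nat) (Xi Xi' : Type) (h : Xi -> Xi').

Definition map_network (G : network Xi) : network Xi' :=
  Network (h \o vmark G) (h \o dmark G)
    (@dsrc_verts _ G) (@drev_darts _ G) (@drevK _ G) (@drev_neq _ G).

Lemma map_network_connected G :
  connected_network G -> connected_network (map_network G).
Proof.
move=> cG x y Vx /(cG _ _ Vx)[r xy]; exists r; move: xy.
by elim: r y => [|r IH] y //= [/IH|[d [Dd /IH ? <-]]]; [left|right; exists d].
Qed.

Definition map_rooted (G : rooted k Xi) : rooted k Xi' :=
  @Rooted k Xi' (map_network G) (roots G) (@roots_verts _ _ G)
    (map_network_connected (@rooted_connected _ _ G))
    (@rooted_locally_finite _ _ G).

Definition map_class (g : rooted_class k Xi) : rooted_class k Xi' :=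
  \pi_(rooted_class k Xi') (map_rooted (repr g)).

End map_marks.

Definition marks_in (Xi : Type) (S : set Xi) (G : network Xi) : Prop :=
  (forall v, verts G v -> S (vmark G v)) /\
  (forall d, darts G d -> S (dmark G d)).

(* S is meant to be closed (see leRplus_closed for the relation <=), so that  *)
(* the networks with all marks in S form a Borel set.                         *)
Definition is_coupling (R : realType) (Xi : pseudoPMetricType R)
    (S : set (Xi * Xi)) (mu1 mu2 : probability (Gstar Xi) R)
    (nu : probability (Gstar (Xi * Xi)%type) R) : Prop :=
  [/\ {ae nu, forall g : rooted_class 1 (Xi * Xi)%type, marks_in S (repr g)},
      (forall A : set (Gstar Xi), measurable A ->
        pushforward nu (map_class fst : _ -> Gstar Xi) A = mu1 A) &
      (forall A : set (Gstar Xi), measurable A ->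
        pushforward nu (map_class snd : _ -> Gstar Xi) A = mu2 A)].

Definition is_unimodular_coupling (R : realType) (Xi : pseudoPMetricType R)
    (S : set (Xi * Xi)) (mu1 mu2 : probability (Gstar Xi) R)
    (nu : probability (Gstar (Xi * Xi)%type) R) : Prop :=
  is_coupling S mu1 mu2 nu /\ unimodular nu.

(* The mark space R^+ = [0, +oo[, with the metric of R.                       *)
Definition Rplus (R : realType) : Type := `[0%R, +oo[%classic : set R.

Section Rplus.
Variable R : realType.

HB.instance Definition _ := PseudoMetric.copy (Rplus R)
  (set_type (`[0%R, +oo[%classic : set R)).

Lemma Rplus0_subproof : 0 \in (`[0%R, +oo[%classic : set R).
Proof. by rewrite inE /= in_itv /= lexx. Qed.

HB.instance Definition _ := isPointed.Build (Rplus R)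
  (exist _ 0 Rplus0_subproof).

Definition leRplus : set (Rplus R * Rplus R) :=
  [set p | set_val p.1 <= set_val p.2].

Lemma leRplus_closed : closed leRplus.
Proof.
have vc : continuous (set_val : Rplus R -> R) := @initial_continuous _ _ set_val.
have c : continuous (fun p : Rplus R * Rplus R => set_val p.2 - set_val p.1 : R).
  move=> p; apply: cvgB.
    by apply: (@continuous_comp _ _ _ snd set_val p); [exact: cvg_snd|exact: vc].
  by apply: (@continuous_comp _ _ _ fst set_val p); [exact: cvg_fst|exact: vc].
rewrite (_ : leRplus = (fun p => set_val p.2 - set_val p.1) @^-1` [set x | 0 <= x]).
  by apply: closed_comp (@closed_ge R 0) => p _; exact: c.
by apply/seteqP; split => p; rewrite /leRplus /= subr_ge0.
Qed.

End Rplus.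

Section random_walk.
Variables (R : realType) (G : network (Rplus R)).

Definition symmetric_weights : Prop :=
  forall d, darts G d -> dmark G (drev G d) = dmark G d.

(* Sum of the weights of the edges joining x and y (meant for x <> y).        *)
Definition rate (x y : nat) : R :=
  \sum_(d \in [set d | [/\ darts G d, dsrc G d = x & dtgt G d = y]])
    set_val (dmark G d).

Definition total_rate (x : nat) : R :=
  \sum_(y \in verts G `\ x) rate x y.

(* Probability that the walk started at x is at y at time t after exactly n   *)
(* jumps, by conditioning on the (exponential) time s and the target z of the *)
(* first jump.                                                                *)
Fixpoint njump_prob (n : nat) (t : R) (x y : nat) : \bar R :=
  (match n with
  | 0 => if x == y then (expR (- (total_rate x * t)))%:E else 0
  | n'.+1 => \int[lebesgue_measure]_(s in `[0%R, t]%classic)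
      ((expR (- (total_rate x * s)))%:E *
       (\esum_(z in verts G `\ x)
          ((rate x z)%:E * njump_prob n' (t - s)%R z y)))
  end)%E.

(* Transition probability P_t(x, y) of the minimal process: the walk is at y  *)
(* at time t after finitely many jumps.                                       *)
Definition trans_prob (t : R) (x y : nat) : \bar R :=
  (\sum_(0 <= n <oo) njump_prob n t x y)%E.

End random_walk.

Definition return_prob (R : realType) (t : R) (g : rooted_class 1 (Rplus R)) :
  \bar R := trans_prob (repr g) t (root (repr g)) (root (repr g)).

(* Main.v *)
(** Kill the walk outside [V = {x | D_2(x) <= N}], [D_2] being the exit rate for the
larger weights, and uniformize it at rate [c = 2N]: its semigroup is
[exp (-ct) * sum_m (ct)^m / m! * Z_i^m] with [Z_i = I - A_i / c]
restricted to [V], where [- A_i] is the generator of the [i]-th walk.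
Both [Z_i], as well as [Z_1 - Z_2], are symmetric and diagonally dominant, hence
positive semidefinite.  Let [tau] be the trace [K |-> E K(o, o)]; mass transport
makes it cyclic, and nonnegative on a product of a diagonally dominant kernel and
a positive semidefinite one.  Then
[T_i = tau (Z_1^i Z_2^(m - i))] satisfies [T_1 >= T_0], as
[T_1 - T_0 = tau ((Z_1 - Z_2) Z_2^(m - 1))], and is convex in [i], as
[T_(i+1) - 2 T_i + T_(i-1) = tau (Z_1^(i-1) (Z_1 - Z_2) Z_2^(m-i-1) (Z_1 - Z_2))].
So [tau (Z_2^m) = T_0 <= T_m = tau (Z_1^m)], which is the inequality for the killed
walks.  Their return probabilities are at most those of the minimal processes
and converge to them as [N] grows, whence the theorem by Fatou's lemma. *)

Require Import Defs.
From mathcomp Require Import all_boot all_order all_algebra.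
From mathcomp Require Import all_classical all_reals all_analysis.
From mathcomp Require Import measurable_realfun.
From mathcomp Require Import ring lra.

Set Implicit Arguments.
Unset Strict Implicit.
Unset Printing Implicit Defensive.

Import Order.TTheory GRing.Theory Num.Theory.
Import numFieldNormedType.Exports.

Local Open Scope classical_set_scope.
Local Open Scope ring_scope.
Local Open Scope quotient_scope.

Local Notation roots := Defs.roots.
Local Notation root := Defs.root.

(** * Isomorphisms of networks and balls *)

(** Positivity of the trace of a product of two psd operators is usually obtained from square roots,
    which are not row finite. Pairing a psd kernel [M] with a diagonally dominant [S] avoids them:
    [|M x y| <= (M x x + M y y) / 2] holds pointwise, mass transport gives both halves the same
    mean, and the diagonal of [S] pays for them. This shapes the convexity step: [X^p] is split into
    two copies of [X^(p/2)], absorbed in the psd factor by congruence, and a remaining [X^(odd p)],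
    because a letter is diagonally dominant while a power need not be. The factor 2 in the clock
    rate makes the letters so: if [D <= c / 2], the holding weight [1 - D / c] is at least the jump
    weight [D / c]. Killing by a threshold on the exit rate bounds the rates and is at the same time
    isomorphism invariant and Borel. Both walks are killed outside the same set, so that in
    [Z_1 - Z_2] the diagonal entry [(D_2 - D_1) / c] covers the rest of its row. All traces are
    written as means of nonnegative bounded functions, differences being moved to the other side,
    and Borel measurability of each kernel is built up from that of [rate] by sums over an
    additional root. *)

Section network_iso.
Variables (Xi Xi' : Type).
Implicit Types (S : Xi -> Xi' -> Prop) (A B : set nat).

(** [sub_iso] without the roots: one pair of maps then serves every list of roots, which is what
    adding, dropping or permuting roots requires. *)
Definition niso S (G : network Xi) A (H : network Xi') B (phi psi : nat -> nat) : Prop :=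
  [/\ set_bij A B phi,
      set_bij (induced_darts G A) (induced_darts H B) psi,
      forall d, induced_darts G A d ->
        dsrc H (psi d) = phi (dsrc G d) /\ drev H (psi d) = psi (drev G d),
      forall v, A v -> S (vmark G v) (vmark H (phi v)) &
      forall d, induced_darts G A d -> S (dmark G d) (dmark H (psi d))].

Definition nball (G : network Xi) (xs : seq nat) (r : nat) : set nat :=
  [set v | exists2 x, x \in xs & gball G x r v].

End network_iso.

Lemma niso_tgt Xi Xi' (S : Xi -> Xi' -> Prop) (G : network Xi) A (H : network Xi') B
    phi psi d :
  niso S G A H B phi psi -> induced_darts G A d -> dtgt H (psi d) = phi (dtgt G d).
Proof.
move=> [_ _ hd _ _] Gd; rewrite /dtgt; have [_ ->] := hd _ Gd.
by have [-> _] := hd _ (induced_drev Gd).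
Qed.

Lemma niso_sub Xi Xi' (S : Xi -> Xi' -> Prop) (G : network Xi) A (H : network Xi') B
    phi psi A' :
  A' `<=` A -> niso S G A H B phi psi -> niso S G A' H (phi @` A') phi psi.
Proof.
move=> A'A h; have tg := niso_tgt h.
have [[fphi iphi _] [fpsi ipsi spsi] hd hv hm] := h.
have sI : induced_darts G A' `<=` induced_darts G A.
  by move=> d [? ? ?]; split=> //; exact: A'A.
have inj v w : A v -> A w -> phi v = phi w -> v = w.
  by move=> Av Aw; apply: iphi; rewrite inE.
have BA' : phi @` A' `<=` B by move=> _ [v /A'A/fphi Bv <-].
split.
- split=> [v A'v|v w|w [v]]; [by exists v| |by exists v].
  by rewrite !inE => /A'A ? /A'A ?; apply: iphi; rewrite inE.
- split=> [d Gd|d d'|d' [Dd' Hs Ht]].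
  + have [e1 _] := hd _ (sI _ Gd); have [Dd _ _] := fpsi _ (sI _ Gd).
    have [_ ? ?] := Gd.
    split=> //; first by rewrite e1; exists (dsrc G d).
    by rewrite tg; [exists (dtgt G d)|exact: sI].
  + by rewrite !inE => /sI ? /sI ?; apply: ipsi; rewrite inE.
  + have [|d Gd e] := spsi d'; first by split=> //; exact: BA'.
    have [e1 _] := hd _ Gd; have e2 := tg _ Gd.
    exists d => //; have [Dd As At] := Gd.
    split=> //.
      by case: Hs => v A'v; rewrite -e e1 => /(inj _ _ (A'A _ A'v) As) <-.
    by case: Ht => w A'w; rewrite -e e2 => /(inj _ _ (A'A _ A'w) At) <-.
- by move=> d /sI /hd.
- by move=> v /A'A/hv.
- by move=> d /sI/hm.
Qed.

Lemma niso_inv Xi Xi' (S : Xi -> Xi' -> Prop) (S' : Xi' -> Xi -> Prop)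
    (G : network Xi) A (H : network Xi') B phi psi :
  (forall x y, S x y -> S' y x) -> niso S G A H B phi psi ->
  exists phi' psi', niso S' H B G A phi' psi' /\ (forall v, A v -> phi' (phi v) = v).
Proof.
move=> SS' [bphi bpsi hd hv hm].
have [phi' bphi' [K1 K2]] := bij_inverse bphi.
have [psi' bpsi' [L1 L2]] := bij_inverse bpsi.
have [fpsi' _ _] := bpsi'; have [fphi' _ _] := bphi'.
exists phi', psi'; split=> //; split=> //.
- move=> d Hd; have Gd := fpsi' _ Hd; have [e1 e2] := hd _ Gd.
  rewrite L2// in e1 e2; rewrite e1 e2; split; first by rewrite K1//; case: Gd.
  by rewrite L1//; exact: induced_drev.
- move=> v Bv; apply: SS'.
  by rewrite -{2}(K2 v Bv); apply: hv; exact: fphi'.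
- move=> d Hd; apply: SS'.
  by rewrite -{2}(L2 d Hd); apply: hm; exact: fpsi'.
Qed.

Lemma niso_gball_sub Xi Xi' (S : Xi -> Xi' -> Prop)
    (G : network Xi) A (H : network Xi') B phi psi x r :
  niso S G A H B phi psi -> gball G x r `<=` A ->
  forall v, gball G x r v -> gball H (phi x) r (phi v).
Proof.
move=> h; have [_ [fpsi _ _] hd _ _] := h.
elim: r => [|r IH] rA v /=; first by move=> ->.
have {}IH := IH (fun w wr => rA w (or_introl wr)).
move=> [/IH|[d [Dd ds <-]]]; first by left.
have Gd : induced_darts G A d.
  by split=> //; apply: rA; [left|right; exists d].
right; exists (psi d); have [-> _] := hd _ Gd; rewrite (niso_tgt h Gd).
by split=> //; [case: (fpsi _ Gd)|exact: IH].
Qed.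

(** One inclusion is transported along the isomorphism and the other along its inverse. Both balls
    must lie in the matched sets, since nothing is known about paths that leave them. *)
Lemma niso_gball Xi Xi' (S : Xi -> Xi' -> Prop)
    (G : network Xi) A (H : network Xi') B phi psi x r :
  niso S G A H B phi psi -> A x -> gball G x r `<=` A -> gball H (phi x) r `<=` B ->
  phi @` (gball G x r) = gball H (phi x) r.
Proof.
move=> h Ax GA HB; apply/seteqP; split=> [_ [v vr <-]|w wr].
  exact: (niso_gball_sub h GA vr).
have [phi' [psi' [h' K]]] := niso_inv (S' := fun y x => S x y) (fun _ _ => id) h.
have [[_ _ sphi] _ _ _ _] := h; have [v Av vw] := sphi _ (HB _ wr).
by have := niso_gball_sub h' HB wr; rewrite K// -vw K//.
Qed.

Lemma niso_nball Xi Xi' (S : Xi -> Xi' -> Prop)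
    (G : network Xi) A (H : network Xi') B phi psi ys r :
  niso S G A H B phi psi ->
  (forall y, y \in ys -> [/\ A y, gball G y r `<=` A & gball H (phi y) r `<=` B]) ->
  niso S G (nball G ys r) H (nball H (map phi ys) r) phi psi.
Proof.
move=> h hys; suff -> : nball H (map phi ys) r = phi @` (nball G ys r).
  by apply: niso_sub h => v [y /hys[_ yA _] /yA].
apply/seteqP; split=> [w [_ /mapP[y yys ->]]|_ [v [y yys yv] <-]].
  have [Ay yA yB] := hys _ yys.
  by rewrite -(niso_gball h)// => -[v yv <-]; exists v => //; exists y.
have [Ay yA yB] := hys _ yys.
by exists (phi y); [exact: map_f|exact: (niso_gball_sub h _ yv)].
Qed.

Lemma gball_trans (Xi : Type) (G : network Xi) x y z m n :
  gball G x m y -> gball G y n z -> gball G x (m + n) z.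
Proof.
move=> xy; elim: n z => [|n IH] z /=; first by move=> ->; rewrite addn0.
rewrite addnS => -[/IH|[d [Dd /IH ? <-]]]; first by left.
by right; exists d.
Qed.

(** This makes a change of roots continuous: new roots within distance [r0] of the old ones only
    cost [r0] in the radius. *)
Lemma niso_nball_nball Xi Xi' (S : Xi -> Xi' -> Prop)
    (G : network Xi) (H : network Xi') phi psi xs ys R r0 r :
  niso S G (nball G xs R) H (nball H (map phi xs) R) phi psi ->
  (r0 + r <= R)%N -> (forall y, y \in ys -> nball G xs r0 y) ->
  niso S G (nball G ys r) H (nball H (map phi ys) r) phi psi.
Proof.
move=> h rR hys; apply: (niso_nball h) => y /hys[x xxs xy].
have r0R : (r0 <= R)%N by apply: leq_trans rR; exact: leq_addr.
have Hy : gball H (phi x) r0 (phi y).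
  apply: (niso_gball_sub h _ xy) => v xv.
  by exists x => //; exact: gballS r0R _ xv.
split; first by exists x => //; exact: gballS r0R _ xy.
  by move=> v yv; exists x => //; exact: gballS rR _ (gball_trans xy yv).
move=> v yv; exists (phi x); first exact: map_f.
exact: gballS rR _ (gball_trans Hy yv).
Qed.

Lemma niso_verts_nball Xi Xi' (S : Xi -> Xi' -> Prop)
    (G : network Xi) (H : network Xi') phi psi ys r :
  niso S G (verts G) H (verts H) phi psi ->
  (forall y, y \in ys -> verts G y) ->
  niso S G (nball G ys r) H (nball H (map phi ys) r) phi psi.
Proof.
move=> h hys; apply: (niso_nball h) => y /hys Gy.
have [[fphi _ _] _ _ _ _] := h.
by split=> //; apply: gball_verts => //; exact: fphi.
Qed.

Lemma gball_finite (Xi : Type) (G : network Xi) x r :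
  locally_finite G -> verts G x -> finite_set (gball G x r).
Proof.
move=> lG Gx; elim: r => [|r IH]; first exact: finite_set1.
rewrite /= finite_setU; split=> //.
rewrite (_ : [set _ | _] = \bigcup_(y in gball G x r)
   (dtgt G @` [set d | darts G d /\ dsrc G d = y])).
  apply: bigcup_finite => // y /(gball_verts Gx) Gy.
  by apply: finite_image; exact: lG.
apply/seteqP; split=> [y [d [Dd dr <-]]|_ [y yr [d [Dd dy] <-]]].
  by exists (dsrc G d) => //; exists d.
by exists d; split=> //; rewrite dy.
Qed.

Section rooted_iso.
Variables (k : nat) (Xi : Type).
Implicit Types (G H : rooted k Xi).

Lemma rballE G r : rball G r = nball G (roots G) r.
Proof.
apply/seteqP; split=> v; first by move=> [i iv]; exists (tnth (roots G) i) => //; exact: mem_tnth.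
by move=> [_ /tnthP[i ->] xv]; exists i.
Qed.

Lemma map_tuple_val (T T' : Type) (f : T -> T') n (x : n.-tuple T) (y : n.-tuple T') :
  (map_tuple f x = y) <-> (map f x = y :> seq T').
Proof. by split=> [<-//|e]; apply/val_inj. Qed.

Lemma sub_isomorphicP S G H r :
  sub_isomorphic S G (rball G r) H (rball H r) <->
  exists phi psi, niso S G (nball G (roots G) r) H (nball H (roots H) r) phi psi /\
    map phi (roots G) = roots H.
Proof.
rewrite !rballE; split=> -[phi [psi h]]; exists phi, psi.
  by case: h => ? ? ? /map_tuple_val ? [? ?].
by case: h => -[? ? ? ? ?] /map_tuple_val; split.
Qed.

Lemma isomorphicP G H :
  isomorphic G H <->
  exists phi psi, niso eq G (verts G) H (verts H) phi psi /\
    map phi (roots G) = roots H.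
Proof.
split=> -[phi [psi h]]; exists phi, psi.
  by case: h => ? ? ? /map_tuple_val ? [? ?].
by case: h => -[? ? ? ? ?] /map_tuple_val; split.
Qed.

Lemma mem_roots_verts G y : y \in val (roots G) -> verts G y.
Proof. by move=> /tnthP[i ->]; exact: roots_verts. Qed.

Lemma isomorphic_rball G H r : isomorphic G H ->
  sub_isomorphic eq G (rball G r) H (rball H r).
Proof.
move=> /isomorphicP[phi [psi [h hr]]]; apply/sub_isomorphicP.
exists phi, psi; split=> //; rewrite -hr.
by apply: niso_verts_nball => //; exact: mem_roots_verts.
Qed.

Lemma isomorphic_repr G : isomorphic (repr (\pi_(rooted_class k Xi) G)) G.
Proof. by have /eqmodP/asboolP := reprK (\pi_(rooted_class k Xi) G). Qed.

Lemma isomorphic_pi G H : isomorphic G H ->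
  \pi_(rooted_class k Xi) G = \pi_(rooted_class k Xi) H.
Proof. by move=> GH; apply/eqmodP/asboolP. Qed.

End rooted_iso.

Section rooted_top.
Variables (R : realType) (k : nat) (Xi : pseudoPMetricType R).
Implicit Types (G H : rooted k Xi).

Lemma locally_close_iso r e G G' H H' : isomorphic G G' -> isomorphic H H' ->
  locally_close r e G' H' -> locally_close r e G H.
Proof.
move=> GG' HH' c.
have h1 := isomorphic_rball r GG'.
have h2 := isomorphic_rball r (isomorphic_sym HH').
apply: (sub_iso_trans (S1 := eq) (S2 := fun a b => ball a e b) _ h1).
  by move=> x y z ->.
by apply: sub_iso_trans c h2 => x y z b <-.
Qed.

(** Openness is defined through [repr]; since local closeness is invariant under isomorphism, it can
    be tested on any representative. *)
Lemma open_classP (U : set (rooted_class k Xi)) : open U <->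
  forall G, U (\pi_(rooted_class k Xi) G) -> exists r e, 0 < e /\
    forall H, locally_close r e G H -> U (\pi_(rooted_class k Xi) H).
Proof.
split=> [oU G UG|h].
  have [r [e [e0 hU]]] : exists r e, 0 < e /\ forall h,
     locally_close r e (repr (\pi_(rooted_class k Xi) G)) (repr h) -> U h by exact: oU.
  exists r, e; split=> // H GH; apply: hU.
  by apply: locally_close_iso GH; exact: isomorphic_repr.
move=> g Ug; have [|r [e [e0 hU]]] := h (repr g); first by rewrite reprK.
by exists r, e; split=> // h' /hU; rewrite reprK.
Qed.

End rooted_top.

(** * Borel functionals of rooted networks *)

(** The generator [F] is left free: with the open upper rays of the extended reals, lower
    semicontinuity is enough for measurability. *)
Lemma borel_measurable_fun (R : realType) (k : nat) (Xi : pseudoPMetricType R)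
    d (T : measurableType d) (F : set (set T)) (f : rooted_class k Xi -> T) :
  @measurable _ T = <<s F >> -> (forall U, F U -> open (f @^-1` U)) ->
  measurable_fun setT (f : borel_class k Xi -> T).
Proof.
move=> FT cf; apply: (measurability _ FT) => _ [U FU <-].
by rewrite setTI; apply: sub_sigma_algebra; exact: cf.
Qed.

Section class_map.
Variables (R : realType) (k m : nat) (Xi Xi' : pseudoPMetricType R).
Variable T : rooted k Xi -> rooted m Xi'.

Definition class_map (g : rooted_class k Xi) : rooted_class m Xi' :=
  \pi_(rooted_class m Xi') (T (repr g)).

Hypothesis Tiso : forall G H, isomorphic G H -> isomorphic (T G) (T H).
Hypothesis Tclose : forall G r e, 0 < e -> exists r' e', 0 < e' /\
  forall H, locally_close r' e' G H -> locally_close r e (T G) (T H).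

Lemma class_map_pi G : class_map (\pi_(rooted_class k Xi) G) = \pi_(rooted_class m Xi') (T G).
Proof. by apply/isomorphic_pi/Tiso/isomorphic_repr. Qed.

Lemma measurable_class_map :
  measurable_fun setT (class_map : borel_class k Xi -> borel_class m Xi').
Proof.
apply: (@borel_measurable_fun R k Xi _ (borel_class m Xi') (@open (rooted_class m Xi')) class_map) => // U /open_classP oU; apply/open_classP => G.
rewrite /preimage/= class_map_pi => /oU[r [e [e0 hU]]].
have [r' [e' [e'0 h]]] := Tclose G r e0.
by exists r', e'; split=> // H /h/hU; rewrite class_map_pi.
Qed.

End class_map.

Section bor.
Variables (R : realType) (Xi : pseudoPMetricType R).
Implicit Types (phi : network Xi -> seq nat -> \bar R).

(** Functionals take a bare network and a plain list of vertices, so that they are ordinary formulas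
    in vertex variables; invariance is what lets them descend to classes with [k] roots. *)
Definition bor k phi : Prop :=
  (forall G H : rooted k Xi, isomorphic G H -> phi G (roots G) = phi H (roots H)) /\
  measurable_fun setT (fun g : borel_class k Xi => phi (repr g) (roots (repr g))).

Lemma bor_pi k phi (G : rooted k Xi) : bor k phi ->
  phi (repr (\pi_(rooted_class k Xi) G)) (roots (repr (\pi_(rooted_class k Xi) G))) =
  phi G (roots G).
Proof. by move=> [+ _]; apply; exact: isomorphic_repr. Qed.

Lemma bor_ext k phi phi' : (forall G : rooted k Xi, phi G (roots G) = phi' G (roots G)) ->
  bor k phi -> bor k phi'.
Proof.
move=> e [h m]; split=> [G H GH|]; first by rewrite -!e; exact: h.
by move: m; congr measurable_fun; apply/funext => g; exact: e.
Qed.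

End bor.

Section map_marks.
Variables (R : realType) (Xi Xi' : pseudoPMetricType R) (h : Xi -> Xi').
Hypothesis h_ball : forall e a b, 0 < e -> ball a e b -> ball (h a) e (h b).

Lemma isomorphic_map k (G H : rooted k Xi) :
  isomorphic G H -> isomorphic (map_rooted h G) (map_rooted h H).
Proof.
move=> /isomorphicP[f [g [[? ? ? hv hm] ?]]]; apply/isomorphicP; exists f, g.
by split=> //; split=> // [v /hv /= ->|d /hm /= ->].
Qed.

(** The map of marks is nonexpanding and leaves the graph unchanged, so the same radius and the same
    tolerance witness continuity. *)
Lemma measurable_map_class k :
  measurable_fun setT (map_class h : borel_class k Xi -> borel_class k Xi').
Proof.
apply: (@measurable_class_map R k k Xi Xi' (map_rooted h)); first exact: isomorphic_map.
move=> G r e e0; exists r, e; split=> // H.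
have bm (K : network Xi) x s : gball (map_network h K) x s = gball K x s.
  by elim: s => //= s ->.
have rm (K : rooted k Xi) s : rball (map_rooted h K) s = rball K s.
  by apply/seteqP; split=> v [i]; [rewrite bm|rewrite -bm]; exists i.
move=> [f [g [? ? ? ? [hv hm]]]]; exists f, g; rewrite !rm; split=> //.
by split=> [v /hv|d /hm] /h_ball; apply.
Qed.

Lemma bor_map k (phi : network Xi' -> seq nat -> \bar R) :
  bor k phi -> bor k (fun G xs => phi (map_network h G) xs).
Proof.
move=> [ip mp]; split; first by move=> G H GH; exact: (ip _ _ (isomorphic_map GH)).
have := measurableT_comp mp (@measurable_map_class k).
congr measurable_fun; apply/funext => g /=.
by rewrite -[RHS]/(phi (net (map_rooted h (repr g))) (roots (map_rooted h (repr g))))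
   -(ip _ _ (isomorphic_repr (map_rooted h (repr g)))).
Qed.

End map_marks.

Section reroot.
Variables (Xi : Type) (k : nat) (s : seq 'I_k).

Lemma reroot_subproof (G : rooted k Xi) (i : 'I_(size s)) :
  verts G (tnth (map_tuple (tnth (roots G)) (in_tuple s)) i).
Proof. by rewrite tnth_map; exact: roots_verts. Qed.

(** The indices in [s] may repeat or permute: this yields diagonal entries, transposes, and
    functionals of few vertices seen as functionals of more. *)
Definition reroot (G : rooted k Xi) : rooted (size s) Xi :=
  Rooted (@reroot_subproof G) (@rooted_connected _ _ G) (@rooted_locally_finite _ _ G).

Lemma roots_reroot (G : rooted k Xi) :
  roots (reroot G) = map (nth 0%N (roots G)) (map val s) :> seq nat.
Proof. by rewrite /= -map_comp; apply: eq_map => i /=; exact: tnth_nth. Qed.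

Lemma reroot_map (G H : rooted k Xi) f : map f (roots G) = roots H ->
  map f (roots (reroot G)) = roots (reroot H).
Proof.
move=> e; rewrite !roots_reroot -e -!map_comp; apply: eq_map => i /=.
by rewrite (nth_map 0%N) ?size_tuple.
Qed.

End reroot.

Lemma bor_reroot (R : realType) (Xi : pseudoPMetricType R) k (s : seq 'I_k)
    (phi : network Xi -> seq nat -> \bar R) :
  bor (size s) phi -> bor k (fun G xs => phi G (map (nth 0%N xs) (map val s))).
Proof.
move=> [ip mp].
have Tiso (G H : rooted k Xi) : isomorphic G H -> isomorphic (reroot s G) (reroot s H).
  move=> /isomorphicP[f [g [h e]]]; apply/isomorphicP; exists f, g.
  by split; [exact: h|exact: reroot_map].
split.
  move=> G H GH; have := ip _ _ (Tiso _ _ GH); by rewrite !roots_reroot.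
have Tclose (G : rooted k Xi) r e : 0 < e -> exists r' e', 0 < e' /\
  forall H, locally_close r' e' G H -> locally_close r e (reroot s G) (reroot s H).
  move=> e0; exists r, e; split=> // H.
  move=> /sub_isomorphicP[f [g [h hr]]]; apply/sub_isomorphicP; exists f, g.
  split; last exact: reroot_map.
  rewrite -(reroot_map s hr); rewrite -hr in h.
  apply: (niso_nball_nball (r0 := 0) h) => // y /mapP[i _ ->].
  exists (tnth (roots G) i) => //; exact: mem_tnth.
have := measurableT_comp mp (measurable_class_map Tiso Tclose).
congr measurable_fun; apply/funext => g /=.
by rewrite -roots_reroot -[RHS]/(phi (net (reroot s (repr g))) (roots (reroot s (repr g))))
   -(ip _ _ (isomorphic_repr (reroot s (repr g)))).
Qed.

Section counting_family.
Context d (T : measurableType d) (R : realType).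
Variables (B : set nat) (p : nat -> T).

(** Counting measure of the family [p] over [B]. It turns a sum over vertices into an integral
    against a kernel that depends on the network, whose measurability can be checked set by set. *)
Definition point_masses : {measure set T -> \bar R} :=
  mseries (fun y => if y \in B then dirac (p y) : {measure set T -> \bar R} else mzero) 0.

Lemma point_massesE A : point_masses A = \esum_(y in B `&` p @^-1` A) (1 : \bar R)%E.
Proof.
rewrite /point_masses/= /mseries nneseries_esumT//.
rewrite [RHS]esum_mkcond; apply: eq_esum => y _.
rewrite in_setI; case: ifPn => //= yB.
rewrite diracE.
by have [|] := boolP (p y \in A); rewrite ?inE ?notin_setE => Apy; case: ifPn;
  rewrite ?inE ?notin_setE.
Qed.

Lemma integral_point_masses (f : T -> \bar R) :
  measurable_fun setT f -> (forall z, 0 <= f z)%E ->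
  (\int[point_masses]_z f z)%E = (\esum_(y in B) f (p y))%E.
Proof.
move=> mf f0; rewrite ge0_integral_measure_series// nneseries_esumT; last first.
  by move=> y; apply: integral_ge0.
rewrite [RHS]esum_mkcond; apply: eq_esum => y _; case: ifPn => yB.
  by rewrite integral_dirac// diracT mul1e.
exact: integral_measure_zero.
Qed.

End counting_family.

Lemma esum_mono_inj (R : realType) (f : nat -> nat) (A B : set nat) :
  {in A &, injective f} -> (forall y, A y -> B (f y)) ->
  (\esum_(y in A) (1 : \bar R) <= \esum_(y in B) (1 : \bar R))%E.
Proof.
move=> fi fAB.
rewrite -(esum_image A f (fun=> 1%E)); last by move=> x y xA yA; apply: fi.
rewrite esum_mkcond [leRHS]esum_mkcond; apply: le_esum => y _.
case: ifPn => [|_]; last by case: ifPn.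
rewrite inE => -[z /fAB Bz <-].
by rewrite ifT ?inE.
Qed.

(** Finitely many radii and tolerances are made uniform at once; with tolerance 1 it only bounds a
    finite set of numbers. *)
Lemma finite_nat_pos_bound (R : realType) (P : set nat) (f : nat -> nat) (e : nat -> R) :
  finite_set P -> (forall y, 0 < e y) ->
  exists M d, 0 < d /\ forall y, P y -> (f y <= M)%N /\ d <= e y.
Proof.
move=> /finite_seqP[s ->] e0; elim: s => [|a s [M [d [d0 h]]]]; first by exists 0%N, 1.
exists (maxn (f a) M), (Num.min (e a) d); split; first by rewrite lt_min e0.
move=> y; rewrite /= inE => /predU1P[->|/h[fM de]].
  by rewrite leq_maxl ge_min lexx.
by rewrite leq_max fM orbT ge_min de orbT.
Qed.

Section push.
Variables (Xi : pointedType) (k : nat).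

Lemma push_subproof (G : rooted k Xi) y (Gy : verts G y) (i : 'I_k.+1) :
  verts G (tnth (rcons_tuple (roots G) y) i).
Proof.
have /= := mem_tnth i (rcons_tuple (roots G) y).
by rewrite mem_rcons inE => /predU1P[->//|/mem_roots_verts].
Qed.

Definition push (G : rooted k Xi) y (Gy : verts G y) : rooted k.+1 Xi :=
  Rooted (push_subproof Gy) (@rooted_connected _ _ G) (@rooted_locally_finite _ _ G).

(** The default [point] off the vertices makes the map total on [nat]; it is never met, because only
    vertices in balls are counted. *)
Definition push_class (G : rooted k Xi) y : rooted_class k.+1 Xi :=
  if pselect (verts G y) is left Gy then \pi_(rooted_class k.+1 Xi) (push Gy) else point.

Lemma push_classE (G : rooted k Xi) y (Gy : verts G y) :
  push_class G y = \pi_(rooted_class k.+1 Xi) (push Gy).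
Proof.
rewrite /push_class; case: pselect => // h; congr (\pi_ _ _).
by rewrite (Prop_irrelevance h Gy).
Qed.

Lemma isomorphic_push (G H : rooted k Xi) phi psi y (Gy : verts G y) (Hy : verts H (phi y)) :
  niso eq G (verts G) H (verts H) phi psi -> map phi (roots G) = roots H ->
  isomorphic (push Gy) (push Hy).
Proof.
move=> h hr; apply/isomorphicP; exists phi, psi; split => //.
by rewrite /= map_rcons hr.
Qed.

End push.

Section sum_over_root.
Variables (R : realType) (Xi : pseudoPMetricType R) (k : nat).

Lemma locally_close_push (G H : rooted k Xi) phi psi r0 r M e y (Gy : verts G y)
    (Hy : verts H (phi y)) :
  niso (fun a b => ball a e b) G (nball G (roots G) M) H (nball H (roots H) M) phi psi ->
  map phi (roots G) = roots H -> (r0 + r <= M)%N -> rball G r0 y ->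
  locally_close r e (push Gy) (push Hy).
Proof.
move=> h hr rM Gry; apply/sub_isomorphicP; exists phi, psi.
have e1 : map phi (roots (push Gy)) = roots (push Hy) by rewrite /= map_rcons hr.
split=> //; rewrite -e1; rewrite -hr in h.
apply: (niso_nball_nball (r0 := r0) h rM) => z.
rewrite /= mem_rcons inE => /predU1P[->|/tnthP[i ->]]; first by rewrite -rballE.
by rewrite -rballE; exact: roots_rball.
Qed.

(** The restriction to a ball makes the count finite, which permits subtraction in the Dynkin
    argument, and makes it depend on a bounded neighbourhood only. *)
Definition count (r : nat) (A : set (rooted_class k.+1 Xi)) (G : rooted k Xi) : \bar R :=
  (\esum_(y in rball G r `&` push_class G @^-1` A) 1)%E.

Lemma count_le_iso r A (G H : rooted k Xi) :
  isomorphic G H -> (count r A G <= count r A H)%E.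
Proof.
move=> GH; have /isomorphicP[phi [psi [h hr]]] := GH.
have [[fphi iphi _] _ _ _ _] := h.
apply: (@esum_mono_inj R phi) => [y z|y [ry Ay]].
  by rewrite !inE => -[/rball_verts Gy _] [/rball_verts Gz _]; apply: iphi; rewrite inE.
have Gy := rball_verts ry; have Hy := fphi _ Gy.
split.
  move: ry; rewrite !rballE => -[x xG xy]; exists (phi x); first by rewrite -hr; exact: map_f.
  by apply: (niso_gball_sub h) xy; apply: gball_verts; exact: mem_roots_verts.
move: Ay; rewrite /= (push_classE Gy) (push_classE Hy); congr (A _).
by apply/isomorphic_pi/isomorphic_push; eassumption.
Qed.

Lemma count_iso r A (G H : rooted k Xi) : isomorphic G H -> count r A G = count r A H.
Proof.
by move=> GH; apply/le_anti; rewrite !count_le_iso//; exact: isomorphic_sym.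
Qed.

Lemma rball_finite (G : rooted k Xi) r : finite_set (rball G r).
Proof.
rewrite (_ : rball G r = \bigcup_(i in [set: 'I_k]) gball G (tnth (roots G) i) r); last first.
  by apply/seteqP; split=> [v [i iv]|v [i _ iv]]; exists i.
apply: bigcup_finite => // i _; apply: gball_finite; last exact: roots_verts.
exact: rooted_locally_finite.
Qed.

(* Finitely many vertices witness a lower bound on the count, and each of them stays *)
(* a witness in every network close enough to [G]: the count is lower semicontinuous. *)
Lemma count_lsc r U (G : rooted k Xi) : open U ->
  exists M e, 0 < e /\ forall H, locally_close M e G H -> (count r U G <= count r U H)%E.
Proof.
move=> oU.
have /choice[f hf] : forall y, exists p : nat * R, 0 < p.2 /\ (U (push_class G y) ->
    forall H, locally_close p.1 p.2 (repr (push_class G y)) H ->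
    U (\pi_(rooted_class k.+1 Xi) H)).
  move=> y; have [Uy|nUy] := pselect (U (push_class G y)); last by exists (0%N, 1).
  have /open_classP := oU => /(_ (repr (push_class G y))); rewrite reprK.
  by move=> /(_ Uy)[s [e [e0 h]]]; exists (s, e).
have [||M [e [e0 hM]]] := @finite_nat_pos_bound R (rball G r `&` push_class G @^-1` U)
  (fun y => (f y).1) (fun y => (f y).2).
- by apply: sub_finite_set (rball_finite G r) => y [].
- by move=> y; have [] := hf y.
(* Radius [r] reaches the witness [y], and [M] more controls the neighbourhood on which membership
   of its class in [U] depends. *)
exists (r + M)%N, e; split => // H /sub_isomorphicP[phi [psi [h hr]]].
have [[fphi iphi _] _ _ _ _] := h.
have rM y : rball G r y -> nball G (roots G) (r + M) y.
  by rewrite -rballE; apply: rball_le; exact: leq_addr.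
apply: (@esum_mono_inj R phi) => [y z|y [ry Uy]].
  by rewrite !inE => -[/rM Gy _] [/rM Gz _]; apply: iphi; rewrite inE.
have [fM ef] := hM _ (conj ry Uy).
have Gy := rball_verts ry.
have Hy' := fphi _ (rM _ ry); have Hy : verts H (phi y).
  by apply: (@rball_verts _ _ H (r + M)); rewrite rballE.
split.
  move: ry; rewrite !rballE => -[x xG xy]; exists (phi x); first by rewrite -hr; exact: map_f.
  apply: (niso_gball_sub h) xy => v xv.
  by apply: rM; rewrite rballE; exists x.
rewrite /= (push_classE Hy); have [_ /(_ Uy)] := hf y; apply.
apply: (locally_close_iso (G' := push Gy) (H' := push Hy)).
- by rewrite (push_classE Gy); exact: isomorphic_repr.
- exact: isomorphic_refl.
- have := locally_close_push Gy Hy h hr (leqnn _) ry.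
  exact: locally_close_le.
Qed.

Lemma measurable_count_open r U : open U ->
  measurable_fun setT (fun g : borel_class k Xi => count r U (repr g)).
Proof.
move=> oU.
apply: (@borel_measurable_fun R k Xi _ (\bar R) _ _ (ErealGenOInfty.measurableE R)).
move=> _ [x ->]; apply/open_classP => G; rewrite preimage_itvoy /=.
rewrite (count_iso r U (isomorphic_repr G)) => xG.
have [M [e [e0 h]]] := count_lsc r G oU.
exists M, e; split=> // H /h GH; rewrite (count_iso r U (isomorphic_repr H)).
exact: lt_le_trans GH.
Qed.

Definition count_measure (r : nat) (g : borel_class k Xi) :
    {measure set (borel_class k.+1 Xi) -> \bar R} :=
  point_masses R (rball (repr g) r) (push_class (repr g) : nat -> borel_class k.+1 Xi).

Lemma count_measureE r g A : count_measure r g A = count r A (repr g).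
Proof. exact: point_massesE. Qed.

Lemma count_fin r A (G : rooted k Xi) : count r A G \is a fin_num.
Proof.
rewrite /count esum_fset//; last by apply: sub_finite_set (rball_finite G r) => y [].
rewrite fsbig_finite/=; last by apply: sub_finite_set (rball_finite G r) => y [].
by rewrite sumEFin.
Qed.

(** Dynkin induction from the open sets. The complement step subtracts from the count of the whole
    space, which is legitimate because counts are finite. *)
Lemma measurable_count r (A : set (borel_class k.+1 Xi)) : measurable A ->
  measurable_fun setT (fun g : borel_class k Xi => count_measure r g A).
Proof.
move=> mA; have mo (U : set (borel_class k.+1 Xi)) : @open (rooted_class k.+1 Xi) U ->
    measurable_fun setT (fun g : borel_class k Xi => count_measure r g U).
  by move=> oU; under eq_fun do rewrite count_measureE; exact: measurable_count_open.
apply: (@dynkin_induction _ (borel_class k.+1 Xi) (@open (rooted_class k.+1 Xi))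
  (fun A => measurable_fun setT (fun g : borel_class k Xi => count_measure r g A)) erefl
  _ _ _ _ _ A mA).
- by move=> {mA}A B; exact: openI.
- apply: mo; exact: (@openT (rooted_class k.+1 Xi)).
- by move=> U oU; exact: mo.
- move=> {mA}A mA hA.
  rewrite (_ : (fun g => _) = (fun g => count_measure r g setT - count_measure r g A)%E).
    apply: emeasurable_funB => //; apply: mo; exact: (@openT (rooted_class k.+1 Xi)).
  apply/funext => g; have fA : count_measure r g A \is a fin_num.
    by rewrite count_measureE count_fin.
  rewrite -(setUv A) measureU ?setICr//; last exact: measurableC.
  by rewrite addeAC subee// add0e.
- move=> {mA}F mF tF hF.
  rewrite (_ : (fun g => _) = (fun g => \sum_(0 <= i <oo | i \in setT) count_measure r g (F i))%E).
    by apply: ge0_emeasurable_sum => // i g _ _; exact: measure_ge0.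
  by apply/funext => g; rewrite measure_bigcup//.
Qed.

End sum_over_root.

Lemma esum_sub (R : realType) (f : nat -> \bar R) (A B : set nat) :
  (forall y, 0 <= f y)%E -> A `<=` B -> (\esum_(y in A) f y <= \esum_(y in B) f y)%E.
Proof.
move=> f0 AB; rewrite esum_mkcond [leRHS]esum_mkcond; apply: le_esum => y _.
case: ifPn => [|_]; last by case: ifPn.
by rewrite inE => /AB By; rewrite ifT ?inE.
Qed.

Lemma cvg_esum_bigcup (R : realType) (f : nat -> \bar R) (B : nat -> set nat) (V : set nat) :
  (forall y, 0 <= f y)%E -> (forall m n, (m <= n)%N -> B m `<=` B n) ->
  (forall y, V y <-> exists n, B n y) ->
  (\esum_(y in B n) f y)%E @[n --> \oo] --> (\esum_(y in V) f y)%E.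
Proof.
move=> f0 Bm BV.
have -> : (\esum_(y in V) f y)%E = ereal_sup (range (fun n => \esum_(y in B n) f y)%E).
  apply/le_anti/andP; split; last first.
    by apply: ge_ereal_sup => _ [n _ <-]; apply: esum_sub => // y yn; apply/BV; exists n.
  apply: ge_ereal_sup => _ [X [finX XV] <-].
  have /choice[g hg] : forall y, exists n, V y -> B n y.
    by move=> y; have [/BV[n ?]|?] := pselect (V y); [exists n|exists 0%N].
  have [M [d [_ hM]]] := @finite_nat_pos_bound R X g (fun=> 1) finX (fun=> ltr01).
  apply: (@le_trans _ _ (\esum_(y in B M) f y)%E); last first.
    by apply: ereal_sup_ubound; exists M.
  apply: esum_ge; exists X; last exact: lexx.
  split=> // y Xy; have [gM _] := hM _ Xy; apply: (Bm _ _ gM); apply: hg; exact: XV.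
apply: ereal_nondecreasing_cvgn => m n mn.
by apply: esum_sub => //; exact: Bm.
Qed.

(** The sum over the [r]-ball is an integral against the measurable kernel [count_measure], and by
    connectedness the balls exhaust the vertices as [r] grows. With [k = 0] the balls would be
    empty. *)
Lemma bor_sum (R : realType) (Xi : pseudoPMetricType R) k
    (phi : network Xi -> seq nat -> \bar R) :
  (0 < k)%N -> (forall G : rooted k.+1 Xi, 0 <= phi G (roots G))%E -> bor k.+1 phi ->
  bor k (fun G xs => \esum_(y in verts G) phi G (rcons xs y))%E.
Proof.
move=> k0 p0 bp; have [ip mp] := bp.
split.
  move=> G H /isomorphicP[f [g [h hr]]]; have [bf _ _ _ _] := h.
  rewrite (reindex_esum (verts G) (verts H) f)//; apply: eq_esum => y Gy.
  have [ff _ _] := bf; have Hy := ff _ Gy.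
  exact: (ip _ _ (isomorphic_push Gy Hy h hr)).
pose F (z : rooted_class k.+1 Xi) := phi (repr z) (roots (repr z)) : \bar R.
have FE (G : rooted k Xi) y : verts G y -> F (push_class G y) = phi (net G) (rcons (roots G) y).
  by move=> Gy; rewrite (push_classE Gy) /F (bor_pi (push Gy) bp).
apply: (@emeasurable_fun_cvg _ _ _ _ (fun r g => \int[count_measure r g]_z F z)%E) => //.
  move=> r; apply: measurable_fun_integral_kernel => //; last by move=> z; exact: p0.
  exact: measurable_count.
move=> g _.
rewrite (_ : (fun n => _) = fun n => (\esum_(y in rball (repr g) n) F (push_class (repr g) y))%E).
  rewrite (_ : (\esum_(y in _) _)%E = (\esum_(y in verts (repr g)) F (push_class (repr g) y))%E).
    apply: cvg_esum_bigcup => [y|m n mn|y].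
    - exact: p0.
    - exact: rball_le.
    - split=> [Gy|[n /rball_verts//]].
      have [r hr] := rooted_connected (roots_verts (repr g) (Ordinal k0)) Gy.
      by exists r, (Ordinal k0).
  by apply: eq_esum => y Gy; rewrite FE.
by apply/funext => r; rewrite /count_measure (integral_point_masses _ _ mp).
Qed.

Section bor_ops.
Variables (R : realType) (Xi : pseudoPMetricType R).
Implicit Types (phi psi : network Xi -> seq nat -> \bar R).

Lemma bor_map2 k (op : \bar R -> \bar R -> \bar R) phi psi :
  (forall d (T : measurableType d) (f g : T -> \bar R), measurable_fun setT f ->
     measurable_fun setT g -> measurable_fun setT (fun x => op (f x) (g x))) ->
  bor k phi -> bor k psi -> bor k (fun G xs => op (phi G xs) (psi G xs)).
Proof.
move=> hop [i1 m1] [i2 m2]; split=> [G H GH|]; first by rewrite (i1 _ _ GH) (i2 _ _ GH).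
exact: hop.
Qed.

Lemma bor_map1 k (op : \bar R -> \bar R) phi :
  measurable_fun setT op ->
  bor k phi -> bor k (fun G xs => op (phi G xs)).
Proof.
move=> mop [i1 m1]; split=> [G H GH|]; first by rewrite (i1 _ _ GH).
exact: measurableT_comp m1.
Qed.

Lemma bor_cst k (c : \bar R) : bor k (fun _ (_ : seq nat) => c : \bar R) (Xi := Xi).
Proof. by split=> //; exact: measurable_cst. Qed.

(** Whether the two roots coincide is already visible in the 0-balls, where the vertex map is
    injective; the functional is therefore locally constant. *)
Lemma bor_eq : bor 2 (fun (_ : network Xi) xs => ((nth 0%N xs 0 == nth 0%N xs 1)%:R)%:E : \bar R).
Proof.
have iE r S (G H : rooted 2 Xi) : sub_isomorphic S G (rball G r) H (rball H r) ->
    ((nth 0%N (roots G) 0) == (nth 0%N (roots G) 1)) = ((nth 0%N (roots H) 0) == (nth 0%N (roots H) 1)).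
  move=> [f [g [[_ fi _] _ _ /map_tuple_val hr _]]]; rewrite -hr.
  rewrite !(nth_map 0%N) ?size_tuple//; apply/eqP/eqP => [->//|].
  have mr (i : 'I_2) : nth 0%N (roots G) i \in rball G r.
    by rewrite -tnth_nth inE; exact: roots_rball.
  by apply: fi; [exact: (mr ord0)|exact: (mr (lift ord0 ord0))].
split.
  by move=> G H /(isomorphic_rball 0)/iE ->.
apply: (@borel_measurable_fun R 2 Xi _ (\bar R) _ _ (ErealGenOInfty.measurableE R)).
move=> _ [x ->]; apply/open_classP => G.
rewrite /preimage /= (iE _ _ _ _ (isomorphic_rball 0 (isomorphic_repr G))) => xG.
exists 0%N, 1; split=> // H /iE GH.
by rewrite (iE _ _ _ _ (isomorphic_rball 0 (isomorphic_repr H))) -GH.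
Qed.

End bor_ops.

Definition darts_between (Xi : Type) (G : network Xi) (x y : nat) : set nat :=
  [set d | [/\ darts G d, dsrc G d = x & dtgt G d = y]].

Lemma darts_between_finite (Xi : Type) (G : network Xi) x y :
  locally_finite G -> finite_set (darts_between G x y).
Proof.
move=> lG; have [Gx|nGx] := pselect (verts G x).
  by apply: sub_finite_set (lG _ Gx) => d [].
apply: sub_finite_set (finite_set0 _) => d [Dd dx _]; apply: nGx.
by rewrite -dx; exact: dsrc_verts.
Qed.

Lemma niso_darts_between Xi Xi' (S : Xi -> Xi' -> Prop)
    (G : network Xi) A (H : network Xi') B phi psi x y :
  niso S G A H B phi psi -> A x -> A y ->
  set_bij (darts_between G x y) (darts_between H (phi x) (phi y)) psi.
Proof.
move=> h Ax Ay; have tg := niso_tgt h.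
have [[fphi iphi _] [fpsi ipsi spsi] hd _ _] := h.
have inj v w : A v -> A w -> phi v = phi w -> v = w.
  by move=> Av Aw; apply: iphi; rewrite inE.
have sI d : darts_between G x y d -> induced_darts G A d.
  by move=> [Dd dx dy]; split=> //; [rewrite dx|rewrite dy].
split.
- move=> d dG; have Gd := sI _ dG; have [Dd' _ _] := fpsi _ Gd.
  have [e1 _] := hd _ Gd; have [_ dx dy] := dG.
  by split=> //; [rewrite e1 dx|rewrite tg// dy].
- by move=> d d'; rewrite !inE => /sI ? /sI ?; apply: ipsi; rewrite inE.
- move=> d' [Dd' d'x d'y].
  have [|d Gd e] := spsi d'.
    by split=> //; rewrite ?d'x ?d'y; exact: fphi.
  exists d => //; have [e1 _] := hd _ Gd; have e2 := tg _ Gd.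
  have [Dd As At] := Gd; split=> //.
    by apply: inj => //; rewrite -e1 e.
  by apply: inj => //; rewrite -e2 e.
Qed.

Section rate.
Variable R : realType.
Local Notation RP := (Rplus R).

Lemma rateE (G : network RP) x y :
  rate G x y = \sum_(d \in darts_between G x y) set_val (dmark G d).
Proof. by []. Qed.

Lemma Rplus_ge0 (a : RP) : 0 <= set_val a :> R.
Proof. by have := set_valP a; rewrite /= in_itv /= andbT. Qed.

Lemma Rplus_ball (a b : RP) e : ball a e b -> `|set_val a - set_val b : R| < e.
Proof. by []. Qed.

Lemma rate_niso S (G : network RP) A (H : network RP) B phi psi x y :
  niso S G A H B phi psi -> A x -> A y ->
  rate H (phi x) (phi y) = \sum_(d \in darts_between G x y) set_val (dmark H (psi d)).
Proof.
move=> h Ax Ay; rewrite rateE.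
have := niso_darts_between h Ax Ay.
exact: reindex_fsbig.
Qed.

Lemma rate_iso (G H : network RP) phi psi x y :
  niso eq G (verts G) H (verts H) phi psi -> verts G x -> verts G y ->
  rate H (phi x) (phi y) = rate G x y.
Proof.
move=> h Gx Gy; rewrite (rate_niso h Gx Gy) rateE; apply: eq_fsbigr => d.
rewrite inE => -[Dd dx dy]; have [_ _ _ _ hm] := h; rewrite hm//.
by split=> //; [rewrite dx|rewrite dy].
Qed.

(** Lower semicontinuity suffices. The union of the 0-balls of both roots induces all darts joining
    them, so radius 0 is enough and only the marks of finitely many darts vary. *)
Lemma bor_rate : bor 2 (fun (G : network RP) xs => (rate G (nth 0%N xs 0) (nth 0%N xs 1))%:E).
Proof.
have rv (G : rooted 2 RP) (i : 'I_2) : verts G (nth 0%N (roots G) i).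
  by rewrite -tnth_nth; exact: roots_verts.
have inv (G H : rooted 2 RP) : isomorphic G H ->
    rate G (nth 0%N (roots G) 0) (nth 0%N (roots G) 1) = rate H (nth 0%N (roots H) 0) (nth 0%N (roots H) 1).
  move=> /isomorphicP[f [g [h <-]]]; rewrite !(nth_map 0%N) ?size_tuple//.
  by rewrite (rate_iso h) => //; [exact: (rv G ord0)|exact: (rv G (lift ord0 ord0))].
split; first by move=> G H GH; congr EFin; exact: inv.
apply: (@borel_measurable_fun R 2 RP _ (\bar R) _ _ (ErealGenOInfty.measurableE R)).
move=> _ [a ->]; apply/open_classP => G.
rewrite preimage_itvoy /= (inv _ _ (isomorphic_repr G)) lte_fin.
set x := (nth 0%N (roots G) 0); set y := (nth 0%N (roots G) 1) => aG.
have finD := darts_between_finite x y (rooted_locally_finite (r := G)).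
pose N : R := (size (finmap.enum_fset (fset_set (darts_between G x y))))%:R.
(* Each of the [N] darts may lose at most [e], and [N * e] stays below the gap; the denominator
   [N + 1] also covers the case without darts. *)
pose e := (rate G x y - a) / (N + 1).
have e0 : 0 < e by rewrite divr_gt0 ?subr_gt0// ltr_wpDl// ler0n.
exists 0%N, e; split=> // H /sub_isomorphicP[f [g [h hr]]].
rewrite /preimage /= (inv _ _ (isomorphic_repr H)) lte_fin -hr.
rewrite !(nth_map 0%N) ?size_tuple// -/x -/y.
have mr (i : 'I_2) : nball G (roots G) 0 (nth 0%N (roots G) i).
  by rewrite -rballE -tnth_nth; exact: roots_rball.
have mx := mr ord0; have my := mr (lift ord0 ord0).
have [_ _ _ _ hm] := h.
rewrite (rate_niso h mx my).
suff : rate G x y - \sum_(d \in darts_between G x y) set_val (dmark H (g d)) <= N * e.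
  have : N * e < rate G x y - a.
    rewrite /e mulrCA -ltr_pdivlMl ?subr_gt0// mulVf ?gt_eqF ?subr_gt0//.
    by rewrite ltr_pdivrMr ?ltr_wpDl// ?ler0n// mul1r ltrDl.
  set u := N * e; set w := \sum_(_ \in _) _; move=> h1 h2; lra.
rewrite rateE !fsbig_finite//= -sumrB.
rewrite [leRHS](_ : _ = \sum_(d <- finmap.enum_fset (fset_set (darts_between G x y))) e); last first.
  by rewrite big_const_seq count_predT iter_addr_0 /N mulr_natl.
rewrite big_seq [leRHS]big_seq; apply: ler_sum => d.
rewrite in_fset_set// inE => -[Dd dx dy].
have Id : induced_darts G (nball G (roots G) 0) d.
  by split=> //; [rewrite dx; exact: mx|rewrite dy; exact: my].
have := hm _ Id => /Rplus_ball /ltW; apply: le_trans; exact: ler_norm.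
Qed.

End rate.

(** * Uniformization *)

Section egf.
Variable R : realType.
Implicit Types (c t s : R) (u : nat -> R).

Definition egf_coeff c u (m : nat) : R := c ^+ m / m`!%:R * u m.

Definition egf c u t : R := limn (pseries (egf_coeff c u) t).

Definition bounded01 u := forall m, 0 <= u m <= 1.

Lemma egf_cvg c u t : bounded01 u -> cvgn (pseries (egf_coeff c u) t).
Proof.
move=> u1; apply: normed_cvg.
apply: (series_le_cvg _ _ _ (is_cvg_series_exp_coeff `|c * t|)) => n /=.
- exact: normr_ge0.
- by rewrite /exp_coeff /= divr_ge0// ?exprn_ge0.
- rewrite /egf_coeff /exp_coeff/= !normrM normrX.
  have /andP[u0 un] := u1 n.
  rewrite (ger0_norm u0) -normrX normfV [`|n`!%:R|]ger0_norm// exprMn normrX normrX.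
  rewrite mulrAC -mulrA [leRHS]mulrAC ler_wpM2l ?divr_ge0 ?exprn_ge0//.
  by rewrite mulrC ler_piMl// exprn_ge0.
Qed.

(** Differentiating an exponential generating function shifts its sequence. Hence the generator of
    the walk enters through the recursion satisfied by [u]. *)
Lemma egf_coeff_diffs c u :
  pseries_diffs (egf_coeff c u) = (fun m => c * egf_coeff c (fun m => u m.+1) m).
Proof.
apply/funext => m; rewrite /pseries_diffs /egf_coeff factS natrM exprS.
have h1 : (m.+1%:R : R) != 0 by rewrite pnatr_eq0.
have h2 : (m`!%:R : R) != 0 by rewrite pnatr_eq0 -lt0n fact_gt0.
by field; rewrite h2 addrC natr1 h1.
Qed.

Lemma pseriesZ c (f : nat -> R) t : pseries (fun m => c * f m) t = c \*o pseries f t.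
Proof.
apply/funext => n; rewrite /pseries /series /= mulr_sumr; apply: eq_bigr => i _.
by rewrite mulrA.
Qed.

Lemma egf_derive c u t : bounded01 u ->
  is_derive t (1 : R) (egf c u) (c * egf c (fun m => u m.+1) t).
Proof.
move=> u1.
have u2 : bounded01 (fun m => u m.+1) by move=> m.
have u3 : bounded01 (fun m => u m.+2) by move=> m.
have c2 K : cvgn (pseries (pseries_diffs (egf_coeff c u)) K).
  by rewrite egf_coeff_diffs pseriesZ; apply: is_cvgMr; exact: egf_cvg.
have := @pseries_snd_diffs _ (egf_coeff c u) (`|t| + 1) t (@egf_cvg c u _ u1) (c2 _).
rewrite [in X in is_derive _ _ _ X]egf_coeff_diffs pseriesZ.
rewrite (_ : limn (c \*o _) = c * egf c (fun m => u m.+1) t); last first.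
  by apply/cvg_lim => //; apply: cvgMr; exact: egf_cvg.
apply; last by rewrite [ltRHS]ger0_norm ?addr_ge0// ltrDl.
rewrite egf_coeff_diffs (_ : pseries_diffs _ = fun m => c * pseries_diffs (egf_coeff c (fun m => u m.+1)) m).
  by rewrite egf_coeff_diffs !pseriesZ; do 2 apply: is_cvgMr; exact: egf_cvg.
by apply/funext => m; rewrite /pseries_diffs mulrCA.
Qed.

Lemma egf_sum c (I : Type) (r : seq I) (k : I -> R) (v : I -> nat -> R) w t :
  (forall i, bounded01 (v i)) -> (forall m, w m = \sum_(i <- r) k i * v i m) ->
  egf c w t = \sum_(i <- r) k i * egf c (v i) t.
Proof.
move=> hv wE; apply/cvg_lim => //.
rewrite (_ : pseries (egf_coeff c w) t =
    fun n => \sum_(i <- r) k i * pseries (egf_coeff c (v i)) t n).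
  by apply: cvg_big; [exact: add_continuous|move=> i _; apply: cvgMr; exact: egf_cvg].
apply/funext => n; rewrite /pseries /series/=.
under [RHS]eq_bigr do rewrite mulr_sumr.
rewrite exchange_big/=; apply: eq_bigr => m _.
rewrite /egf_coeff wE mulr_sumr mulr_suml; apply: eq_bigr => i _.
by rewrite mulrCA !mulrA.
Qed.

Lemma egf0 c u : egf c u 0 = u 0%N.
Proof.
apply/cvg_lim => //; apply/cvgrPdist_le => /= e e0; near=> n.
have n0 : (0 < n)%N by near: n; exists 1%N.
rewrite /pseries /series /= -(prednK n0) big_nat_recl//= big1 ?addr0.
  by rewrite expr0 mulr1 /egf_coeff expr0 fact0 divr1 mul1r subrr normr0 ltW.
by move=> i _; rewrite expr0n mulr0.
Unshelve. all: by end_near. Qed.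

Lemma egf_ge0 c u t : 0 <= c -> 0 <= t -> bounded01 u -> 0 <= egf c u t.
Proof.
move=> c0 t0 u1; apply: limr_ge; first exact: egf_cvg.
apply: nearW => n; apply: sumr_ge0 => i _; have /andP[ui _] := u1 i.
by rewrite mulr_ge0 ?exprn_ge0// mulr_ge0// divr_ge0// exprn_ge0.
Qed.

(* Distribution at time [t] of a rate-[c] Poisson clock sampling the sequence [u]. *)
Definition poissonized c u t : R := expR (- (c * t)) * egf c u t.

Lemma poissonized_derive c u t : bounded01 u ->
  is_derive t (1 : R) (poissonized c u)
    (c * (poissonized c (fun m => u m.+1) t - poissonized c u t)).
Proof.
move=> u1; have de := egf_derive c t u1.
apply: is_derive_eq; rewrite /poissonized /= /GRing.scale/=; ring.
Qed.

End egf.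

Section renewal.
Variable R : realType.
Local Notation leb := (@lebesgue_measure R).

Lemma is_derive_continuous (f : R -> R) (f' : R -> R) :
  (forall x, is_derive x (1 : R) f (f' x)) -> continuous f.
Proof.
move=> df x; apply: differentiable_continuous; apply/derivable1_diffP.
by have [] := df x.
Qed.

Lemma poissonized_continuous c (u : nat -> R) : bounded01 u -> continuous (poissonized c u).
Proof. by move=> u1; apply: is_derive_continuous => t; exact: poissonized_derive. Qed.

Lemma poissonized_sum c (I : Type) (r : seq I) (k : I -> R) (v : I -> nat -> R) w t :
  (forall i, bounded01 (v i)) -> (forall m, w m = \sum_(i <- r) k i * v i m) ->
  poissonized c w t = \sum_(i <- r) k i * poissonized c (v i) t.
Proof.
move=> hv wE; rewrite /poissonized (egf_sum c t hv wE) mulr_sumr.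
by apply: eq_bigr => i _; rewrite mulrCA.
Qed.

Lemma sojourn_continuous c D (r : seq nat) (k : nat -> R) (v : nat -> nat -> R) t :
  (forall z, bounded01 (v z)) ->
  continuous (fun s : R => expR (- (D * s)) *
    \sum_(z <- r) k z * poissonized c (v z) (t - s)).
Proof.
move=> v1 s.
apply: cvgM.
  apply: (@continuous_comp _ _ _ (fun s : R => - (D * s)) expR); last exact: continuous_expR.
  by apply: cvgN; apply: cvgMr; exact: cvg_id.
apply: cvg_big; first exact: add_continuous.
move=> z _; apply: cvgMr.
apply: (@continuous_comp _ _ _ (fun s : R => t - s) (poissonized c (v z))).
  by apply: cvgB; [exact: cvg_cst|exact: cvg_id].
exact: poissonized_continuous.
Qed.

(** Decomposition at the first jump, in the shape of the recursion defining [njump_prob]: [D] is the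
    exit rate, [c * k z] the rate of jumping to [z], and [u 0 = 0] says that some jump has to
    occur. *)
Lemma renewal_integral c D (r : seq nat) (k : nat -> R) (u : nat -> R)
    (v : nat -> nat -> R) t :
  c != 0 -> 0 <= t -> bounded01 u -> (forall z, bounded01 (v z)) -> u 0%N = 0 ->
  (forall m, u m.+1 = (1 - D / c) * u m + \sum_(z <- r) k z * v z m) ->
  (\int[leb]_(s in `[0%R, t]) (expR (- (D * s)) *
     \sum_(z <- r) (c * k z) * poissonized c (v z) (t - s))%:E = (poissonized c u t)%:E)%E.
Proof.
move=> c0 t0 u1 v1 u0 uS; rewrite le_eqVlt in t0; case/predU1P: t0 => [<-|t0].
  by rewrite set_itv1 integral_set1 /poissonized egf0 u0 mulr0.
pose f (s : R) : R := expR (- (D * s)) *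
  \sum_(z <- r) (c * k z) * poissonized c (v z) (t - s).
(* By [u m.+1 = (1 - D / c) * u m + ...], the derivative of [P] is the integrand. *)
pose P (s : R) : R := - (expR (- (D * s)) * poissonized c u (t - s)).
have dP s : is_derive s (1 : R) P (f s).
  have dB := poissonized_derive c (t - s) u1.
  have -> : f s = expR (- (D * s)) *
      (c * poissonized c (fun m => u m.+1) (t - s) + (D - c) * poissonized c u (t - s)).
    (* The index [None] stands for the holding term [(1 - D / c) * u m] and [Some z] for a jump to
       [z], so that the recursion becomes one linear combination. *)
    rewrite (@poissonized_sum c _ (None :: map some r)
      (fun i => if i is Some z then k z else 1 - D / c)
      (fun i => if i is Some z then v z else u) (fun m => u m.+1)).
    - rewrite /f big_cons big_map; congr (_ * _).
      under [in LHS]eq_bigr do rewrite -mulrA.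
      by rewrite -mulr_sumr; set S := \sum_(_ <- _) _; field.
    - by case.
    - by move=> m; rewrite big_cons big_map uS.
  have dC : is_derive s (1 : R) (poissonized c u \o (fun s : R => t - s))
     (- (c * (poissonized c (fun m => u m.+1) (t - s) - poissonized c u (t - s)))).
    have d1 : is_derive s (1 : R) (fun s : R => t - s) (-1).
      by apply: is_derive_eq; rewrite add0r mul1r.
    by apply: is_derive_eq; rewrite /GRing.scale/= ?mulN1r ?mulrN1.
  rewrite /P.
  apply: (@is_derive_eq _ _ _ (fun s : R => - (expR (- (D * s)) * (poissonized c u \o (fun s : R => t - s)) s))).
  rewrite /= /GRing.scale/=; ring.
have cP : continuous P by exact: is_derive_continuous dP.
rewrite (@continuous_FTC2 _ f P)//.
- by rewrite -EFinB /P subrr subr0 mulr0 !oppr0 expR0 mul1r /poissonized egf0 u0 !mulr0 oppr0 sub0r opprK.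
- by apply: continuous_subspaceT; exact: sojourn_continuous.
- split; first by move=> x _; have [] := dP x.
    by apply: cvg_at_right_filter; exact: cP.
  by apply: cvg_at_left_filter; exact: cP.
- by move=> x _; rewrite derive1E; have [_ ->] := dP x.
Qed.

End renewal.

Section finite_sums.
Variable R : realType.

Lemma fsum_setT (f : nat -> R) m :
  (forall z, (m <= z)%N -> f z = 0) -> \sum_(z \in [set: nat]) f z = \sum_(z < m) f z.
Proof.
move=> f0; rewrite fsbig_ord; apply/esym/fsbig_widen => // z [_ /= /negP].
by rewrite -leqNgt => /f0.
Qed.

Lemma esum_setT (f : nat -> \bar R) m : (forall z, 0 <= f z)%E ->
  (forall z, (m <= z)%N -> f z = 0%E) -> (\esum_(z in [set: nat]) f z = \sum_(z < m) f z)%E.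
Proof.
move=> f0 fm; rewrite fsbig_ord -esum_fset; [|exact: finite_II|by move=> *].
rewrite [RHS]esum_mkcond; apply: eq_esum => z _.
case: ifPn => //; rewrite notin_setE /= => /negP.
by rewrite -leqNgt => /fm.
Qed.

End finite_sums.

(** * Row-finite kernels and the uniformized step *)

Section kernels.
Variable R : realType.
Implicit Types (K L M : nat -> nat -> R) (V : pred nat).

(** Kernels live on all of [nat], whether vertices or not. Finite rows reduce every product to a
    finite sum, so associativity needs no summability. *)
Definition row_finite K := forall x, exists m, forall z, (m <= z)%N -> K x z = 0.

Definition kmul K L x y : R := \sum_(z \in [set: nat]) K x z * L z y.

(** The projection onto [V]: the zeroth power of a step killed outside [V], and a left unit for
    kernels whose rows vanish off [V]. *)
Definition kid V x y : R := ((y == x) && V x)%:R.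

Lemma kmulE K L x y m : (forall z, (m <= z)%N -> K x z = 0) ->
  kmul K L x y = \sum_(z < m) K x z * L z y.
Proof. by move=> K0; apply: fsum_setT => z /K0 ->; rewrite mul0r. Qed.

Lemma row_bound K (m : nat) : row_finite K ->
  exists k, forall x, (x < m)%N -> forall z, (k <= z)%N -> K x z = 0.
Proof.
move=> Kf; elim: m => [|m [k hk]]; first by exists 0%N.
have [N hN] := Kf m; exists (maxn k N) => x.
rewrite ltnS leq_eqVlt => /predU1P[->|xm] z; rewrite geq_max => /andP[zk zN].
  exact: hN.
exact: (hk _ xm).
Qed.

Lemma row_finite_kmul K L : row_finite K -> row_finite L -> row_finite (kmul K L).
Proof.
move=> Kf Lf x; have [m hm] := Kf x; have [k hk] := row_bound m Lf.
exists k => z kz; rewrite (kmulE _ _ hm) big1// => i _.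
by rewrite (hk i) ?mulr0.
Qed.

Lemma kmulA K L M : row_finite K -> row_finite L ->
  forall x y, kmul (kmul K L) M x y = kmul K (kmul L M) x y.
Proof.
move=> Kf Lf x y; have [m hm] := Kf x; have [n hn] := row_bound m Lf.
rewrite (kmulE _ _ hm) (@kmulE _ _ _ _ n).
  under eq_bigr do rewrite (kmulE _ _ hm) mulr_suml.
  rewrite exchange_big; apply: eq_bigr => i _.
  rewrite (kmulE _ _ (hn i (ltn_ord i))) mulr_sumr.
  by apply: eq_bigr => j _; rewrite mulrA.
by move=> z nz; rewrite (kmulE _ _ hm) big1// => i _; rewrite (hn i) ?mulr0.
Qed.

Lemma kmul_ge0 K L : (forall x y, 0 <= K x y) -> (forall x y, 0 <= L x y) ->
  forall x y, 0 <= kmul K L x y.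
Proof. by move=> K0 L0 x y; apply: fsumr_ge0 => z _; exact: mulr_ge0. Qed.

Lemma kmul_idl V K x y : kmul (kid V) K x y = if V x then K x y else 0.
Proof.
rewrite (@kmulE _ _ _ _ x.+1); last first.
  by move=> z xz; rewrite /kid gtn_eqF.
rewrite big_ord_recr /= big1 ?add0r.
  by rewrite /kid eqxx /=; case: ifP; rewrite (mul0r,mul1r).
by move=> i _; rewrite /kid ltn_eqF ?mul0r//=.
Qed.

Lemma row_finite_kid V : row_finite (kid V).
Proof. by move=> x; exists x.+1 => z xz; rewrite /kid gtn_eqF. Qed.

Lemma row_finite_sub K L : (forall x y, K x y = 0 -> L x y = 0) -> row_finite K -> row_finite L.
Proof. by move=> KL Kf x; have [m hm] := Kf x; exists m => z /hm/KL. Qed.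

End kernels.

Section killed_kernel.
Variable R : realType.
Variables (V : pred nat) (w : nat -> nat -> R) (c : R).
Implicit Types (x y z : nat).

Definition off_diag x y : R := if y == x then 0 else w x y.

Definition exit_rate x : R := \sum_(y \in [set: nat]) off_diag x y.

(* One step of the uniformization, at rate [c], of the walk with jump rates [w] *)
(* killed when it leaves [V].                                                   *)
Definition step x y : R :=
  if V x && V y then (if y == x then 1 - exit_rate x / c else w x y / c) else 0.

Definition step_off x y : R := if y == x then 0 else step x y.

(* Weight of the [m]-step paths from [x] to [y] with exactly [n] genuine jumps. *)
Fixpoint jump_weight (m n : nat) x y : R :=
  match m with
  | 0 => (n == 0%N)%:R * kid R V x y
  | m'.+1 => step x x * jump_weight m' n x y +
      (if n is n'.+1 then kmul step_off (jump_weight m' n') x y else 0)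
  end.

Fixpoint step_pow (m : nat) x y : R :=
  match m with
  | 0 => kid R V x y
  | m'.+1 => kmul step (step_pow m') x y
  end.

Hypotheses (w_ge0 : forall x y, 0 <= w x y) (w_fin : row_finite w) (c_gt0 : 0 < c)
  (exit_le : forall x, V x -> exit_rate x <= c).

Lemma off_fin : row_finite off_diag.
Proof. by apply: row_finite_sub w_fin => x y xy; rewrite /off_diag xy if_same. Qed.

Lemma exit_rate_ge0 x : 0 <= exit_rate x.
Proof. by apply: fsumr_ge0 => y _; rewrite /off_diag; case: ifP. Qed.

Lemma step_ge0 x y : 0 <= step x y.
Proof.
rewrite /step; case: ifP => // /andP[Vx _]; case: ifP => _; last by rewrite divr_ge0// ltW.
by rewrite subr_ge0 ler_pdivrMr// mul1r exit_le.
Qed.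

Lemma step_off_ge0 x y : 0 <= step_off x y.
Proof. by rewrite /step_off; case: ifP => // _; exact: step_ge0. Qed.

Lemma step_off_fin : row_finite step_off.
Proof.
apply: row_finite_sub w_fin => x y xy; rewrite /step_off; case: ifPn => // /negPf yx.
by rewrite /step yx xy mul0r if_same.
Qed.

Lemma stepE x y : step x y = (if y == x then step x x else 0) + step_off x y.
Proof. by rewrite /step_off; case: eqP => [->|]; rewrite (addr0,add0r). Qed.

Lemma step_fin : row_finite step.
Proof.
move=> x; have [m hm] := step_off_fin x; exists (maxn m x.+1) => z.
by rewrite geq_max => /andP[mz xz]; rewrite stepE gtn_eqF// add0r hm.
Qed.

Lemma kmul_step L x y : kmul step L x y = step x x * L x y + kmul step_off L x y.
Proof.
have [m hm] := step_off_fin x.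
have h1 z : (maxn m x.+1 <= z)%N -> step_off x z = 0.
  by rewrite geq_max => /andP[/hm].
have h2 z : (maxn m x.+1 <= z)%N -> step x z = 0.
  move=> h; rewrite stepE h1// addr0; move: h; rewrite geq_max => /andP[_ xz].
  by rewrite gtn_eqF.
rewrite (kmulE _ _ h1) (kmulE _ _ h2).
under eq_bigr do rewrite stepE mulrDl.
rewrite big_split /=; congr (_ + _).
have xm : (x < maxn m x.+1)%N by rewrite leq_max leqnn orbT.
rewrite (bigD1 (Ordinal xm))//= eqxx big1 ?addr0// => i.
by rewrite -val_eqE /= => /negPf ->; rewrite mul0r.
Qed.

Lemma step_off_sum m x : (forall z, (m <= z)%N -> w x z = 0) ->
  V x -> \sum_(z < m) step_off x z <= exit_rate x / c.
Proof.
move=> hm Vx; rewrite /exit_rate (@fsum_setT R _ m); last first.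
  by move=> z /hm xz; rewrite /off_diag xz if_same.
rewrite mulr_suml; apply: ler_sum => z _.
rewrite /step_off /off_diag; case: ifPn => [_|zx]; first by rewrite mul0r.
by rewrite /step Vx (negPf zx) /=; case: ifP => // _; rewrite divr_ge0// ltW.
Qed.

Lemma kmul_step_off_le1 L x y : V x -> (forall x y, 0 <= L x y <= 1) ->
  kmul step_off L x y <= exit_rate x / c.
Proof.
move=> Vx L1; have [m hm] := w_fin x.
have h z : (m <= z)%N -> step_off x z = 0.
  by move=> /hm xz; rewrite /step_off /step xz mul0r; do 3 case: ifP => //.
rewrite (kmulE _ _ h); apply: le_trans (step_off_sum hm Vx).
apply: ler_sum => z _; have /andP[_ L1'] := L1 z y.
by rewrite ler_piMr// step_off_ge0.
Qed.

Lemma step_diag x : V x -> step x x = 1 - exit_rate x / c.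
Proof. by move=> Vx; rewrite /step Vx eqxx. Qed.

Lemma step_out x y : ~~ V x -> step x y = 0.
Proof. by move=> /negPf Vx; rewrite /step Vx. Qed.

Lemma kmul_step_off_out L x y : ~~ V x -> kmul step_off L x y = 0.
Proof.
by move=> Vx; apply: fsbig1 => z _; rewrite /step_off step_out// if_same mul0r.
Qed.

(** From a vertex of [V] one step holds with weight [1 - D / c] and jumps with total weight at most
    [D / c]; killing only loses mass. So the bound 1 is preserved. *)
Lemma jump_weight01 m n x y : 0 <= jump_weight m n x y <= 1.
Proof.
elim: m n x y => [|m IH] n x y /=.
  by rewrite /kid -natrM mulnb ler0n lern1 leq_b1.
have J0 n' x' y' : 0 <= jump_weight m n' x' y' by have /andP[] := IH n' x' y'.
apply/andP; split.
  rewrite addr_ge0 ?mulr_ge0 ?step_ge0//.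
  by case: n => // n; apply: kmul_ge0; [exact: step_off_ge0|exact: J0].
have [Vx|Vx] := boolP (V x); last first.
  by rewrite step_out// mul0r add0r; case: n => // n; rewrite kmul_step_off_out// ler01.
have h1 : step x x * jump_weight m n x y <= 1 - exit_rate x / c.
  by rewrite -step_diag// ler_piMr ?step_ge0//; have /andP[] := IH n x y.
have h2 : (if n is n'.+1 then kmul step_off (jump_weight m n') x y else 0) <= exit_rate x / c.
  case: n {h1} => [|n]; first by rewrite divr_ge0 ?exit_rate_ge0// ltW.
  exact: kmul_step_off_le1.
by apply: le_trans (lerD h1 h2) _; rewrite subrK.
Qed.

Lemma jump_weight_gt m n x y : (m < n)%N -> jump_weight m n x y = 0.
Proof.
elim: m n x y => [|m IH] n x y /=; first by case: n => // n; rewrite mul0r.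
case: n => // n mn; rewrite IH ?mulr0 ?add0r; last exact: ltnW.
by apply: fsbig1 => z _; rewrite IH ?mulr0.
Qed.

Lemma jump_weight_out m n x y : ~~ V x -> jump_weight m n x y = 0.
Proof.
move=> Vx; case: m => [|m] /=; first by rewrite /kid (negPf Vx) andbF mulr0.
by rewrite step_out// mul0r add0r; case: n => // n; rewrite kmul_step_off_out.
Qed.

(** Paths of [m] steps are sorted by their number of genuine jumps, which is at most [m]; the slack
    [m <= N] lets the induction use one cutoff for all lengths. *)
Lemma sum_jump_weight m N x y : (m <= N)%N ->
  \sum_(n < N.+1) jump_weight m n x y = step_pow m x y.
Proof.
elim: m N x y => [|m IH] N x y mN /=.
  by rewrite big_ord_recl/= mul1r big1 ?addr0// => i _; rewrite mul0r.
case: N mN => // N mN.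
rewrite kmul_step -(IH N.+1)//; last exact: ltnW.
rewrite mulr_sumr big_split /=; congr (_ + _).
rewrite big_ord_recl add0r /=.
have [k hk] := step_off_fin x; rewrite (kmulE _ _ hk).
under eq_bigr do rewrite (kmulE _ _ hk).
by rewrite exchange_big /=; apply: eq_bigr => z _; rewrite -mulr_sumr IH.
Qed.

Lemma kmul_step_le1 L x y : (forall x y, 0 <= L x y <= 1) -> kmul step L x y <= 1.
Proof.
move=> L1; rewrite kmul_step.
have [Vx|Vx] := boolP (V x); last first.
  by rewrite step_out// mul0r add0r kmul_step_off_out// ler01.
have h1 : step x x * L x y <= 1 - exit_rate x / c.
  by rewrite -step_diag// ler_piMr ?step_ge0//; have /andP[] := L1 x y.
by apply: le_trans (lerD h1 (kmul_step_off_le1 y Vx L1)) _; rewrite subrK.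
Qed.

Lemma step_pow01 m x y : 0 <= step_pow m x y <= 1.
Proof.
elim: m x y => [|m IH] x y /=; first by rewrite /kid ler0n lern1 leq_b1.
by rewrite kmul_step_le1// andbT kmul_ge0// => x' y'; [exact: step_ge0|have /andP[] := IH x' y'].
Qed.

End killed_kernel.

(** * The killed walk and the minimal process *)

Section walk.
Variables (R : realType) (G : network (Rplus R)).
Hypothesis lfG : locally_finite G.
Local Notation leb := (@lebesgue_measure R).
Local Notation w := (rate G).

Lemma rate_ge0 x y : 0 <= w x y.
Proof. by rewrite rateE; apply: fsumr_ge0 => d _; exact: Rplus_ge0. Qed.

Lemma rate_dart x y : w x y != 0 -> exists2 d, darts G d & dsrc G d = x /\ dtgt G d = y.
Proof.
move=> xy; have [[d [Dd dx dy]]|nd] := pselect (exists d, darts_between G x y d).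
  by exists d.
exfalso; move/eqP: xy; apply; rewrite rateE fsbig1// => d dxy; exfalso.
by apply: nd; exists d.
Qed.

Lemma rate_out x y : ~ verts G y -> w x y = 0.
Proof.
move=> Gy; apply/eqP; apply: contra_notT Gy => /rate_dart[d Dd [_ <-]].
exact/dsrc_verts/drev_darts.
Qed.

Lemma rate_fin : row_finite w.
Proof.
move=> x; have [Gx|nGx] := pselect (verts G x); last first.
  exists 0%N => z _; apply/eqP; apply: contra_notT nGx => /rate_dart[d Dd [<- _]].
  exact: dsrc_verts.
have fx : finite_set (dtgt G @` [set d | darts G d /\ dsrc G d = x]).
  by apply: finite_image; exact: lfG.
have [M [d [_ hM]]] := @finite_nat_pos_bound R _ id (fun=> 1) fx (fun=> ltr01).
exists M.+1 => z Mz; apply/eqP; apply: contraTT Mz => /rate_dart[e De [ex ez]].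
have [|+ _] := hM z; first by exists e.
by rewrite -ltnNge ltnS.
Qed.

Lemma total_rateE x : total_rate G x = exit_rate w x.
Proof.
rewrite /exit_rate /total_rate.
rewrite -(@fsbig_widen _ _ _ _ (verts G `\ x) setT)//.
  apply: eq_fsbigr => y; rewrite inE => -[_ /eqP yx].
  by rewrite /off_diag (negPf yx).
move=> y [_ /= hy]; rewrite /off_diag; case: eqP => // yx.
by apply: rate_out => Gy; apply: hy; split.
Qed.

Lemma njump_prob_ge0 n t x y : (0 <= njump_prob G n t x y)%E.
Proof.
elim: n t x => [|n IH] t x /=; first by case: ifP => // _; rewrite lee_fin expR_ge0.
apply: integral_ge0 => s _; apply: mule_ge0; first by rewrite lee_fin expR_ge0.
apply: esum_ge0 => z _; apply: mule_ge0; last exact: IH.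
by rewrite lee_fin rate_ge0.
Qed.

Lemma njump_sum_finite n s x y m : (forall z, (m <= z)%N -> w x z = 0) ->
  (\esum_(z in verts G `\ x) ((w x z)%:E * njump_prob G n s z y) =
   \sum_(z < m) ((off_diag w x z)%:E * njump_prob G n s z y))%E.
Proof.
move=> hm; rewrite esum_mkcond -(@esum_setT R
  (fun z => (off_diag w x z)%:E * njump_prob G n s z y)%E m).
- apply: eq_esum => z _; rewrite /off_diag; case: ifPn.
    by rewrite inE => -[_ /eqP/negPf ->].
  rewrite notin_setE => hz; case: eqP => [_|zx]; first by rewrite mul0e.
  by rewrite rate_out ?mul0e// => Gz; apply: hz; split.
- move=> z; apply: mule_ge0; last exact: njump_prob_ge0.
  by rewrite lee_fin /off_diag; case: ifP => // _; exact: rate_ge0.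
- by move=> z /hm xz; rewrite /off_diag xz if_same mul0e.
Qed.

(* Probability that the walk killed outside [V] is at [y] after [n] jumps. *)
Definition killed_njump (V : pred nat) c n t x y : R :=
  poissonized c (fun m => jump_weight V w c m n x y) t.

Section killed.
Variables (V : pred nat) (c : R).
Hypotheses (c_gt0 : 0 < c) (exit_le : forall x, V x -> exit_rate w x <= c).

Let jw01 n x y : bounded01 (fun m => jump_weight V w c m n x y).
Proof. move=> m; apply: jump_weight01 => //; [exact: rate_ge0|exact: rate_fin]. Qed.

Lemma killed_njump_ge0 n t x y : 0 <= t -> 0 <= killed_njump V c n t x y.
Proof.
by move=> t0; rewrite mulr_ge0 ?expR_ge0// egf_ge0// ?ltW//.
Qed.

Lemma killed_njump_out n t x y : ~~ V x -> killed_njump V c n t x y = 0.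
Proof.
move=> Vx; rewrite /killed_njump (@poissonized_sum _ _ _ [::] (fun=> 0) (fun _ : nat => fun=> 0)).
- by rewrite big_nil.
- by move=> i m; rewrite lexx ler01.
- by move=> m; rewrite big_nil jump_weight_out.
Qed.

(** Without jumps the weights are the powers of [1 - D / c], whose generating function is
    [exp ((c - D) t)]; the factor [exp (- c t)] leaves the exponential holding time. *)
Lemma killed_njump0 t x y : V x ->
  killed_njump V c 0 t x y = if x == y then expR (- (total_rate G x * t)) else 0.
Proof.
move=> Vx; rewrite /killed_njump /poissonized.
have jwE m : jump_weight V w c m 0 x y = (y == x)%:R * (1 - exit_rate w x / c) ^+ m.
  elim: m => [|m /= ->]; first by rewrite /= mul1r mulr1 /kid Vx andbT.
  by rewrite addr0 step_diag// exprS mulrCA.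
rewrite /egf.
rewrite (_ : pseries _ t = (y == x)%:R \*o series (exp_coeff ((c - exit_rate w x) * t))); last first.
  apply/funext => k; rewrite /pseries/series/= mulr_sumr; apply: eq_bigr => m _.
  rewrite /egf_coeff jwE /exp_coeff/= mulrCA -!mulrA; congr (_ * _).
  rewrite (_ : c - exit_rate w x = c * (1 - exit_rate w x / c)); last first.
    by field; exact: lt0r_neq0.
  by rewrite !exprMn; ring.
rewrite (_ : limn _ = (y == x)%:R * expR ((c - exit_rate w x) * t)); last first.
  by apply/cvg_lim => //; apply: cvgMr; exact: is_cvg_series_exp_coeff.
rewrite mulrCA -expRD total_rateE eq_sym; case: eqP => _; rewrite (mul1r,mul0r)//.
by congr expR; ring.
Qed.

Lemma killed_njumpS n t x y m : V x -> 0 <= t -> (forall z, (m <= z)%N -> w x z = 0) ->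
  (\int[leb]_(s in `[0%R, t]) (expR (- (total_rate G x * s)) *
     \sum_(0 <= z < m) (c * step_off V w c x z) * killed_njump V c n (t - s) z y)%:E =
   (killed_njump V c n.+1 t x y)%:E)%E.
Proof.
move=> Vx t0 hm; rewrite total_rateE.
apply: (@renewal_integral R c (exit_rate w x) (index_iota 0 m) (step_off V w c x)
  (fun k => jump_weight V w c k n.+1 x y) (fun z k => jump_weight V w c k n z y)) => //.
- exact: lt0r_neq0.
- exact: mul0r.
- move=> k /=; rewrite step_diag// big_mkord (@kmulE _ _ _ _ _ m)// => z /hm xz.
  by rewrite /step_off; case: ifPn => // /negPf zx; rewrite /step zx xz mul0r if_same.
Qed.

End killed.

Lemma rate_gball x z n : w x z != 0 -> gball G z n `<=` gball G x n.+1.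
Proof.
move=> /rate_dart[d Dd [dx dz]] v zv; rewrite -add1n.
by apply: gball_trans zv; right; exists d; split=> //; rewrite dx.
Qed.

(** A walk making [n] jumps stays in the [n]-ball of its starting point, so killing outside a set
    that contains this ball is not noticed. *)
Lemma njump_prob_killed n t x y (V : pred nat) c : 0 < c -> (forall z, V z -> exit_rate w z <= c) ->
  0 <= t -> verts G x -> (forall z, gball G x n z -> V z) ->
  njump_prob G n t x y = (killed_njump V c n t x y)%:E.
Proof.
move=> c0 Vc; elim: n t x => [|n IH] t x t0 Gx xV.
  by rewrite /= (killed_njump0 c0)//; [case: ifP|exact: xV].
have Vx : V x by apply: xV; apply: (gballS (leq0n n.+1)).
have [m hm] := rate_fin x.
rewrite -(killed_njumpS c0 Vc n y Vx t0 hm) /=; apply: eq_integral => s.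
rewrite inE /= in_itv /= => /andP[s0 st].
rewrite (njump_sum_finite _ _ _ hm) EFinM; congr (_ * _)%E.
rewrite big_mkord -sumEFin; apply: eq_bigr => z _.
rewrite EFinM /off_diag /step_off; case: ifPn => zx; first by rewrite mulr0 !mul0e.
have [xz|xz] := eqVneq (w x z) 0.
  by rewrite /step (negPf zx) xz mul0r if_same mulr0 !mul0e.
have Gz : verts G z by apply: contrapT => /(rate_out x)/eqP; rewrite (negPf xz).
have Vz : V z by apply/xV/(rate_gball xz); apply: (gballS (leq0n n)).
rewrite IH//; last 2 first.
- by rewrite subr_ge0.
- by move=> v /(rate_gball xz); exact: xV.
rewrite /step Vx Vz /= (negPf zx).
by rewrite mulrCA divff ?mulr1// lt0r_neq0.
Qed.

Lemma finite_exit_bound (A : set nat) : finite_set A ->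
  exists c, 0 < c /\ forall z, A z -> exit_rate w z <= c.
Proof.
move=> /finite_seqP[s ->]; elim: s => [|a s [c [c0 hc]]]; first by exists 1.
exists (Num.max c (exit_rate w a)); split; first by rewrite lt_max c0.
by move=> z /=; rewrite inE le_max => /predU1P[->|/hc ->]; rewrite ?lexx ?orbT.
Qed.

(** The ball itself is finite, hence has bounded exit rates and can serve as [V]. This exhibits each
    [njump_prob] as a finite, continuous function of time. *)
Lemma njump_prob_killedE n x : verts G x -> exists (V : pred nat) c,
  [/\ 0 < c, (forall z, V z -> exit_rate w z <= c), (forall z, gball G x n z -> V z) &
   forall t y, 0 <= t -> njump_prob G n t x y = (killed_njump V c n t x y)%:E].
Proof.
move=> Gx; have [c [c0 hc]] := finite_exit_bound (gball_finite n lfG Gx).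
exists (fun z => `[< gball G x n z >]), c; split=> //.
- by move=> z /asboolP /hc.
- by move=> z /asboolP.
- move=> t y t0; apply: njump_prob_killed => //; first by move=> z /asboolP /hc.
  by move=> z /asboolP.
Qed.

(** Both sides are expressed by killed walks, the right one with a set [V'] large enough for
    equality. The two first-jump integrands are then continuous and can be compared pointwise by
    induction. *)
Lemma killed_njump_le n t x y (V : pred nat) c : 0 < c -> (forall z, V z -> exit_rate w z <= c) ->
  0 <= t -> verts G x -> ((killed_njump V c n t x y)%:E <= njump_prob G n t x y)%E.
Proof.
move=> c0 Vc; elim: n t x => [|n IH] t x t0 Gx.
  have [Vx|Vx] := boolP (V x); last by rewrite killed_njump_out// njump_prob_ge0.
  by rewrite (killed_njump0 c0)//=; case: ifP.
have [Vx|Vx] := boolP (V x); last by rewrite killed_njump_out// njump_prob_ge0.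
have [V' [c' [c'0 V'c xV' eq']]] := njump_prob_killedE n.+1 Gx.
have [m hm] := rate_fin x.
have V'x : V' x by apply: xV'; apply: (gballS (leq0n n.+1)).
rewrite eq'// -(killed_njumpS c0 Vc n y Vx t0 hm) -(killed_njumpS c'0 V'c n y V'x t0 hm).
have jw01 (U : pred nat) e : 0 < e -> (forall z, U z -> exit_rate w z <= e) ->
    forall z, bounded01 (fun k => jump_weight U w e k n z y).
  by move=> e0 Ue z k; apply: jump_weight01 => //; [exact: rate_ge0|exact: rate_fin].
have mf (U : pred nat) e : 0 < e -> (forall z, U z -> exit_rate w z <= e) ->
    measurable_fun `[0, t] (fun s : R => (expR (- (total_rate G x * s)) *
     \sum_(0 <= z < m) (e * step_off U w e x z) * killed_njump U e n (t - s) z y)%:E).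
  move=> e0 Ue; apply/measurable_EFinP; apply: measurable_funTS.
  apply: continuous_measurable_fun.
  exact: (sojourn_continuous (v := fun z k => jump_weight U w e k n z y) (jw01 _ _ e0 Ue)).
have pos (U : pred nat) e s : 0 < e -> (forall z, U z -> exit_rate w z <= e) -> `[0, t]%classic s ->
    (0 <= (expR (- (total_rate G x * s)) *
     \sum_(0 <= z < m) (e * step_off U w e x z) * killed_njump U e n (t - s) z y)%:E)%E.
  move=> e0 Ue; rewrite /= in_itv/= => /andP[s0 st].
  rewrite lee_fin mulr_ge0 ?expR_ge0// sumr_ge0// => z _; rewrite mulr_ge0//.
    by rewrite mulr_ge0 ?(ltW e0)// step_off_ge0//; exact: rate_ge0.
  by apply: killed_njump_ge0 => //; rewrite subr_ge0.
apply: ge0_le_integral => //.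
- by move=> s; exact: pos.
- exact: mf.
- exact: mf.
- move=> s; rewrite /= in_itv/= => /andP[s0 st].
  rewrite lee_fin ler_wpM2l ?expR_ge0//; apply: ler_sum => z _.
  have ts0 : 0 <= t - s by rewrite subr_ge0.
  have [->|zx] := eqVneq z x; first by rewrite /step_off eqxx !mulr0 !mul0r.
  have [xz|xz] := eqVneq (w x z) 0.
    by rewrite /step_off (negPf zx) /step xz (negPf zx) !mul0r !if_same !mulr0 !mul0r.
  have Gz : verts G z by apply: contrapT => /(rate_out x)/eqP; rewrite (negPf xz).
  have V'z : V' z by apply/xV'/(rate_gball xz); apply: (gballS (leq0n n)).
  have h : killed_njump V c n (t - s) z y <= killed_njump V' c' n (t - s) z y.
    rewrite -lee_fin -(njump_prob_killed y c'0 V'c ts0 Gz); first exact: IH.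
    by move=> v /(rate_gball xz); exact: xV'.
  apply: ler_pM => //.
  + by rewrite mulr_ge0 ?(ltW c0)// step_off_ge0//; exact: rate_ge0.
  + exact: killed_njump_ge0.
  (* Multiplied by its own clock rate, an off-diagonal step is the jump rate itself, or 0 if the
     jump is killed, whatever the clock rate. *)
  + rewrite /step_off (negPf zx) /step V'x V'z Vx (negPf zx) /=.
    rewrite [leRHS]mulrCA divff ?lt0r_neq0// mulr1; case: ifP => _.
      by rewrite mulrCA divff ?lt0r_neq0// mulr1.
    by rewrite mulr0 rate_ge0.
Qed.

End walk.

Definition poisson_weight (R : realType) (c t : R) (m : nat) : R :=
  expR (- (c * t)) * (c ^+ m / m`!%:R * t ^+ m).

Lemma poisson_weight_ge0 (R : realType) (c t : R) m : 0 <= c -> 0 <= t ->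
  0 <= poisson_weight c t m.
Proof. by move=> c0 t0; rewrite !mulr_ge0 ?expR_ge0 ?exprn_ge0 ?invr_ge0. Qed.

Lemma EFin_poissonized (R : realType) (c t : R) (u : nat -> R) : bounded01 u ->
  ((poissonized c u t)%:E = \sum_(m <oo) (poisson_weight c t m * u m)%:E)%E.
Proof.
move=> u1.
have h : (fun n => expR (- (c * t)) * pseries (egf_coeff c u) t n) @ \oo -->
    poissonized c u t by apply: cvgMr; exact: egf_cvg.
rewrite -(cvg_lim _ h)// -EFin_lim; last by apply/cvg_ex; eexists; exact: h.
apply: congr_lim; apply/funext => n /=; rewrite sumEFin; congr EFin.
rewrite /pseries /series /= mulr_sumr; apply: eq_bigr => m _; rewrite /egf_coeff /poisson_weight; ring.
Qed.

Section killed_transition.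
Variables (R : realType) (G : network (Rplus R)).
Hypothesis lfG : locally_finite G.
Local Notation w := (rate G).

Definition killed_trans (w : nat -> nat -> R) (V : pred nat) c t x y : R :=
  poissonized c (fun m => step_pow V w c m x y) t.

(** Tonelli for the number [m] of clock ticks and the number [n] of genuine jumps; for given [m]
    only [n <= m] contributes. *)
Lemma killed_trans_sum (V : pred nat) c t x y : 0 < c ->
  (forall z, V z -> exit_rate w z <= c) -> 0 <= t ->
  ((killed_trans w V c t x y)%:E = \sum_(n <oo) (killed_njump G V c n t x y)%:E)%E.
Proof.
move=> c0 Vc t0.
have w0 := @rate_ge0 R G; have wf := rate_fin lfG.
have j1 n : bounded01 (fun m => jump_weight V w c m n x y).
  by move=> m; exact: jump_weight01.
rewrite EFin_poissonized; last by move=> m; exact: step_pow01.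
under [RHS]eq_eseriesr do rewrite EFin_poissonized//.
have p0 m n : (0 <= (poisson_weight c t m * jump_weight V w c m n x y)%:E)%E.
  by rewrite lee_fin mulr_ge0 ?poisson_weight_ge0 ?(ltW c0)//; have /andP[] := j1 n m.
rewrite nneseries_interchange; last by move=> n m; exact: p0.
apply: eq_eseriesr => m _; rewrite nneseries_esumT; last by move=> n; exact: p0.
rewrite (@esum_setT R _ m.+1); [|by move=> n; exact: p0|]; last first.
  by move=> n mn; rewrite jump_weight_gt// mulr0.
by rewrite sumEFin -mulr_sumr (sum_jump_weight V c wf x y (leqnn m)).
Qed.

Lemma killed_trans_le (V : pred nat) c t x y : 0 < c ->
  (forall z, V z -> exit_rate w z <= c) -> 0 <= t -> verts G x ->
  ((killed_trans w V c t x y)%:E <= trans_prob G t x y)%E.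
Proof.
move=> c0 Vc t0 Gx; rewrite killed_trans_sum//; apply: lee_nneseries => n _.
  by rewrite lee_fin killed_njump_ge0.
exact: killed_njump_le.
Qed.

(** The threshold [N.+1] instead of [N] keeps the clock rate positive for every [N]. *)
Definition exit_below (w : nat -> nat -> R) (N : nat) : pred nat :=
  fun z => exit_rate w z <= N.+1%:R.

(** Killing only decreases the probabilities, and a partial sum over numbers of jumps is not
    affected once the threshold exceeds the exit rates in finitely many balls. The lower limit is
    the form in which Fatou's lemma uses it. *)
Lemma trans_prob_limn_einf t x y : 0 <= t -> verts G x ->
  trans_prob G t x y =
  limn_einf (fun N => (killed_trans w (exit_below w N) (2 * N.+1%:R) t x y)%:E).
Proof.
move=> t0 Gx; set q := fun N => _%:E.
have c0 N : 0 < 2 * N.+1%:R :> R by rewrite mulr_gt0.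
have Vc N z : exit_below w N z -> exit_rate w z <= 2 * N.+1%:R.
  by move=> h; apply: (le_trans h); rewrite mulr_natl mulr2n lerDl ler0n.
rewrite limn_einf_lim; apply/le_anti/andP; split; last first.
  apply: lime_le; first exact: is_cvg_einfs.
  apply: nearW => N; apply: (@le_trans _ _ (q N)); last exact: (killed_trans_le y (c0 N) (Vc N) t0 Gx).
  by apply: ereal_inf_lbound; exists N => /=.
apply: lime_le; first by apply: is_cvg_nneseries => n _ _; exact: njump_prob_ge0.
apply: nearW => k.
have fk : finite_set (\bigcup_(n in `I_k) gball G x n).
  by apply: bigcup_finite => [|n _]; [exact: finite_II|exact: gball_finite].
(* For the first [k] terms the walk sees only this finite union of balls; from the threshold [N0]
   on, all of it survives. *)
have [c [_ hc]] := finite_exit_bound G fk.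
have [N0 hN0] : exists N0 : nat, c <= N0.+1%:R.
  by exists (Num.trunc c); apply/ltW; exact: truncnS_gt.
apply: (@le_trans _ _ (einfs q N0)); last first.
  have := ereal_nondecreasing_cvgn (nondecreasing_einfs q) => /cvg_lim -> //.
  by apply: ereal_sup_ubound; exists N0.
apply: le_ereal_inf_tmp => _ [N /= NN0 <-].
rewrite /q killed_trans_sum//; last exact: Vc.
apply: (@le_trans _ _ (\sum_(0 <= n < k) (killed_njump G (exit_below w N) (2 * N.+1%:R) n t x y)%:E)%E).
  rewrite !big_mkord; apply: lee_sum => n _; rewrite (@njump_prob_killed R G lfG n t x y (exit_below w N) (2 * N.+1%:R))//.
    exact: Vc.
  move=> z nz; rewrite /exit_below; apply: (le_trans (hc z _)); first by exists n => /=.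
  by apply: (le_trans hN0); rewrite ler_nat ltnS.
apply: nneseries_lim_ge => n _ _.
by rewrite lee_fin killed_njump_ge0//; exact: Vc.
Qed.

End killed_transition.

(** * Positive semidefinite kernels *)

Section psd.
Variable R : realType.
Implicit Types (S K M : nat -> nat -> R).

Definition ksym S := forall x y, S x y = S y x.

Definition off_abs S x y : R := if y == x then 0 else `|S x y|.

Definition diag_dominant S := forall x, \sum_(y \in [set: nat]) off_abs S x y <= S x x.

(** Initial segments of [nat] are enough, since a vector of finite support extends by zero to such a
    segment. *)
Definition psd M := ksym M /\
  forall m (u : nat -> R), 0 <= \sum_(i < m) \sum_(j < m) u i * M i j * u j.

Lemma off_abs_ge0 S x y : 0 <= off_abs S x y.
Proof. by rewrite /off_abs; case: ifP. Qed.

Lemma off_abs_sym S x y : ksym S -> off_abs S x y = off_abs S y x.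
Proof. by move=> Ss; rewrite /off_abs eq_sym Ss. Qed.

Lemma off_abs_fin S : row_finite S -> row_finite (off_abs S).
Proof. by apply: row_finite_sub => x y xy; rewrite /off_abs xy normr0 if_same. Qed.

Lemma diag_dominant_bound S x m : row_finite S -> diag_dominant S ->
  \sum_(y < m) off_abs S x y <= S x x.
Proof.
move=> Sf Sd; apply: le_trans (Sd x); have [k hk] := off_abs_fin Sf x.
rewrite (@fsum_setT R _ (maxn k m)); last by move=> z; rewrite geq_max => /andP[/hk].
rewrite -!(big_mkord xpredT (off_abs S x)) (@big_cat_nat _ _ _ m 0 (maxn k m))//=; last exact: leq_maxr.
by rewrite lerDl sumr_ge0// => i _; exact: off_abs_ge0.
Qed.

(** Each cross term is at least [- |S i j| (u i ^ 2 + u j ^ 2) / 2]; symmetry turns the sum of these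
    bounds into full row sums against [u i ^ 2], which the diagonal dominates. *)
Lemma psd_diag_dominant S : ksym S -> row_finite S -> diag_dominant S -> psd S.
Proof.
move=> Ss Sf Sd; split=> // m u.
have h (i j : 'I_m) : (j == i)%:R * (S i i * u i ^+ 2) -
    off_abs S i j * ((u i ^+ 2 + u j ^+ 2) / 2) <= u i * S i j * u j.
  rewrite /off_abs -val_eqE; have [/val_inj ->|ji] := eqVneq (val j) (val i).
    by rewrite mul1r mul0r subr0 expr2 mulrCA mulrA.
  rewrite mul0r sub0r; set a := S i j; set p := u i; set q := u j.
  have h1 : - `|a| <= a by rewrite lerNl -normrN ler_norm.
  have h2 : a <= `|a| by exact: ler_norm.
  rewrite -subr_ge0 opprK.
  (* Completing squares: one of the coefficients [|a| + a] and [|a| - a] vanishes according to the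
     sign of [a], and neither is negative. *)
  rewrite (_ : _ + _ = ((`|a| + a) * (p + q) ^+ 2 + (`|a| - a) * (p - q) ^+ 2) / 4); last by field.
  have a1 : 0 <= `|a| + a by lra.
  have a2 : 0 <= `|a| - a by lra.
  by apply: divr_ge0 => //; apply: addr_ge0; apply: mulr_ge0 => //; exact: sqr_ge0.
apply: le_trans (ler_sum _ (fun i _ => ler_sum _ (fun j _ => h i j))).
have -> : \sum_(i < m) \sum_(j < m) ((j == i)%:R * (S i i * u i ^+ 2) -
    off_abs S i j * ((u i ^+ 2 + u j ^+ 2) / 2)) =
    \sum_(i < m) u i ^+ 2 * (S i i - \sum_(j < m) off_abs S i j).
  have e1 : \sum_(i < m) \sum_(j < m) (j == i)%:R * (S i i * u i ^+ 2) =
      \sum_(i < m) u i ^+ 2 * S i i.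
    apply: eq_bigr => i _; rewrite (bigD1 i)//= eqxx mul1r big1 ?addr0 1?mulrC// => j.
    by move=> /negPf ->; rewrite mul0r.
  have e2 : \sum_(i < m) \sum_(j < m) off_abs S i j * u j ^+ 2 =
      \sum_(i < m) \sum_(j < m) off_abs S i j * u i ^+ 2.
    rewrite exchange_big; apply: eq_bigr => i _; apply: eq_bigr => j _.
    by rewrite off_abs_sym.
  have e3 : \sum_(i < m) \sum_(j < m) off_abs S i j * ((u i ^+ 2 + u j ^+ 2) / 2) =
      \sum_(i < m) \sum_(j < m) off_abs S i j * u i ^+ 2.
    have -> : \sum_(i < m) \sum_(j < m) off_abs S i j * ((u i ^+ 2 + u j ^+ 2) / 2) =
      (\sum_(i < m) \sum_(j < m) off_abs S i j * u i ^+ 2 +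
       \sum_(i < m) \sum_(j < m) off_abs S i j * u j ^+ 2) / 2.
      rewrite -big_split mulr_suml; apply: eq_bigr => i _.
      rewrite -big_split mulr_suml; apply: eq_bigr => j _ /=; by field.
    by rewrite e2; field.
  under eq_bigr do rewrite sumrB.
  rewrite sumrB e1 e3 -sumrB; apply: eq_bigr => i _.
  by rewrite mulrBr mulr_sumr; congr (_ - _); apply: eq_bigr => j _; rewrite mulrC.
apply: sumr_ge0 => i _; rewrite mulr_ge0 ?sqr_ge0// subr_ge0.
exact: diag_dominant_bound.
Qed.

Lemma diag_dominant_kid V : diag_dominant (kid R V).
Proof.
move=> x; rewrite fsbig1; first by rewrite /kid ler0n.
by move=> y _; rewrite /off_abs /kid; case: eqP => //= _; rewrite normr0.
Qed.

Lemma psd_kid V : psd (kid R V).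
Proof.
apply: psd_diag_dominant; [|exact: row_finite_kid|exact: diag_dominant_kid].
by move=> x y; rewrite /kid eq_sym; case: eqP => [->|].
Qed.

(** As [K] is symmetric, the form of [K M K] at [u] is the form of [M] at [K u]. The vector [K u]
    has finite support because finitely many rows of [K] do. *)
Lemma psd_congruence K M : ksym K -> row_finite K -> psd M ->
  psd (kmul K (kmul M K)).
Proof.
move=> Ks Kf [Ms Mp].
have E m : exists k, forall i j, (i < m)%N -> (j < m)%N ->
    kmul K (kmul M K) i j = \sum_(z < k) \sum_(z' < k) K i z * M z z' * K j z'.
  have [k hk] := row_bound m Kf; exists k => i j im jm.
  rewrite (kmulE _ _ (hk i im)); apply: eq_bigr => z _.
  rewrite /kmul (@fsum_setT R _ k); last by move=> z' kz'; rewrite Ks (hk j) ?mulr0.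
  by rewrite mulr_sumr; apply: eq_bigr => z' _; rewrite (Ks z') mulrA.
split.
  move=> x y; have [k hk] := E (maxn x y).+1.
  rewrite !hk ?ltnS ?leq_maxl ?leq_maxr// exchange_big; apply: eq_bigr => z _.
  by apply: eq_bigr => z' _; rewrite (Ms z') mulrAC [in RHS]mulrAC [K y _ * _]mulrC.
move=> m u; have [k hk] := E m.
rewrite (_ : \sum_(i < m) _ = \sum_(z < k) \sum_(z' < k)
    (\sum_(i < m) u i * K i z) * M z z' * (\sum_(j < m) u j * K j z')).
  exact: (Mp k (fun z => \sum_(i < m) u i * K i z)).
under eq_bigr => i _.
  under eq_bigr => j _.
    rewrite hk// mulr_sumr mulr_suml.
    under eq_bigr => z _ do rewrite mulr_sumr mulr_suml.
    over.
  rewrite exchange_big /=.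
  under eq_bigr => z _ do rewrite exchange_big /=.
  over.
rewrite exchange_big; apply: eq_bigr => z _ /=.
rewrite exchange_big; apply: eq_bigr => z' _ /=.
rewrite mulr_suml mulr_suml; apply: eq_bigr => i _.
rewrite mulr_sumr; apply: eq_bigr => j _; ring.
Qed.

Lemma psd_diag_ge0 M x : psd M -> 0 <= M x x.
Proof.
move=> [_ /(_ x.+1 (fun i => (i == x)%:R))].
rewrite big_ord_recr /= big1 ?add0r; last first.
  by move=> i _; rewrite big1// => j _; rewrite ltn_eqF ?mul0r.
rewrite big_ord_recr /= big1 ?add0r ?eqxx ?mul1r ?mulr1//.
by move=> i _; rewrite (@ltn_eqF i x) ?mulr0.
Qed.

(** The form is evaluated at [delta_x + e delta_y] with [e = 1] and [e = -1]; the computation allows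
    [x = y]. *)
Lemma psd_off_diag M x y : psd M -> `|M x y| <= (M x x + M y y) / 2.
Proof.
move=> [Ms Mp].
have key e : 0 <= M x x + e * M x y + e * (M y x + e * M y y).
  have sumd (f : nat -> R) m z : (z < m)%N -> \sum_(i < m) (i == z :> nat)%:R * f i = f z.
    move=> zm; rewrite (bigD1 (Ordinal zm))//= eqxx mul1r big1 ?addr0// => i.
    by rewrite -val_eqE /= => /negPf ->; rewrite mul0r.
  have := Mp (maxn x y).+1 (fun i => (i == x)%:R + e * (i == y)%:R).
  set m := (maxn x y).+1.
  have xm : (x < m)%N by rewrite ltnS leq_maxl.
  have ym : (y < m)%N by rewrite ltnS leq_maxr.
  rewrite (eq_bigr (fun i : 'I_m => (i == x :> nat)%:R * (M i x + e * M i y) +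
      (i == y :> nat)%:R * (e * (M i x + e * M i y)))); last first.
    move=> i _.
    rewrite (eq_bigr (fun j : 'I_m => (j == x :> nat)%:R * (((i == x :> nat)%:R + e * (i == y :> nat)%:R) * M i j) +
      (j == y :> nat)%:R * (e * (((i == x :> nat)%:R + e * (i == y :> nat)%:R) * M i j)))); last first.
      by move=> j _; ring.
    rewrite big_split /= (sumd (fun j => _ * M i j) m x xm).
    rewrite (sumd (fun j => e * (_ * M i j)) m y ym); ring.
  rewrite big_split /= (sumd (fun i => M i x + e * M i y) m x xm).
  by rewrite (sumd (fun i => e * (M i x + e * M i y)) m y ym).
have h1 := key 1; have h2 := key (-1); rewrite ler_norml (Ms y x) in h1 h2 *.
by apply/andP; split; lra.
Qed.

(** The pointwise half of trace positivity: every off-diagonal entry of [M] is replaced by the mean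
    of two diagonal ones. What remains on the left has nonnegative mean once mass transport
    exchanges [M y y] for [M x x]. *)
Lemma kmul_diag_ge S M x : ksym S -> row_finite S -> psd M ->
  S x x * M x x - \sum_(y \in [set: nat]) off_abs S x y * ((M x x + M y y) / 2) <= kmul S M x x.
Proof.
move=> Ss Sf Mp; have [k hk] := Sf x.
have h z : (maxn k x.+1 <= z)%N -> S x z = 0 by rewrite geq_max => /andP[/hk].
rewrite (kmulE _ _ h) (@fsum_setT R _ (maxn k x.+1)); last first.
  by move=> z /h xz; rewrite /off_abs xz normr0 if_same mul0r.
have xm : (x < maxn k x.+1)%N by rewrite leq_max leqnn orbT.
rewrite (bigD1 (Ordinal xm))//= /off_abs eqxx mul0r add0r.
rewrite [leRHS](bigD1 (Ordinal xm))//= lerD2l -sumrN; apply: ler_sum => y.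
rewrite -val_eqE /= => /negPf ->.
have := psd_off_diag y x Mp; rewrite addrC => My.
rewrite lerNl -(mulrN (S x y)) (le_trans (ler_norm _))// normrM normrN.
by rewrite ler_wpM2l.
Qed.

End psd.

Section kernel_algebra.
Variable R : realType.
Implicit Types (A B K L : nat -> nat -> R).

Definition ksub A B x y : R := A x y - B x y.

Lemma row_finite_ksub A B : row_finite A -> row_finite B -> row_finite (ksub A B).
Proof.
move=> Af Bf x; have [m hm] := Af x; have [k hk] := Bf x.
by exists (maxn m k) => z; rewrite geq_max => /andP[/hm az /hk bz]; rewrite /ksub az bz subr0.
Qed.

Lemma kmul_subl A B L : row_finite A -> row_finite B ->
  kmul (ksub A B) L = ksub (kmul A L) (kmul B L).
Proof.
move=> Af Bf; apply/funext => x; apply/funext => y.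
have [m hm] := Af x; have [k hk] := Bf x.
have ha z : (maxn m k <= z)%N -> A x z = 0 by rewrite geq_max => /andP[/hm].
have hb z : (maxn m k <= z)%N -> B x z = 0 by rewrite geq_max => /andP[_ /hk].
rewrite /ksub (kmulE _ _ ha) (kmulE _ _ hb) -sumrB (@kmulE _ _ _ _ _ (maxn m k)).
  by apply: eq_bigr => z _; rewrite mulrBl.
by move=> z zk; rewrite ha// hb// subr0.
Qed.

Lemma kmul_subr K A B : row_finite K -> kmul K (ksub A B) = ksub (kmul K A) (kmul K B).
Proof.
move=> Kf; apply/funext => x; apply/funext => y; have [m hm] := Kf x.
rewrite /ksub !(kmulE _ _ hm) -sumrB; by apply: eq_bigr => z _; rewrite mulrBr.
Qed.

Lemma kmul_assoc K L A : row_finite K -> row_finite L ->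
  kmul (kmul K L) A = kmul K (kmul L A).
Proof. by move=> Kf Lf; apply/funext => x; apply/funext => y; exact: kmulA. Qed.

Lemma ksym_ksub A B : ksym A -> ksym B -> ksym (ksub A B).
Proof. by move=> As Bs x y; rewrite /ksub As Bs. Qed.

End kernel_algebra.

(** * Words in two symmetric kernels *)

Section words.
Variables (R : realType) (V : pred nat) (X Y : nat -> nat -> R).

Definition letter (b : bool) := if b then X else Y.

(** Products are kept as words in [X] (true) and [Y] (false) because words have entries in [[0, 1]];
    expressions in [X - Y] are expanded into words before means are taken. *)
Fixpoint kword (l : seq bool) : nat -> nat -> R :=
  if l is b :: l' then kmul (letter b) (kword l') else kid R V.

Hypotheses (l_ge0 : forall b x y, 0 <= letter b x y)
  (l_sym : forall b, ksym (letter b)) (l_fin : forall b, row_finite (letter b))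
  (l_dd : forall b, diag_dominant (letter b))
  (l_supp : forall b x y, ~~ V x -> letter b x y = 0)
  (l_contr : forall b L x y, (forall x y, 0 <= L x y <= 1) -> kmul (letter b) L x y <= 1).

Lemma kword_fin l : row_finite (kword l).
Proof. elim: l => [|b l IH] /=; [exact: row_finite_kid|exact: row_finite_kmul]. Qed.

Lemma kword01 l x y : 0 <= kword l x y <= 1.
Proof.
elim: l x y => [|b l IH] x y /=; first by rewrite /kid ler0n lern1 leq_b1.
by rewrite l_contr// andbT kmul_ge0// => x' y'; have /andP[] := IH x' y'.
Qed.

Lemma kword_supp l x y : ~~ V x -> kword l x y = 0.
Proof.
move=> Vx; case: l => [|b l] /=; first by rewrite /kid (negPf Vx) andbF.
by apply: fsbig1 => z _; rewrite l_supp ?mul0r.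
Qed.

Lemma kmul_kidl L : (forall x y, ~~ V x -> L x y = 0) -> kmul (kid R V) L = L.
Proof.
move=> Ls; apply/funext => x; apply/funext => y; rewrite kmul_idl.
by case: ifPn => // Vx; rewrite Ls.
Qed.

Lemma kword1 b : kword [:: b] = letter b.
Proof.
apply/funext => x; apply/funext => y /=; have [m hm] := l_fin b x.
have h z : (maxn m y.+1 <= z)%N -> letter b x z = 0 by rewrite geq_max => /andP[/hm].
have ym : (y < maxn m y.+1)%N by rewrite leq_max leqnn orbT.
rewrite (kmulE _ _ h) (bigD1 (Ordinal ym))//= big1 ?addr0.
  rewrite /kid eqxx /=; have [Vy|Vy] := boolP (V y); first by rewrite mulr1.
  by rewrite mulr0 l_sym l_supp.
by move=> i; rewrite -val_eqE /= eq_sym /kid => /negPf ->; rewrite mulr0.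
Qed.

Lemma kword_cat l1 l2 : kword (l1 ++ l2) = kmul (kword l1) (kword l2).
Proof.
elim: l1 => [|b l1 IH] /=; first by rewrite kmul_kidl// => x y; exact: kword_supp.
by rewrite IH kmul_assoc//; exact: kword_fin.
Qed.

Lemma kword_cons_rcons b l : kword (b :: rcons l b) = kmul (letter b) (kmul (kword l) (letter b)).
Proof. by rewrite /= -cats1 kword_cat kword1. Qed.

(** Lengths 0 and 1 are diagonally dominant, and [b^(n+2)] is the congruence of [b^n] by [b]; hence
    the induction by two. *)
Lemma psd_nseq b n : psd (kword (nseq n b)).
Proof.
have [k] := ubnP n; elim: k n => // k IH [|[|n]] nk.
- exact: psd_kid.
- by rewrite /nseq/= -[kmul _ _]/(kword [:: b]) kword1; exact: psd_diag_dominant.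
- have -> : nseq n.+2 b = b :: rcons (nseq n b) b by elim: n {nk} => //= n [->].
  rewrite kword_cons_rcons; apply: psd_congruence => //; apply: IH.
  by rewrite -ltnS ltnW.
Qed.

Definition kdiff := ksub X Y.

Lemma kdiff_kmul l : kmul kdiff (kword l) = ksub (kword (true :: l)) (kword (false :: l)).
Proof. by rewrite /kdiff kmul_subl//; [exact: (l_fin true)|exact: (l_fin false)]. Qed.

Definition sandwich a j b1 b2 := nseq a true ++ b1 :: nseq j false ++ b2 :: nseq a true.

(* [X^a (X - Y) Y^j (X - Y) X^a], expanded so that its entries are sums of words. *)
Definition square_kernel a j :=
  ksub (ksub (kword (sandwich a j true true)) (kword (sandwich a j true false)))
       (ksub (kword (sandwich a j false true)) (kword (sandwich a j false false))).

Lemma sandwichS a j b1 b2 : sandwich a.+1 j b1 b2 = true :: rcons (sandwich a j b1 b2) true.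
Proof.
rewrite /sandwich /=; congr cons; rewrite !rcons_cat rcons_cons rcons_cat rcons_cons.
by congr (_ ++ _ :: _ ++ _ :: _); elim: a => //= a ->.
Qed.

(** Starting from the psd kernel [Y^j], one congruence by [X - Y] and then [a] congruences by
    [X]. *)
Lemma psd_square_kernel a j : psd (square_kernel a j).
Proof.
elim: a => [|a IH].
  have -> : square_kernel 0 j = kmul kdiff (kmul (kword (nseq j false)) kdiff).
    have e b : kmul (kword (nseq j false)) (letter b) = kword (nseq j false ++ [:: b]).
      by rewrite kword_cat kword1.
    rewrite {2}/kdiff kmul_subr; last exact: kword_fin.
    rewrite (e true) (e false) kmul_subr; last first.
      by apply: row_finite_ksub; [exact: (l_fin true)|exact: (l_fin false)].
    by rewrite !kdiff_kmul /square_kernel /sandwich /=; apply/funext => x; apply/funext => y;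
      rewrite /ksub; lra.
  apply: psd_congruence; last exact: psd_nseq.
  - by apply: ksym_ksub; [exact: (l_sym true)|exact: (l_sym false)].
  - by apply: row_finite_ksub; [exact: (l_fin true)|exact: (l_fin false)].
have -> : square_kernel a.+1 j = kmul X (kmul (square_kernel a j) X).
  have Xf : row_finite X by exact: (l_fin true).
  rewrite {2}/square_kernel !kmul_subl;
    try (by apply: row_finite_ksub; exact: kword_fin); try exact: kword_fin.
  rewrite !kmul_subr//.
  by rewrite /square_kernel !sandwichS !(kword_cons_rcons true).
by apply: psd_congruence => //; [exact: (l_sym true)|exact: (l_fin true)].
Qed.

Lemma ksym_nseq_true e : (e <= 1)%N -> ksym (kword (nseq e true)).
Proof.
case: e => [|[|//]] _; first by have [] := @psd_kid R V.
by rewrite kword1; exact: l_sym.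
Qed.

Lemma diag_dominant_nseq e : (e <= 1)%N -> diag_dominant (kword (nseq e true)).
Proof.
case: e => [|[|//]] _; first exact: diag_dominant_kid.
by rewrite kword1; exact: l_dd.
Qed.

Lemma kmul_square_kernel l a j : kmul (kword l) (square_kernel a j) =
  ksub (ksub (kword (l ++ sandwich a j true true)) (kword (l ++ sandwich a j true false)))
       (ksub (kword (l ++ sandwich a j false true)) (kword (l ++ sandwich a j false false))).
Proof.
rewrite /square_kernel kmul_subr; last exact: kword_fin.
by rewrite !kmul_subr ?kword_cat//; exact: kword_fin.
Qed.

End words.

(** * Equivariant Borel kernels *)

Section bor_real.
Variables (R : realType) (Xi : pseudoPMetricType R).
Implicit Types (K L : network Xi -> nat -> nat -> R) (f g : network Xi -> nat -> R).

Definition bor_fun f := bor 1 (fun G xs => (f G (nth 0%N xs 0))%:E).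

Definition bor_ker K := bor 2 (fun G xs => (K G (nth 0%N xs 0) (nth 0%N xs 1))%:E).

Lemma bor_ker_at k (i j : 'I_k) K : bor_ker K ->
  bor k (fun G xs => (K G (nth 0%N xs i) (nth 0%N xs j))%:E).
Proof. exact: (@bor_reroot R Xi k [:: i; j]). Qed.

Lemma bor_fun_at k (i : 'I_k) f : bor_fun f -> bor k (fun G xs => (f G (nth 0%N xs i))%:E).
Proof. exact: (@bor_reroot R Xi k [:: i]). Qed.

Lemma bor_ker_swap K : bor_ker K -> bor_ker (fun G x y => K G y x).
Proof. exact: (@bor_ker_at 2 (lift ord0 ord0) ord0 K). Qed.

Lemma bor_ker_diag K : bor_ker K -> bor_fun (fun G x => K G x x).
Proof. exact: (@bor_ker_at 1 ord0 ord0 K). Qed.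

Lemma bor_fun_left f : bor_fun f -> bor_ker (fun G x y => f G x).
Proof. exact: (@bor_fun_at 2 ord0 f). Qed.

Lemma bor_fun_right f : bor_fun f -> bor_ker (fun G x y => f G y).
Proof. exact: (@bor_fun_at 2 (lift ord0 ord0) f). Qed.

Lemma bor_kerD K L : bor_ker K -> bor_ker L -> bor_ker (fun G x y => K G x y + L G x y).
Proof. apply: (bor_map2 (op := fun a b => (a + b)%E)) => *; exact: emeasurable_funD. Qed.

Lemma bor_kerB K L : bor_ker K -> bor_ker L -> bor_ker (fun G x y => K G x y - L G x y).
Proof. apply: (bor_map2 (op := fun a b => (a - b)%E)) => *; exact: emeasurable_funB. Qed.

Lemma bor_kerM K L : bor_ker K -> bor_ker L -> bor_ker (fun G x y => K G x y * L G x y).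
Proof. apply: (bor_map2 (op := fun a b => (a * b)%E)) => *; exact: emeasurable_funM. Qed.

Lemma bor_ker_cst (a : R) : bor_ker (fun _ _ _ => a).
Proof. exact: bor_cst. Qed.

Lemma bor_ker_eq : bor_ker (fun _ x y => (y == x)%:R).
Proof.
have := bor_eq Xi; apply: bor_ext => G; by rewrite eq_sym.
Qed.

Lemma bor_funB f g : bor_fun f -> bor_fun g -> bor_fun (fun G x => f G x - g G x).
Proof. apply: (bor_map2 (op := fun a b => (a - b)%E)) => *; exact: emeasurable_funB. Qed.

Lemma bor_ker_map2 (op : \bar R -> \bar R -> \bar R) (op' : R -> R -> R) K L :
  (forall d (T : measurableType d) (f g : T -> \bar R), measurable_fun setT f ->
     measurable_fun setT g -> measurable_fun setT (fun x => op (f x) (g x))) ->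
  (forall a b, op a%:E b%:E = (op' a b)%:E) ->
  bor_ker K -> bor_ker L -> bor_ker (fun G x y => op' (K G x y) (L G x y)).
Proof.
move=> mop opE bK bL; have := bor_map2 mop bK bL.
by apply: bor_ext => G; rewrite opE.
Qed.

Lemma bor_fun_le f (a : R) : bor_fun f -> bor_fun (fun G x => (f G x <= a)%R%:R).
Proof.
move=> bf; pose op (b : \bar R) : \bar R := (\1_[set c | (c <= a%:E)%E] b)%:E.
have mop : measurable_fun setT op.
  apply/measurable_EFinP; apply: measurable_indic.
  rewrite (_ : [set c | _] = [set` `]-oo, a%:E]]); first exact: emeasurable_itv.
  by apply/seteqP; split => c /=; rewrite in_itv.
have := bor_map1 mop bf; apply: bor_ext => G.
rewrite /op indicE; congr ((nat_of_bool _)%:R%:E).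
by apply/idP/idP; rewrite inE /= lee_fin.
Qed.

(** These conditions make the sum over vertices in [bor_sum] agree with the finite sum over [nat] in
    [kmul], so the class is closed under products. Local finiteness is required explicitly since [K]
    is defined on bare networks. *)
Definition good_kernel K := [/\ bor_ker K, (forall G, locally_finite G -> forall x y, 0 <= K G x y),
  (forall G, locally_finite G -> row_finite (K G)) &
  (forall G, locally_finite G -> forall x y, verts G x -> ~ verts G y -> K G x y = 0)].

Lemma EFin_sum_verts (G : network Xi) (F : nat -> R) :
  (forall z, 0 <= F z) -> (exists m, forall z, (m <= z)%N -> F z = 0) ->
  (forall z, ~ verts G z -> F z = 0) ->
  (\esum_(z in verts G) (F z)%:E = (\sum_(z \in [set: nat]) F z)%:E)%E.
Proof.
move=> F0 [m hm] Fv; rewrite (fsum_setT hm) -sumEFin.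
rewrite -(@esum_setT R (fun z => (F z)%:E) m) => [||z /hm ->//].
  rewrite esum_mkcond; apply: eq_esum => z _; case: ifPn => //.
  by rewrite notin_setE => /Fv ->.
by move=> z; rewrite lee_fin.
Qed.

Lemma bor_row_sum K : good_kernel K -> bor_fun (fun G x => \sum_(y \in [set: nat]) K G x y).
Proof.
move=> [bK K0 Kf Kv].
have := @bor_sum R Xi 1 (fun G xs => (K G (nth 0%N xs 0) (nth 0%N xs 1))%:E) isT.
have h0 (G : rooted 2 Xi) : (0 <= (K G (nth 0%N (roots G) 0) (nth 0%N (roots G) 1))%:E)%E.
  by rewrite lee_fin; apply: K0; exact: rooted_locally_finite.
move=> /(_ h0 bK); apply: bor_ext => G.
have Gx : verts G (nth 0%N (roots G) 0).
  by have := roots_verts G ord0; rewrite (tnth_nth 0%N).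
have lG := rooted_locally_finite (r := G).
rewrite -(@EFin_sum_verts G).
- by apply: eq_esum => y _; rewrite !nth_rcons size_tuple.
- exact: K0.
- exact: Kf.
- by move=> z; exact: Kv.
Qed.

Lemma good_kmul K L : good_kernel K -> good_kernel L ->
  good_kernel (fun G => kmul (K G) (L G)).
Proof.
move=> [bK K0 Kf Kv] [bL L0 Lf Lv]; split.
(* The intermediate vertex of the product is put last, because [bor_sum] sums over the last root. *)
- have b3 : bor 3 (fun G xs => ((K G (nth 0%N xs 0) (nth 0%N xs 2))%:E *
                               (L G (nth 0%N xs 2) (nth 0%N xs 1))%:E)%E).
    have k02 := @bor_ker_at 3 ord0 (inord 2) K bK.
    have k21 := @bor_ker_at 3 (inord 2) (inord 1) L bL.
    rewrite !inordK // in k02 k21.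
    by apply: (bor_map2 (op := fun a b => (a * b)%E)) k02 k21 => *; exact: emeasurable_funM.
  have h0 (G : rooted 3 Xi) : (0 <= (K G (nth 0%N (roots G) 0) (nth 0%N (roots G) 2))%:E *
                               (L G (nth 0%N (roots G) 2) (nth 0%N (roots G) 1))%:E)%E.
    have lG := rooted_locally_finite (r := G).
    by rewrite mule_ge0 ?lee_fin; [|exact: K0|exact: L0].
  have := @bor_sum R Xi 2 _ isT h0 b3; apply: bor_ext => G.
  have Gx : verts G (nth 0%N (roots G) 0).
    by have := roots_verts G ord0; rewrite (tnth_nth 0%N).
  rewrite /kmul -(@EFin_sum_verts G).
  + by apply: eq_esum => y _; rewrite !nth_rcons size_tuple.
  + by have lG := rooted_locally_finite (r := G) => z; rewrite mulr_ge0 ?K0 ?L0.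
  + have [m hm] := Kf _ (rooted_locally_finite (r := G)) (nth 0%N (roots G) 0).
    by exists m => z /hm ->; rewrite mul0r.
  + by have lG := rooted_locally_finite (r := G) => z Gz; rewrite Kv ?mul0r.
- by move=> G lG; apply: kmul_ge0; [exact: K0|exact: L0].
- by move=> G lG; apply: row_finite_kmul; [exact: Kf|exact: Lf].
- move=> G lG x y Gx Gy; apply: fsbig1 => z _.
  by have [Gz|Gz] := pselect (verts G z); [rewrite Lv ?mulr0|rewrite Kv ?mul0r].
Qed.

End bor_real.

Section step_facts.
Variables (R : realType) (V : pred nat) (c : R).
Hypothesis c_gt0 : 0 < c.
Implicit Types w : nat -> nat -> R.

Lemma step_sym w : ksym w -> ksym (step V w c).
Proof.
by move=> ws x y; rewrite /step andbC (eq_sym y); case: ifP => // _; case: eqP => [->//|]; rewrite ws.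
Qed.

(** The off-diagonal mass is at most [D / c] and the diagonal is [1 - D / c]; the comparison of the
    two is exactly [D <= c / 2]. *)
Lemma step_diag_dominant w : (forall x y, 0 <= w x y) -> row_finite w ->
  (forall x, V x -> exit_rate w x <= c / 2) -> diag_dominant (step V w c).
Proof.
move=> w0 wf Vc x.
have [Vx|Vx] := boolP (V x); last first.
  rewrite fsbig1 ?step_out// => y _; rewrite /off_abs step_out//.
  by rewrite normr0 if_same.
have [m hm] := wf x.
have h z : (m <= z)%N -> step_off V w c x z = 0.
  move=> /hm xz; rewrite /step_off; case: ifPn => // /negPf zx.
  by rewrite /step zx xz mul0r if_same.
have -> : off_abs (step V w c) x = step_off V w c x.
  apply/funext => y; rewrite /off_abs /step_off; case: ifPn => // /negPf yx.
  by rewrite ger0_norm// /step yx; case: ifP => // _; rewrite divr_ge0// ltW.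
rewrite (fsum_setT h); apply: le_trans (step_off_sum w0 c_gt0 hm Vx) _.
rewrite step_diag// lerBrDr -mulrDl ler_pdivrMr// mul1r.
by have := Vc _ Vx; lra.
Qed.

(** The diagonal entry is [(D_2 - D_1) / c], the sum of [(w2 - w1) / c] along the row; the
    off-diagonal moduli are these same terms, some of them suppressed by the killing. *)
Lemma step_diff_diag_dominant w1 w2 : (forall x y, w1 x y <= w2 x y) ->
  row_finite w1 -> row_finite w2 ->
  diag_dominant (ksub (step V w1 c) (step V w2 c)).
Proof.
move=> w12 w1f w2f x.
have [Vx|Vx] := boolP (V x); last first.
  rewrite fsbig1; first by rewrite /ksub !step_out// subr0.
  by move=> y _; rewrite /off_abs /ksub !step_out// subr0 normr0 if_same.
have [m1 h1] := off_fin w1f x; have [m2 h2] := off_fin w2f x.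
pose m := maxn m1 m2.
have k1 z : (m <= z)%N -> off_diag w1 x z = 0 by rewrite geq_max => /andP[/h1].
have k2 z : (m <= z)%N -> off_diag w2 x z = 0 by rewrite geq_max => /andP[_ /h2].
have le z : off_abs (ksub (step V w1 c) (step V w2 c)) x z <= (off_diag w2 x z - off_diag w1 x z) / c.
  rewrite /off_abs /off_diag; case: ifPn => [_|/negPf zx]; first by rewrite subr0 mul0r.
  rewrite /ksub /step zx; case: ifP => _; last first.
    by rewrite subr0 normr0 divr_ge0 ?subr_ge0// ltW.
  have ci : 0 <= c^-1 by rewrite invr_ge0 ltW.
  by rewrite -mulrBl normrM (ger0_norm ci) distrC ger0_norm// subr_ge0.
rewrite (@fsum_setT R _ m); last first.
  move=> z mz; apply/le_anti; rewrite off_abs_ge0 andbT; apply: le_trans (le z) _.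
  by rewrite k1// k2// subr0 mul0r.
apply: (@le_trans _ _ (\sum_(z < m) (off_diag w2 x z - off_diag w1 x z) / c)).
  by apply: ler_sum => z _; exact: le.
rewrite -mulr_suml sumrB /ksub !step_diag// /exit_rate (fsum_setT k1) (fsum_setT k2).
by rewrite le_eqVlt; apply/orP; left; apply/eqP; ring.
Qed.

Lemma exit_rate_le w1 w2 x : (forall x y, w1 x y <= w2 x y) ->
  row_finite w1 -> row_finite w2 -> exit_rate w1 x <= exit_rate w2 x.
Proof.
move=> w12 w1f w2f; have [m1 h1] := off_fin w1f x; have [m2 h2] := off_fin w2f x.
pose m := maxn m1 m2.
have k1 z : (m <= z)%N -> off_diag w1 x z = 0 by rewrite geq_max => /andP[/h1].
have k2 z : (m <= z)%N -> off_diag w2 x z = 0 by rewrite geq_max => /andP[_ /h2].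
rewrite /exit_rate (fsum_setT k1) (fsum_setT k2); apply: ler_sum => z _.
by rewrite /off_diag; case: ifP.
Qed.

End step_facts.

Section good_step.
Variables (R : realType) (Xi : pseudoPMetricType R).
Implicit Types (w v : network Xi -> nat -> nat -> R).

Lemma good_off_diag w : good_kernel w -> good_kernel (fun G => off_diag (w G)).
Proof.
move=> [bw w0 wf wv]; split.
- have := bor_kerM (bor_kerB (bor_ker_cst Xi 1) (bor_ker_eq Xi)) bw.
  apply: bor_ext => G; rewrite /off_diag; case: eqP => _; first by rewrite subrr mul0r.
  by rewrite subr0 mul1r.
- by move=> G lG x y; rewrite /off_diag; case: ifP => // _; exact: w0.
- by move=> G lG; apply: off_fin; exact: wf.
- by move=> G lG x y Gx Gy; rewrite /off_diag wv// if_same.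
Qed.

Lemma bor_exit_rate w : good_kernel w -> bor_fun (fun G => exit_rate (w G)).
Proof. by move=> /good_off_diag/bor_row_sum. Qed.

Lemma good_kid v (N : R) : good_kernel v ->
  good_kernel (fun G => kid R (fun z => exit_rate (v G) z <= N)).
Proof.
move=> /bor_exit_rate/(bor_fun_le N)/bor_fun_left bV; split.
- have := bor_kerM (bor_ker_eq Xi) bV; apply: bor_ext => G.
  by rewrite /kid -natrM mulnb.
- by move=> G lG x y; rewrite /kid ler0n.
- by move=> G lG; exact: row_finite_kid.
- by move=> G lG x y Gx Gy; rewrite /kid; case: eqP => // xy; rewrite xy in Gy.
Qed.

Lemma good_step w v (N c : R) : good_kernel w -> good_kernel v -> 0 < c ->
  (forall G, locally_finite G -> forall z, exit_rate (v G) z <= N -> exit_rate (w G) z <= c) ->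
  good_kernel (fun G => step (fun z => exit_rate (v G) z <= N) (w G) c).
Proof.
move=> gw gv c0 hc; have [bw w0 wf wv] := gw.
have bV := bor_fun_le N (bor_exit_rate gv).
have bD := bor_exit_rate gw.
split.
(* The case distinctions in [step] become 0-1 factors, which writes it as a polynomial in Borel
   kernels. *)
- have := bor_kerM (bor_kerM (bor_fun_left bV) (bor_fun_right bV))
    (bor_kerD (bor_kerM (bor_ker_eq Xi)
        (bor_kerB (bor_ker_cst Xi 1) (bor_kerM (bor_fun_left bD) (bor_ker_cst Xi c^-1))))
      (bor_kerM (bor_kerM (bor_kerB (bor_ker_cst Xi 1) (bor_ker_eq Xi)) bw) (bor_ker_cst Xi c^-1))).
  apply: bor_ext => G; rewrite /step -natrM mulnb.
  case: ifP => _; rewrite ?mul0r// mul1r.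
  by case: eqP => _; rewrite ?mul1r ?subrr ?mul0r ?addr0 ?add0r ?subr0 ?mul1r.
- by move=> G lG x y; apply: step_ge0 => //; [exact: w0|exact: hc].
- by move=> G lG; apply: step_fin; exact: wf.
- move=> G lG x y Gx Gy; rewrite /step wv// mul0r; case: ifP => // _.
  by case: eqP => // xy; rewrite xy in Gy.
Qed.

End good_step.

(** * Mass transport *)

Section mass_transport.
Variables (R : realType) (Xi : pseudoPMetricType R) (nu : probability (Gstar Xi) R).
Implicit Types (s : network Xi -> nat -> nat -> R) (d f : network Xi -> nat -> R).

Definition root_mean f : \bar R := (\int[nu]_g (f (repr g) (root (repr g)))%:E)%E.

Lemma measurable_root f : bor_fun f ->
  measurable_fun setT (fun g : Gstar Xi => (f (repr g) (root (repr g)))%:E).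
Proof.
by move=> [_]; congr measurable_fun; apply/funext => g; rewrite /root (tnth_nth 0%N).
Qed.

Hypothesis unim : unimodular nu.

(** Transfers unimodularity from functions on birooted classes, summed over a subtype of vertices,
    to formulas [K G x y] in vertex numbers. *)
Lemma mass_transport (K : network Xi -> nat -> nat -> R) :
  bor_ker K -> (forall G, locally_finite G -> forall x y, 0 <= K G x y) ->
  (\int[nu]_g (\esum_(x in verts (repr g)) (K (repr g) (root (repr g)) x)%:E) =
   \int[nu]_g (\esum_(x in verts (repr g)) (K (repr g) x (root (repr g)))%:E))%E.
Proof.
move=> bK K0; have [iK mK] := bK.
pose f (z : Gstarstar Xi) : \bar R :=
  (K (repr z) (nth 0%N (roots (repr z)) 0) (nth 0%N (roots (repr z)) 1))%:E.
have f0 z : (0 <= f z)%E by rewrite lee_fin; apply: K0; exact: rooted_locally_finite.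
have fE (G : rooted 1 Xi) (x y : verts G) : f (birooted_class x y) = (K G (val x) (val y))%:E.
  by rewrite /f /birooted_class (bor_pi (birooted x y) bK).
have vb (G : network Xi) : set_bij [set: verts G] (verts G) val.
  split=> [x _|x y _ _|x Gx]; [exact: set_valP|exact: val_inj|].
  by exists (exist _ x (mem_set Gx)).
have := @unim f mK f0.
under eq_integral => g _.
  rewrite (_ : (\esum_(x in _) _)%E = \esum_(x in [set: verts (repr g)])
      (K (repr g) (root (repr g)) (val x))%:E); last by apply: eq_esum => x _; rewrite fE.
  rewrite -(reindex_esum _ _ _ (fun x => (K (repr g) (root (repr g)) x)%:E) (vb (repr g))).
  over.
move=> ->; apply: eq_integral => g _.
rewrite [RHS](reindex_esum _ _ _ (fun x => (K (repr g) x (root (repr g)))%:E) (vb (repr g))).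
by apply: eq_esum => x _; rewrite fE.
Qed.

Lemma mass_transport_sum (K : network Xi -> nat -> nat -> R) :
  good_kernel K -> good_kernel (fun G x y => K G y x) ->
  root_mean (fun G x => \sum_(y \in [set: nat]) K G x y) =
  root_mean (fun G x => \sum_(y \in [set: nat]) K G y x).
Proof.
have rv (G : rooted 1 Xi) : verts G (root G) by exact: roots_verts.
move=> [bK K0 Kf Kv] [_ _ Kf' Kv']; rewrite /root_mean.
under eq_integral => g _.
  have lG := rooted_locally_finite (r := repr g).
  rewrite -(@EFin_sum_verts _ _ (repr g)); first over.
  - exact: K0.
  - exact: Kf.
  - by move=> z; exact: Kv.
rewrite mass_transport//; apply: eq_integral => g _.
have lG := rooted_locally_finite (r := repr g).
rewrite (@EFin_sum_verts _ _ (repr g))//.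
- by move=> z; exact: K0.
- exact: (Kf' _ lG (root (repr g))).
- by move=> z; exact: Kv'.
Qed.

Lemma root_mean_le f f' : bor_fun f -> bor_fun f' ->
  (forall G : rooted 1 Xi, 0 <= f G (root G) <= f' G (root G)) ->
  (root_mean f <= root_mean f')%E.
Proof.
move=> bf bf' ff'; apply: ge0_le_integral => //.
- by move=> g _; rewrite lee_fin; have /andP[] := ff' (repr g).
- exact: measurable_root.
- exact: measurable_root.
- by move=> g _; rewrite lee_fin; have /andP[] := ff' (repr g).
Qed.

Lemma root_meanD f f' : bor_fun f -> bor_fun f' ->
  (forall G : rooted 1 Xi, 0 <= f G (root G)) ->
  (forall G : rooted 1 Xi, 0 <= f' G (root G)) ->
  root_mean (fun G x => f G x + f' G x) = (root_mean f + root_mean f')%E.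
Proof.
move=> bf bf' f0 f'0; rewrite /root_mean -ge0_integralD//.
- by move=> g _; rewrite lee_fin.
- exact: measurable_root.
- by move=> g _; rewrite lee_fin.
- exact: measurable_root.
Qed.

Lemma root_mean_fin f (C : R) : bor_fun f ->
  (forall G : rooted 1 Xi, 0 <= f G (root G) <= C) -> root_mean f \is a fin_num.
Proof.
move=> bf f01; rewrite ge0_fin_numE; last first.
  by apply: integral_ge0 => g _; rewrite lee_fin; have /andP[] := f01 (repr g).
apply: (@le_lt_trans _ _ (root_mean (fun _ _ => C))).
  by apply: root_mean_le => //; exact: bor_cst.
rewrite /root_mean integral_cst// [ltLHS](_ : _ = C%:E) ?ltry//.
exact: (etrans (congr1 (mule C%:E) (probability_setT nu)) (mule1 _)).
Qed.

Lemma bor_funD f f' : bor_fun f -> bor_fun f' -> bor_fun (fun G x => f G x + f' G x).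
Proof. apply: (bor_map2 (op := fun a b => (a + b)%E)) => *; exact: emeasurable_funD. Qed.

(* Positivity of the trace of a product of a diagonally dominant kernel (diagonal *)
(* [sg], off-diagonal modulus [s]) and a positive semidefinite one (diagonal [d]). *)
Lemma root_mean_diag_dominant s (sg d hp hm : network Xi -> nat -> R) (C : R) :
  good_kernel s -> (forall G, locally_finite G -> ksym (s G)) ->
  bor_fun d -> bor_fun hp -> bor_fun hm ->
  (forall G, locally_finite G -> forall x, 0 <= d G x <= C) ->
  (forall G, locally_finite G -> forall x, 0 <= hp G x) ->
  (forall G, locally_finite G -> forall x, 0 <= hm G x) ->
  (forall G, locally_finite G -> forall x, \sum_(y \in [set: nat]) s G x y <= sg G x <= 1) ->
  (forall G, locally_finite G -> forall x,
     sg G x * d G x - \sum_(y \in [set: nat]) s G x y * ((d G x + d G y) / 2)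
       <= hp G x - hm G x) ->
  (root_mean hm <= root_mean hp)%E.
Proof.
move=> gs ss bd bhp bhm hd hhp hhm hs hk; have [bs s0 sf sv] := gs.
have lf (G : rooted 1 Xi) := rooted_locally_finite (r := G).
have d0 G : locally_finite G -> forall x, 0 <= d G x.
  by move=> lG x; have /andP[] := hd G lG x.
(* The transport: [x] sends half of [d x], weighted by [s x y], to [y]. The mass sent is [A], the
   mass received is [A'], and their sum is the subtracted term of the hypothesis. *)
pose k G x y := s G x y * (d G x * 2^-1).
have bk : bor_ker k.
  by apply: bor_kerM => //; apply: bor_kerM; [exact: bor_fun_left|exact: bor_ker_cst].
have bk' : bor_ker (fun G x y => k G y x) by exact: bor_ker_swap.
have kE G : locally_finite G -> forall x y, k G y x = s G x y * (d G y * 2^-1).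
  by move=> lG x y; rewrite /k (ss G lG y x).
have gk : good_kernel k.
  split=> //.
  - by move=> G lG x y; rewrite mulr_ge0 ?s0// mulr_ge0 ?d0.
  - by move=> G lG; apply: (row_finite_sub _ (sf _ lG)) => x y xy; rewrite /k xy mul0r.
  - by move=> G lG x y Gx Gy; rewrite /k sv ?mul0r.
have gk' : good_kernel (fun G x y => k G y x).
  split=> //.
  - by move=> G lG x y; rewrite mulr_ge0 ?s0// mulr_ge0 ?d0.
  - by move=> G lG; apply: (row_finite_sub _ (sf _ lG)) => x y xy; rewrite kE// xy mul0r.
  - by move=> G lG x y Gx Gy; rewrite kE// sv ?mul0r.
pose A G x := \sum_(y \in [set: nat]) k G x y.
pose A' G x := \sum_(y \in [set: nat]) k G y x.
have AA' : root_mean A = root_mean A' by exact: mass_transport_sum.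
have bA : bor_fun A by exact: bor_row_sum gk.
have bA' : bor_fun A' by exact: bor_row_sum gk'.
have AE G : locally_finite G -> forall x,
    A G x = (\sum_(y \in [set: nat]) s G x y) * (d G x * 2^-1).
  move=> lG x; have [m hm'] := sf _ lG x.
  rewrite /A (fsum_setT hm') (@fsum_setT R _ m); last by move=> z /hm' xz; rewrite /k xz mul0r.
  by rewrite mulr_suml.
have AAE G : locally_finite G -> forall x,
    \sum_(y \in [set: nat]) s G x y * ((d G x + d G y) / 2) = A G x + A' G x.
  move=> lG x; have [m hm'] := sf _ lG x.
  rewrite /A /A' !(@fsum_setT R _ m) => [|z /hm' xz|z /hm' xz|z /hm' xz].
  - by rewrite -big_split; apply: eq_bigr => y _; rewrite (kE _ lG x y) /k mulrDl mulrDr.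
  - by rewrite (kE _ lG x z) xz mul0r.
  - by rewrite /k xz mul0r.
  - by rewrite xz mul0r.
have A01 (G : rooted 1 Xi) : 0 <= A G (root G) <= C.
  have /andP[h1 h2] := hs _ (lf G) (root G); have /andP[h3 h4] := hd _ (lf G) (root G).
  have h5 : 0 <= \sum_(y \in [set: nat]) s G (root G) y by apply: fsumr_ge0 => y _; exact: s0.
  have h6 : 0 <= d G (root G) * 2^-1 by rewrite mulr_ge0.
  rewrite AE// mulr_ge0//=; apply: le_trans (_ : d G (root G) * 2^-1 <= C); last by lra.
  by rewrite ler_piMl// (le_trans h1).
have A'0 (G : rooted 1 Xi) : 0 <= A' G (root G).
  by apply: fsumr_ge0 => y _; rewrite mulr_ge0 ?s0// mulr_ge0 ?d0.
have A0 (G : rooted 1 Xi) : 0 <= A G (root G) by have /andP[] := A01 G.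
(* Adding [2 A] on one side and [A + A'] on the other keeps all integrands nonnegative; as [A] and
   [A'] have the same finite mean, they cancel afterwards. *)
have h : (root_mean (fun G x => (hm G x + (A G x + A G x))%R) <=
    root_mean (fun G x => (hp G x + (A G x + A' G x))%R))%E.
  apply: (root_mean_le (bor_funD bhm (bor_funD bA bA)) (bor_funD bhp (bor_funD bA bA'))).
  move=> G; rewrite !addr_ge0//=; last exact: hhm.
  have := hk _ (lf G) (root G); rewrite AAE// => h1.
  have h2 : A G (root G) + A G (root G) <= sg G (root G) * d G (root G).
    rewrite AE//; have /andP[h3 _] := hs _ (lf G) (root G).
    have d0r := d0 _ (lf G) (root G).
    by rewrite -mulrDr -splitr ler_wpM2r.
  lra.
have fA : root_mean A \is a fin_num by exact: root_mean_fin A01.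
have hp0 (G : rooted 1 Xi) : 0 <= hp G (root G) by exact: hhp.
have hm0 (G : rooted 1 Xi) : 0 <= hm G (root G) by exact: hhm.
have AA0 (G : rooted 1 Xi) : 0 <= A G (root G) + A G (root G) by rewrite addr_ge0.
have AA'0 (G : rooted 1 Xi) : 0 <= A G (root G) + A' G (root G) by rewrite addr_ge0.
move: h; rewrite (root_meanD bhm (bor_funD bA bA) hm0 AA0) (root_meanD bA bA A0 A0).
rewrite (root_meanD bhp (bor_funD bA bA') hp0 AA'0) (root_meanD bA bA' A0 A'0).
by rewrite -AA' leeD2rE// fin_numD fA.
Qed.

End mass_transport.

(** * Traces of words and comparison of the killed walks *)

Section comparison.
Variables (R : realType) (Xi : pseudoPMetricType R) (nu : probability (Gstar Xi) R).
Hypothesis unim : unimodular nu.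
Variables (w1 w2 : network Xi -> nat -> nat -> R).
Hypotheses (gw1 : good_kernel w1) (gw2 : good_kernel w2)
  (sw1 : forall G, ksym (w1 G)) (sw2 : forall G, ksym (w2 G))
  (w12 : forall G x y, w1 G x y <= w2 G x y).
Variable N : nat.

Let c : R := 2 * N.+1%:R.
Let V (G : network Xi) : pred nat := exit_below (w2 G) N.
Let X (G : network Xi) := step (V G) (w1 G) c.
Let Y (G : network Xi) := step (V G) (w2 G) c.
Let W (l : seq bool) (G : network Xi) := kword (V G) (X G) (Y G) l.

Let c_gt0 : 0 < c. Proof. by rewrite /c mulr_gt0. Qed.

Lemma good_off_abs (K : network Xi -> nat -> nat -> R) : bor_ker K ->
  (forall G, locally_finite G -> row_finite (K G)) ->
  (forall G, locally_finite G -> forall x y, verts G x -> ~ verts G y -> K G x y = 0) ->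
  good_kernel (fun G => off_abs (K G)).
Proof.
move=> bK Kf Kv; split.
- have bn : bor_ker (fun G x y => `|K G x y|).
    by have := bor_map1 (@abse_measurable R setT) bK; apply: bor_ext.
  have := bor_kerM (bor_kerB (bor_ker_cst Xi 1) (bor_ker_eq Xi)) bn.
  apply: bor_ext => G; rewrite /off_abs; case: eqP => _; first by rewrite subrr mul0r.
  by rewrite subr0 mul1r.
- by move=> G lG x y; exact: off_abs_ge0.
- by move=> G lG; apply: off_abs_fin; exact: Kf.
- by move=> G lG x y Gx Gy; rewrite /off_abs Kv// normr0 if_same.
Qed.

Let exit12 G : locally_finite G -> forall x, exit_rate (w1 G) x <= exit_rate (w2 G) x.
Proof.
have [_ _ w1f _] := gw1; have [_ _ w2f _] := gw2.
by move=> lG x; apply: exit_rate_le => //; [exact: w1f|exact: w2f].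
Qed.

Let Vc2 G : locally_finite G -> forall b x, V G x ->
  exit_rate (if b then w1 G else w2 G) x <= c / 2.
Proof.
move=> lG b x; rewrite /V /exit_below => h.
have -> : c / 2 = N.+1%:R by rewrite /c; field.
by case: b => //; apply: le_trans h; exact: exit12.
Qed.

Let Vc G : locally_finite G -> forall b x, V G x ->
  exit_rate (if b then w1 G else w2 G) x <= c.
Proof. by move=> lG b x /(Vc2 lG b); move: c_gt0; lra. Qed.

Let letterE G b : letter (X G) (Y G) b = step (V G) (if b then w1 G else w2 G) c.
Proof. by case: b. Qed.

Let w_ge0 G : locally_finite G -> forall (b : bool) x y, 0 <= (if b then w1 G else w2 G) x y.
Proof. by move=> lG []; [have [_ h _ _] := gw1|have [_ h _ _] := gw2]; exact: h. Qed.

Let w_fin G : locally_finite G -> forall b : bool, row_finite (if b then w1 G else w2 G).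
Proof. by move=> lG []; [have [_ _ h _] := gw1|have [_ _ h _] := gw2]; exact: h. Qed.

Let l_ge0 G : locally_finite G -> forall b x y, 0 <= letter (X G) (Y G) b x y.
Proof.
by move=> lG b x y; rewrite letterE; apply: step_ge0 => //; [exact: w_ge0|exact: Vc].
Qed.

Let l_sym G b : ksym (letter (X G) (Y G) b).
Proof. by rewrite letterE; apply: step_sym; case: b. Qed.

Let l_fin G : locally_finite G -> forall b, row_finite (letter (X G) (Y G) b).
Proof. by move=> lG b; rewrite letterE; apply: step_fin; exact: w_fin. Qed.

Let l_dd G : locally_finite G -> forall b, diag_dominant (letter (X G) (Y G) b).
Proof.
move=> lG b; rewrite letterE.
by apply: step_diag_dominant => //; [exact: w_ge0|exact: w_fin|exact: Vc2].
Qed.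

Let l_supp G b x y : ~~ V G x -> letter (X G) (Y G) b x y = 0.
Proof. by rewrite letterE; exact: step_out. Qed.

Let l_contr G : locally_finite G -> forall b L x y, (forall x y, 0 <= L x y <= 1) ->
  kmul (letter (X G) (Y G) b) L x y <= 1.
Proof.
move=> lG b L x y L1; rewrite letterE.
by apply: kmul_step_le1 => //; [exact: w_ge0|exact: w_fin|exact: Vc].
Qed.

Let good_letter b : good_kernel (fun G => letter (X G) (Y G) b).
Proof.
case: b => /=; apply: good_step => // G lG z h.
  exact: (@Vc G lG true).
exact: (@Vc G lG false).
Qed.

Let good_W l : good_kernel (W l).
Proof.
elim: l => [|b l IH]; first exact: (good_kid N.+1%:R gw2).
exact: (good_kmul (good_letter b) IH).
Qed.

Let W01 l G : locally_finite G -> forall x y, 0 <= W l G x y <= 1.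
Proof. by move=> lG x y; apply: kword01; [exact: l_ge0|exact: l_contr]. Qed.

Let tau l : \bar R := root_mean nu (fun G x => W l G x x).

Let bor_W l : bor_fun (fun G x => W l G x x).
Proof. by have [bW _ _ _] := good_W l; exact: bor_ker_diag. Qed.

Let tau_fin l : tau l \is a fin_num.
Proof.
apply: (@root_mean_fin R Xi nu _ 1) => // G; apply: W01; exact: rooted_locally_finite.
Qed.

(** Transport of the mass [W l1 x y * W l2 y x] from [x] to [y]: the total sent is the diagonal
    entry of one product, the total received that of the other. *)
Let tau_cat l1 l2 : tau (l1 ++ l2) = tau (l2 ++ l1).
Proof.
have gk l l' : good_kernel (fun G x y => W l G x y * W l' G y x).
  have [b0 h0 hf hv] := good_W l; have [b0' h0' hf' hv'] := good_W l'.
  split.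
  - by apply: bor_kerM => //; exact: bor_ker_swap.
  - by move=> G lG x y; rewrite mulr_ge0 ?h0 ?h0'.
  - by move=> G lG; apply: (row_finite_sub _ (hf _ lG)) => x y xy; rewrite xy mul0r.
  - by move=> G lG x y Gx Gy; rewrite hv ?mul0r.
have E l l' : tau (l ++ l') =
    root_mean nu (fun G x => \sum_(y \in [set: nat]) W l G x y * W l' G y x).
  apply: eq_integral => g _; have lG := rooted_locally_finite (r := repr g).
  by rewrite /W kword_cat//; [exact: l_fin|move=> *; exact: l_supp].
have gk' : good_kernel (fun G x y => W l1 G y x * W l2 G x y).
  have -> : (fun G x y => W l1 G y x * W l2 G x y) = (fun G x y => W l2 G x y * W l1 G y x).
    by apply/funext => G; apply/funext => x; apply/funext => y; rewrite mulrC.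
  exact: gk.
rewrite !E (mass_transport_sum unim (gk l1 l2) gk'); congr root_mean.
by apply/funext => G; apply/funext => x; apply: eq_fsbigr => y _; rewrite mulrC.
Qed.

Let tau_le_first n : (tau (nseq n.+1 false) <= tau (true :: nseq n false))%E.
Proof.
pose B G := ksub (X G) (Y G).
have [bX _ Xf Xv] := good_letter true; have [bY _ Yf Yv] := good_letter false.
have Bf G : locally_finite G -> row_finite (B G).
  by move=> lG; apply: row_finite_ksub; [exact: Xf|exact: Yf].
have Bs G : ksym (B G) by apply: ksym_ksub; [exact: (@l_sym G true)|exact: (@l_sym G false)].
have Bd G : locally_finite G -> diag_dominant (B G).
  by move=> lG; apply: step_diff_diag_dominant => //;
    [exact: (w_fin lG true)|exact: (w_fin lG false)].
apply: (@root_mean_diag_dominant R Xi nu unim (fun G => off_abs (B G)) (fun G x => B G x x)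
   (fun G x => W (nseq n false) G x x) (fun G x => W (true :: nseq n false) G x x)
   (fun G x => W (nseq n.+1 false) G x x) 1) => //.
- apply: good_off_abs => //; first exact: bor_kerB.
  move=> G lG x y Gx Gy; have hX := Xv G lG x y Gx Gy; have hY := Yv G lG x y Gx Gy.
  by rewrite /= in hX hY; rewrite /B /ksub hX hY subr0.
- by move=> G lG x y; exact: off_abs_sym.
- by move=> G lG x; exact: W01.
- by move=> G lG x; have /andP[] := W01 (true :: nseq n false) lG x x.
- by move=> G lG x; have /andP[] := W01 (nseq n.+1 false) lG x x.
- move=> G lG x; rewrite (Bd G lG)/=.
  have h1 := l_ge0 lG false x x.
  have [Vx|Vx] := boolP (V G x); last by rewrite /B /ksub /X /Y !step_out// subr0 ler01.
  rewrite /B /ksub (le_trans (y := X G x x))//; first by rewrite gerBl.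
  rewrite /X step_diag// gerBl divr_ge0 ?(ltW c_gt0)// exit_rate_ge0//.
  exact: (w_ge0 lG true).
- move=> G lG x.
  have := kmul_diag_ge x (Bs G) (Bf G lG) (psd_nseq (V := V G) (@l_sym G) (l_fin lG) (l_dd lG)
     (@l_supp G) false n).
  by rewrite /B (kdiff_kmul (V G) (l_fin lG)).
Qed.

(** The difference of the sides is the trace of [X^e] times the psd [square_kernel]; [e <= 1] makes
    [X^e] diagonally dominant. It is stated with sums on both sides to stay within nonnegative
    integrands. *)
Let tau_convex e a j : (e <= 1)%N ->
  (tau (nseq e true ++ sandwich a j true false) + tau (nseq e true ++ sandwich a j false true)
   <= tau (nseq e true ++ sandwich a j true true) + tau (nseq e true ++ sandwich a j false false))%E.
Proof.
move=> e1.
have W0 l (G : rooted 1 Xi) : 0 <= W l G (root G) (root G).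
  by have /andP[] := W01 l (rooted_locally_finite (r := G)) (root G) (root G).
rewrite /tau -!root_meanD//.
pose l b b' := nseq e true ++ sandwich a j b b'.
pose Q G := square_kernel (V G) (X G) (Y G) a j.
have bQ : bor_fun (fun G x => Q G x x).
  by apply: bor_funB; apply: bor_funB; exact: bor_W.
have Qp G : locally_finite G -> psd (Q G).
  move=> lG; apply: psd_square_kernel => //; [exact: l_fin|exact: l_dd|exact: l_supp].
have [bS _ Sf Sv] := good_W (nseq e true).
(* The bound 2: a diagonal entry of [Q] is a sum of two entries of words minus two others, each in
   [[0, 1]]. *)
apply: (@root_mean_diag_dominant R Xi nu unim (fun G => off_abs (W (nseq e true) G))
   (fun G x => W (nseq e true) G x x) (fun G x => Q G x x)
   (fun G x => W (l true true) G x x + W (l false false) G x x)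
   (fun G x => W (l true false) G x x + W (l false true) G x x) 2) => //.
- exact: good_off_abs.
- move=> G lG x y; apply: off_abs_sym; apply: ksym_nseq_true => //.
  + exact: l_fin.
  + exact: l_supp.
- exact: bor_funD.
- exact: bor_funD.
- move=> G lG x; rewrite (psd_diag_ge0 x (Qp G lG))/=.
  have /andP[h1 h2] := W01 (sandwich a j true true) lG x x.
  have /andP[h3 h4] := W01 (sandwich a j false false) lG x x.
  have /andP[h5 h6] := W01 (sandwich a j true false) lG x x.
  have /andP[h7 h8] := W01 (sandwich a j false true) lG x x.
  rewrite /Q /square_kernel /ksub; move: h1 h2 h3 h4 h5 h6 h7 h8; rewrite /W; lra.
- move=> G lG x; have /andP[h1 _] := W01 (l true true) lG x x.
  by have /andP[h2 _] := W01 (l false false) lG x x; rewrite addr_ge0.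
- move=> G lG x; have /andP[h1 _] := W01 (l true false) lG x x.
  by have /andP[h2 _] := W01 (l false true) lG x x; rewrite addr_ge0.
- move=> G lG x; have /andP[_ ->] := W01 (nseq e true) lG x x; rewrite andbT.
  apply: diag_dominant_nseq => //; [exact: l_fin|exact: l_dd|exact: l_supp].
- move=> G lG x.
  have Ss : ksym (W (nseq e true) G).
    by apply: ksym_nseq_true => //; [exact: l_fin|exact: l_supp].
  have := kmul_diag_ge x Ss (Sf G lG) (Qp G lG).
  rewrite /W /Q kmul_square_kernel//; [|exact: l_fin|exact: l_supp].
  rewrite /ksub -/(l true true) -/(l true false) -/(l false true) -/(l false false).
  by move=> h; apply: le_trans h _; rewrite le_eqVlt; apply/orP; left; apply/eqP; ring.
Qed.

Let u p q := tau (nseq p true ++ nseq q false).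

(** Moving the trailing [X^(p/2)] to the front restores [X^p], since [p = odd p + 2 (p/2)]. Then [b]
    joins the adjacent block of its letter, and [b'] either ends the block of [Y] or is rotated into
    that of [X]. *)
Let tau_sandwich p j b b' :
  tau (nseq (odd p) true ++ sandwich p./2 j b b') = u (b + b' + p) (~~ b + ~~ b' + j).
Proof.
have nt k (s : seq bool) : nseq k true ++ true :: s = nseq k.+1 true ++ s.
  by elim: k => //= k ->.
have nf k : nseq k false ++ [:: false] = nseq k.+1 false by rewrite -(nseqD k 1) addn1.
have -> : tau (nseq (odd p) true ++ sandwich p./2 j b b') =
    tau (nseq p true ++ b :: nseq j false ++ [:: b']).
  rewrite /sandwich (_ : nseq (odd p) true ++ _ =
      (nseq (odd p) true ++ nseq p./2 true ++ b :: nseq j false ++ [:: b']) ++ nseq p./2 true);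
    last by rewrite -?catA /= -?catA.
  by rewrite tau_cat !catA -!nseqD addnC addnA addnn addnC odd_double_half.
case: b'; rewrite ?addn0.
  rewrite (_ : nseq p true ++ _ = (nseq p true ++ b :: nseq j false) ++ [:: true]); last first.
    by rewrite -catA.
  by rewrite tau_cat /u /=; case: b; rewrite //= nt.
by case: b; rewrite /u /= nf // nt.
Qed.

Let u_le_first q : (u 0 q.+1 <= u 1 q)%E.
Proof. exact: tau_le_first. Qed.

(* The difference of the two sides is the trace of [X^p (X - Y) Y^q (X - Y)]; moving *)
(* [X^(p/2)] around cyclically leaves [X^(odd p)], diagonally dominant, times a psd kernel. *)
Let u_convex p q : (u p.+1 q.+1 + u p.+1 q.+1 <= u p.+2 q + u p q.+2)%E.
Proof.
have := @tau_convex (odd p) p./2 q (leq_b1 _).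
by rewrite !tau_sandwich /= !addn0 !add0n.
Qed.

Let u_step p q : fine (u p q.+1) <= fine (u p.+1 q).
Proof.
elim: p q => [|p IH] q; first by apply: fine_le; rewrite ?tau_fin// u_le_first.
have := u_convex p q.
rewrite -[u p.+1 q.+1]fineK ?tau_fin// -[u p.+2 q]fineK ?tau_fin//.
rewrite -[u p q.+2]fineK ?tau_fin// -!EFinD lee_fin.
have := IH q.+1; lra.
Qed.

Lemma tau_le n : (tau (nseq n false) <= tau (nseq n true))%E.
Proof.
have h p q : fine (u 0 (p + q)) <= fine (u p q).
  elim: p q => [|p IH] q //; apply: le_trans (u_step p q).
  by rewrite addSnnS; exact: IH.
have := h n 0%N; rewrite addn0 /u cats0 /= => hn.
by rewrite -(fineK (tau_fin (nseq n false))) -(fineK (tau_fin (nseq n true))) lee_fin.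
Qed.

Let step_powW G b m : step_pow (V G) (if b then w1 G else w2 G) c m = W (nseq m b) G.
Proof. by elim: m => //= m ->; rewrite /W /= letterE. Qed.

(** All terms of the Poisson expansion are nonnegative, so mean and series are exchanged; the
    comparison of semigroups is thereby reduced to that of each power. *)
Lemma root_mean_killed_trans (b : bool) t : 0 <= t ->
  root_mean nu (fun G x => killed_trans (if b then w1 G else w2 G) (V G) c t x x) =
  (\sum_(m <oo) ((poisson_weight c t m)%:E * tau (nseq m b)))%E.
Proof.
move=> t0; rewrite /root_mean.
have p0 m : 0 <= poisson_weight c t m by rewrite poisson_weight_ge0// ltW.
under eq_integral => g _.
  have lG := rooted_locally_finite (r := repr g).
  rewrite /killed_trans EFin_poissonized; last first.
    by move=> m; rewrite step_powW; exact: W01.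
  over.
rewrite integral_nneseries//.
- apply: eq_eseriesr => m _.
  under eq_integral do rewrite EFinM step_powW.
  rewrite ge0_integralZl_EFin//.
  + by move=> g _; rewrite lee_fin; have /andP[] := W01 (nseq m b)
      (rooted_locally_finite (r := repr g)) (root (repr g)) (root (repr g)).
  + exact: (measurable_root (bor_W (nseq m b))).
- move=> m; under eq_fun do rewrite EFinM step_powW.
  apply: emeasurable_funM; first exact: measurable_cst.
  exact: (measurable_root (bor_W (nseq m b))).
- move=> m g _; rewrite lee_fin mulr_ge0// step_powW.
  by have /andP[] := W01 (nseq m b) (rooted_locally_finite (r := repr g)) (root (repr g)) (root (repr g)).
Qed.

Lemma root_mean_killed_trans_le t : 0 <= t ->
  (root_mean nu (fun G x => killed_trans (w2 G) (exit_below (w2 G) N) (2 * N.+1%:R) t x x) <=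
   root_mean nu (fun G x => killed_trans (w1 G) (exit_below (w2 G) N) (2 * N.+1%:R) t x x))%E.
Proof.
move=> t0; have := root_mean_killed_trans true t0; rewrite /= => ->.
have := root_mean_killed_trans false t0; rewrite /= => ->.
have p0 m : 0 <= poisson_weight c t m by rewrite poisson_weight_ge0// ltW.
apply: lee_nneseries => m _.
  rewrite mule_ge0 ?lee_fin//; apply: integral_ge0 => g _; rewrite lee_fin.
  by have /andP[] := W01 (nseq m false) (rooted_locally_finite (r := repr g)) (root (repr g)) (root (repr g)).
by rewrite lee_wpmul2l ?lee_fin// tau_le.
Qed.

End comparison.

(** * Lower limits and measurability of return probabilities *)

Lemma measurable_limn_einf d (T : measurableType d) (R : realType) (f : nat -> T -> \bar R) :
  (forall n, measurable_fun setT (f n)) ->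
  measurable_fun setT (fun x => limn_einf (fun n => f n x)).
Proof.
move=> mf; rewrite /limn_einf; apply: measurableT_comp; first exact: oppe_measurable.
apply: (measurable_fun_limn_esup (f := fun n x => - f n x)%E) => n.
by apply: measurableT_comp; first exact: oppe_measurable.
Qed.

Lemma limn_einf_ge0 (R : realType) (a : nat -> \bar R) :
  (forall n, 0 <= a n)%E -> (0 <= limn_einf a)%E.
Proof.
move=> a0; rewrite limn_einf_lim; apply: lime_ge; first exact: is_cvg_einfs.
by apply: nearW => n; apply: le_ereal_inf_tmp => _ [m _ <-].
Qed.

Lemma limn_einf_le (R : realType) (a : nat -> \bar R) b :
  (forall n, a n <= b)%E -> (limn_einf a <= b)%E.
Proof.
move=> ab; rewrite limn_einf_lim; apply: lime_le; first exact: is_cvg_einfs.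
by apply: nearW => n; apply: le_trans (ab n); apply: ereal_inf_lbound; exists n => /=.
Qed.

Section bor_limits.
Variables (R : realType) (Xi : pseudoPMetricType R) (k : nat).
Implicit Types (phi : nat -> network Xi -> seq nat -> \bar R).

Lemma bor_series phi : (forall m, bor k (phi m)) ->
  (forall m (G : rooted k Xi), 0 <= phi m G (roots G))%E ->
  bor k (fun G xs => \sum_(m <oo) phi m G xs)%E.
Proof.
move=> bphi phi0; split.
  by move=> G H GH; apply: eq_eseriesr => m _; have [i _] := bphi m; exact: i.
apply: ge0_emeasurable_sum => [m g _ _|m _]; first exact: phi0.
by have [] := bphi m.
Qed.

Lemma bor_limn_einf phi : (forall m, bor k (phi m)) ->
  bor k (fun G xs => limn_einf (fun m => phi m G xs)).
Proof.
move=> bphi; split.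
  move=> G H GH; congr limn_einf; apply/funext => m.
  by have [i _] := bphi m; exact: i.
by apply: measurable_limn_einf => m; have [] := bphi m.
Qed.

End bor_limits.

Section bor_killed_trans.
Variables (R : realType) (Xi : pseudoPMetricType R).
Implicit Types (w v : network Xi -> nat -> nat -> R).

Lemma bor_killed_trans w v N (c t : R) : good_kernel w -> good_kernel v -> 0 < c -> 0 <= t ->
  (forall G, locally_finite G -> forall z, exit_below (v G) N z -> exit_rate (w G) z <= c) ->
  bor_fun (fun G x => killed_trans (w G) (exit_below (v G) N) c t x x).
Proof.
move=> gw gv c0 t0 hc; have [_ w0 wf _] := gw.
have gp m : good_kernel (fun G => step_pow (exit_below (v G) N) (w G) c m).
  elim: m => [|m IH] /=; first exact: good_kid.
  by apply: good_kmul => //; exact: good_step.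
have p01 (G : rooted 1 Xi) m x y : 0 <= step_pow (exit_below (v G) N) (w G) c m x y <= 1.
  have lG := rooted_locally_finite (r := G).
  by apply: step_pow01 => //; [exact: w0|exact: wf|exact: hc].
have b m : bor_fun (fun G x => poisson_weight c t m * step_pow (exit_below (v G) N) (w G) c m x x).
  have [bp _ _ _] := gp m.
  exact: (bor_ker_diag (bor_kerM (bor_ker_cst Xi (poisson_weight c t m)) bp)).
have := @bor_series R Xi 1 (fun m G xs => (poisson_weight c t m *
  step_pow (exit_below (v G) N) (w G) c m (nth 0%N xs 0) (nth 0%N xs 0))%:E) b.
have h0 m (G : rooted 1 Xi) : (0 <= (poisson_weight c t m *
    step_pow (exit_below (v G) N) (w G) c m (nth 0%N (roots G) 0) (nth 0%N (roots G) 0))%:E)%E.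
  have /andP[p _] := p01 G m (nth 0%N (roots G) 0) (nth 0%N (roots G) 0).
  by rewrite lee_fin mulr_ge0// poisson_weight_ge0// ltW.
by move=> /(_ h0); apply: bor_ext => G; rewrite /killed_trans EFin_poissonized.
Qed.

End bor_killed_trans.

Section rate_kernels.
Variable R : realType.
Local Notation RP := (Rplus R).

Lemma rate_out_left (G : network RP) x y : ~ verts G x -> rate G x y = 0.
Proof.
move=> Gx; apply/eqP; apply: contra_notT Gx => /rate_dart[d Dd [<- _]].
exact: dsrc_verts.
Qed.

(** The weights may differ in the two directions, but darts come in reversed pairs: whatever jumps
    to [x] is a neighbour of [x]. *)
Lemma rate_col_fin (G : network RP) : locally_finite G -> row_finite (fun x y => rate G y x).
Proof.
move=> lG x; have [Gx|nGx] := pselect (verts G x); last first.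
  by exists 0%N => z _; exact: rate_out.
have fx : finite_set (dtgt G @` [set d | darts G d /\ dsrc G d = x]).
  by apply: finite_image; exact: lG.
have [M [d [_ hM]]] := @finite_nat_pos_bound R _ id (fun=> 1) fx (fun=> ltr01).
exists M.+1 => z Mz; apply/eqP; apply: contraTT Mz => /rate_dart[e De [ez ex]].
have [|+ _] := hM z.
  exists (drev G e); last by rewrite /dtgt drevK.
  by split; [exact: drev_darts|exact: ex].
by rewrite -ltnNge ltnS.
Qed.

Lemma good_rate (Xi : pseudoPMetricType R) (h : Xi -> RP) :
  (forall e a b, 0 < e -> ball a e b -> ball (h a) e (h b)) ->
  good_kernel (fun G => rate (map_network h G)).
Proof.
move=> hb; split.
- exact: (bor_map hb (bor_rate R)).
- by move=> G _ x y; exact: rate_ge0.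
- by move=> G lG; apply: rate_fin; exact: lG.
- by move=> G _ x y _ Gy; exact: rate_out.
Qed.

Lemma good_rate_swap (Xi : pseudoPMetricType R) (h : Xi -> RP) :
  (forall e a b, 0 < e -> ball a e b -> ball (h a) e (h b)) ->
  good_kernel (fun G x y => rate (map_network h G) y x).
Proof.
move=> hb; have [b _ _ _] := good_rate hb; split.
- exact: (bor_ker_swap b).
- by move=> G _ x y; exact: rate_ge0.
- by move=> G lG; apply: rate_col_fin; exact: lG.
- by move=> G _ x y _ Gy; exact: rate_out_left.
Qed.

Lemma good_min (Xi : pseudoPMetricType R) (K L : network Xi -> nat -> nat -> R) :
  good_kernel K -> good_kernel L ->
  good_kernel (fun G x y => Num.min (K G x y) (L G x y)).
Proof.
move=> [bK K0 Kf Kv] [bL L0 Lf Lv]; split.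
- apply: (bor_ker_map2 (op := Order.min)) bK bL => [d T f g mf mg|a b].
    exact: measurable_mine.
  by rewrite -EFin_min.
- by move=> G lG x y; rewrite le_min K0// L0.
- move=> G lG x; have [m hm] := Kf G lG x; have [n hn] := Lf G lG x.
  by exists (maxn m n) => z; rewrite geq_max => /andP[/hm -> /hn ->]; rewrite minxx.
- by move=> G lG x y Gx Gy; rewrite Kv// Lv// minxx.
Qed.

Lemma good_max (Xi : pseudoPMetricType R) (K L : network Xi -> nat -> nat -> R) :
  good_kernel K -> good_kernel L ->
  good_kernel (fun G x y => Num.max (K G x y) (L G x y)).
Proof.
move=> [bK K0 Kf Kv] [bL L0 Lf Lv]; split.
- apply: (bor_ker_map2 (op := Order.max)) bK bL => [d T f g mf mg|a b].
    exact: measurable_maxe.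
  by rewrite -EFin_max.
- by move=> G lG x y; rewrite le_max K0.
- move=> G lG x; have [m hm] := Kf G lG x; have [n hn] := Lf G lG x.
  by exists (maxn m n) => z; rewrite geq_max => /andP[/hm -> /hn ->]; rewrite maxxx.
- by move=> G lG x y Gx Gy; rewrite Kv// Lv// maxxx.
Qed.

Lemma map_network_id (G : network RP) : map_network id G = G.
Proof. by case: G. Qed.

Lemma exit_below_le (w : nat -> nat -> R) N z :
  exit_below w N z -> exit_rate w z <= 2 * N.+1%:R.
Proof.
by move=> h; apply: (le_trans h); rewrite mulr_natl mulr2n lerDl ler0n.
Qed.

(** Measurability is obtained from the killed walks, which are power series in products of Borel
    kernels, and not from the iterated time integrals that define the minimal process. *)
Lemma bor_trans_prob (t : R) : 0 <= t ->
  bor 1 (fun (G : network RP) xs => trans_prob G t (nth 0%N xs 0) (nth 0%N xs 0)).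
Proof.
move=> t0; have gr : good_kernel (fun G : network RP => rate G).
  have := @good_rate RP id (fun _ _ _ _ => id).
  by congr good_kernel; apply/funext => G; rewrite map_network_id.
have b N := @bor_killed_trans R RP _ _ N (2 * N.+1%:R) t gr gr
   (mulr_gt0 (ltr0Sn R 1) (ltr0Sn R N)) t0 (fun G _ z h => exit_below_le h).
have := @bor_limn_einf R RP 1 (fun N G xs => (killed_trans (rate G) (exit_below (rate G) N)
  (2 * N.+1%:R) t (nth 0%N xs 0) (nth 0%N xs 0))%:E) b; apply: bor_ext => G.
rewrite -trans_prob_limn_einf//; first exact: rooted_locally_finite.
by have := roots_verts G ord0; rewrite (tnth_nth 0%N).
Qed.

End rate_kernels.

(** * Transfer along the coupling *)

Section transfer.
Variables (R : realType) (Xi Xi' : pseudoPMetricType R) (h : Xi -> Xi').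
Hypothesis h_ball : forall e a b, 0 < e -> ball a e b -> ball (h a) e (h b).
Variables (mu : probability (Gstar Xi') R) (nu : probability (Gstar Xi) R).
Hypothesis push : forall A : set (Gstar Xi'), measurable A ->
  pushforward nu (map_class h : _ -> Gstar Xi') A = mu A.

Let mh := @measurable_map_class R Xi Xi' h h_ball 1.

Lemma integral_map_class (phi : network Xi' -> seq nat -> \bar R) : bor 1 phi ->
  (forall G : rooted 1 Xi', 0 <= phi G (roots G))%E ->
  (\int[mu]_g phi (repr g) (roots (repr g)) =
   \int[nu]_g phi (map_network h (repr g)) (roots (repr g)))%E.
Proof.
move=> bphi phi0; have [iphi mphi] := bphi.
transitivity (\int[pushforward nu (map_class h : Gstar Xi -> Gstar Xi')]_g
   phi (repr g) (roots (repr g)))%E.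
  by apply: eq_measure_integral => A mA _; exact/esym/push.
rewrite ge0_integral_pushforward// preimage_setT; apply: eq_integral => g _ /=.
exact: (iphi _ _ (isomorphic_repr (map_rooted h (repr g)))).
Qed.

Lemma ae_map_class (P : rooted 1 Xi' -> Prop) :
  (forall G H, isomorphic G H -> P G -> P H) ->
  {ae mu, forall g : rooted_class 1 Xi', P (repr g)} ->
  {ae nu, forall g : rooted_class 1 Xi, P (map_rooted h (repr g))}.
Proof.
move=> iP [A [mA A0 PA]].
exists ((map_class h : Gstar Xi -> Gstar Xi') @^-1` A); split.
- by rewrite -[X in measurable X]setTI; exact: mh.
- exact: etrans (push mA) A0.
- move=> g /= nP; apply: PA => /= Pg; apply: nP.
  exact: iP (isomorphic_repr _) Pg.
Qed.

End transfer.

Section symmetric_weights.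
Variable R : realType.
Local Notation RP := (Rplus R).

Lemma symmetric_weights_iso (G H : rooted 1 RP) :
  isomorphic G H -> symmetric_weights G -> symmetric_weights H.
Proof.
move=> /isomorphicP[f [g [[_ [_ _ sg] hd _ hm] _]]] sG d Hd.
have [|e Ge <-] := sg d.
  by split=> //; [exact: dsrc_verts|exact/dsrc_verts/drev_darts].
have [_ ->] := hd _ Ge; rewrite -!hm//; last exact: induced_drev.
by apply: sG; have [] := Ge.
Qed.

Lemma rate_sym (G : network RP) : symmetric_weights G -> ksym (rate G).
Proof.
move=> sG x y; rewrite [RHS]rateE.
rewrite (@reindex_fsbig _ _ _ _ _ (drev G) (darts_between G x y) (darts_between G y x)).
  rewrite rateE; apply: eq_fsbigr => d; rewrite inE => -[Gd _ _].
  by rewrite sG.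
split.
- by move=> d [Gd dx dy]; split; [exact: drev_darts|exact: dy|rewrite /dtgt drevK].
- move=> d d'; rewrite !inE => -[Gd _ _] [Gd' _ _] e.
  by rewrite -(drevK Gd) e drevK.
- move=> d [Gd dx dy]; exists (drev G d); last exact: drevK.
  by split; [exact: drev_darts|exact: dy|rewrite /dtgt drevK].
Qed.

Lemma trans_prob_ge0 (G : network RP) t x y : (0 <= trans_prob G t x y)%E.
Proof. by apply: nneseries_ge0 => n _ _; exact: njump_prob_ge0. Qed.

End symmetric_weights.

Section coupled.
Variable R : realType.
Local Notation RP := (Rplus R).
Local Notation RP2 := (RP * RP)%type.

Lemma ball_fst (e : R) (a b : RP2) : 0 < e -> ball a e b -> ball a.1 e b.1.
Proof. by move=> _ []. Qed.

Lemma ball_snd (e : R) (a b : RP2) : 0 < e -> ball a e b -> ball a.2 e b.2.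
Proof. by move=> _ []. Qed.

Let r1 (G : network RP2) := rate (map_network fst G).
Let r2 (G : network RP2) := rate (map_network snd G).

(* On almost every network these are just [r1] and [r2]; taking extrema makes them *)
(* symmetric and ordered on every network.                                         *)
Definition lower_rate (G : network RP2) x y : R :=
  Num.min (Num.min (r1 G x y) (r1 G y x)) (Num.min (r2 G x y) (r2 G y x)).
Definition upper_rate (G : network RP2) x y : R :=
  Num.max (Num.max (r1 G x y) (r1 G y x)) (Num.max (r2 G x y) (r2 G y x)).

Lemma good_lower_rate : good_kernel lower_rate.
Proof.
by apply: good_min; apply: good_min;
  [exact: good_rate ball_fst|exact: good_rate_swap ball_fst|
   exact: good_rate ball_snd|exact: good_rate_swap ball_snd].
Qed.

Lemma good_upper_rate : good_kernel upper_rate.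
Proof.
by apply: good_max; apply: good_max;
  [exact: good_rate ball_fst|exact: good_rate_swap ball_fst|
   exact: good_rate ball_snd|exact: good_rate_swap ball_snd].
Qed.

Lemma lower_rate_sym G : ksym (lower_rate G).
Proof.
by move=> x y; rewrite /lower_rate (minC (r1 G x y)) (minC (r2 G x y)).
Qed.

Lemma upper_rate_sym G : ksym (upper_rate G).
Proof.
by move=> x y; rewrite /upper_rate (maxC (r1 G x y)) (maxC (r2 G x y)).
Qed.

Lemma lower_upper_rate G x y : lower_rate G x y <= upper_rate G x y.
Proof. by rewrite !ge_min !le_max lexx. Qed.

Lemma coupled_rates (G : rooted 1 RP2) : marks_in (@leRplus R) G ->
  symmetric_weights (map_network fst G) -> symmetric_weights (map_network snd G) ->
  lower_rate G = r1 G /\ upper_rate G = r2 G.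
Proof.
move=> [_ mG] s1 s2.
have r12 x y : r1 G x y <= r2 G x y.
  have fD := darts_between_finite x y (rooted_locally_finite (r := G)).
  rewrite /r1 /r2 !rateE !fsbig_finite//= big_seq [leRHS]big_seq.
  apply: ler_sum => d; rewrite in_fset_set// inE => -[Gd _ _].
  exact: mG.
split; apply/funext => x; apply/funext => y.
  rewrite /lower_rate {2}/r1 (rate_sym s1 y x) -/(r1 G x y) minxx.
  rewrite {2}/r2 (rate_sym s2 y x) -/(r2 G x y) minxx.
  exact/min_idPl.
rewrite /upper_rate {2}/r1 (rate_sym s1 y x) -/(r1 G x y) maxxx.
rewrite {2}/r2 (rate_sym s2 y x) -/(r2 G x y) maxxx.
exact/max_idPr.
Qed.

End coupled.

Unset Implicit Arguments.

Theorem theorem5p1 (R : realType)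
    (mu1 mu2 : probability (Gstar (Rplus R)) R)
    (mu1_unimodular : unimodular mu1) (mu2_unimodular : unimodular mu2)
    (mu1_symmetric : {ae mu1, forall g : rooted_class 1 (Rplus R),
       symmetric_weights (repr g)})
    (mu2_symmetric : {ae mu2, forall g : rooted_class 1 (Rplus R),
       symmetric_weights (repr g)})
    (coupling : exists nu : probability (Gstar (Rplus R * Rplus R)%type) R,
       is_unimodular_coupling (@leRplus R) mu1 mu2 nu)
    (t : R) (t_gt0 : 0 < t) :
  (\int[mu2]_g return_prob t g <= \int[mu1]_g return_prob t g)%E.
Proof.
have [nu [[nu_le push1 push2] unim]] := coupling.
have t0 := ltW t_gt0.
have btr := bor_trans_prob t0.
pose tr (h : (Rplus R * Rplus R)%type -> Rplus R) (g : Gstar (Rplus R * Rplus R)%type) :=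
  trans_prob (map_network h (repr g)) t (root (repr g)) (root (repr g)).
(* Both return probabilities become functionals of the same random network under [nu], with weights
   read off through [h]. *)
have retE h (mu : probability (Gstar (Rplus R)) R) :
    (forall e a b, 0 < e -> ball a e b -> ball (h a) e (h b)) ->
    (forall A : set (Gstar (Rplus R)), measurable A ->
      pushforward nu (map_class h : _ -> Gstar (Rplus R)) A = mu A) ->
    (\int[mu]_g return_prob t g = \int[nu]_g tr h g)%E.
  move=> hb push.
  transitivity (\int[mu]_g trans_prob (repr g) t (nth 0%N (roots (repr g)) 0)
      (nth 0%N (roots (repr g)) 0))%E.
    by apply: eq_integral => g _; rewrite /return_prob /root (tnth_nth 0%N).
  rewrite (integral_map_class hb push btr) => [|G]; last exact: trans_prob_ge0.
  by apply: eq_integral => g _; rewrite /tr /root (tnth_nth 0%N).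
rewrite (retE fst mu1 (@ball_fst R) push1) (retE snd mu2 (@ball_snd R) push2).
have m_tr h : (forall e a b, 0 < e -> ball a e b -> ball (h a) e (h b)) ->
    measurable_fun setT (tr h).
  move=> hb; have [_] := bor_map hb btr; congr measurable_fun; apply/funext => g.
  by rewrite /tr /root (tnth_nth 0%N).
have s1 := ae_map_class (@ball_fst R) push1 (@symmetric_weights_iso R) mu1_symmetric.
have s2 := ae_map_class (@ball_snd R) push2 (@symmetric_weights_iso R) mu2_symmetric.
have ae_rates : {ae nu, forall g : rooted_class 1 (Rplus R * Rplus R)%type,
    lower_rate (repr g) = rate (map_network fst (repr g)) /\
    upper_rate (repr g) = rate (map_network snd (repr g))}.
  apply: (@filterS3 _ _ (ae_filter_ringOfSetsType nu) _ _ _ _ _ nu_le s1 s2) => g.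
  exact: coupled_rates.
have c0 N : 0 < 2 * N.+1%:R :> R by rewrite mulr_gt0.
(* The killing always uses the upper rate, whichever rate [w] drives the walk. *)
pose q (w : network (Rplus R * Rplus R) -> nat -> nat -> R) N (g : Gstar (Rplus R * Rplus R)%type) : \bar R := (killed_trans (w (repr g))
  (exit_below (upper_rate (repr g)) N) (2 * N.+1%:R) t (root (repr g)) (root (repr g)))%:E.
have glo := good_lower_rate R; have gup := good_upper_rate R.
have exit_lo N (G : network (Rplus R * Rplus R)%type) : locally_finite G ->
    forall z, exit_below (upper_rate G) N z -> exit_rate (lower_rate G) z <= 2 * N.+1%:R.
  move=> lG z /exit_below_le; apply: le_trans; apply: exit_rate_le.
  - exact: lower_upper_rate.
  - by have [_ _ f _] := glo; exact: f.
  - by have [_ _ f _] := gup; exact: f.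
have mq_up N : measurable_fun setT (q (@upper_rate R) N).
  exact: (measurable_root (bor_killed_trans gup gup (c0 N) t0 (fun G _ z => @exit_below_le R (upper_rate G) N z))).
have mq_lo N : measurable_fun setT (q (@lower_rate R) N).
  exact: (measurable_root (bor_killed_trans glo gup (c0 N) t0 (exit_lo N))).
have q_le N : (\int[nu]_g q (@upper_rate R) N g <= \int[nu]_g q (@lower_rate R) N g)%E.
  exact: (root_mean_killed_trans_le unim glo gup (@lower_rate_sym R) (@upper_rate_sym R)
    (@lower_upper_rate R) N t0).
have lG (g : rooted_class 1 (Rplus R * Rplus R)%type) : locally_finite (repr g).
  exact: rooted_locally_finite.
have rG (g : rooted_class 1 (Rplus R * Rplus R)%type) : verts (repr g) (root (repr g)).
  exact: roots_verts.
have q_ge0 w : good_kernel w -> (forall N (G : network (Rplus R * Rplus R)%type),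
    locally_finite G -> forall z, exit_below (upper_rate G) N z ->
    exit_rate (w G) z <= 2 * N.+1%:R) -> forall N g, (0 <= q w N g)%E.
  move=> [_ w0 wf _] hw N g; rewrite lee_fin mulr_ge0 ?expR_ge0// egf_ge0 ?(ltW (c0 N))//.
  by move=> m; apply: step_pow01 => //; [exact: w0|exact: wf|exact: hw].
have q_up0 := q_ge0 _ gup (fun N G _ z => @exit_below_le R (upper_rate G) N z).
have q_lo0 := q_ge0 _ glo exit_lo.
(* For the upper rates the minimal process is almost surely the lower limit of the killed ones, so
   Fatou's lemma bounds its mean by the lower limit of the killed means. *)
apply: (@le_trans _ _ (\int[nu]_g limn_einf (fun N => q (@upper_rate R) N g))%E).
  apply: ae_ge0_le_integral => //.
  - by move=> g _; exact: trans_prob_ge0.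
  - exact: m_tr (@ball_snd R).
  - by move=> g _; apply: limn_einf_ge0 => N; exact: q_up0.
  - exact: measurable_limn_einf.
  - apply: (@filterS _ _ (ae_filter_ringOfSetsType nu) _ _ _ ae_rates) => g [_ e] _.
    by rewrite /tr /q e trans_prob_limn_einf//; [exact: lG|exact: rG].
apply: (le_trans (fatou nu measurableT mq_up (fun N g _ => q_up0 N g))).
(* For the lower rates no limit is taken: at each [N] the killed walk is dominated by the minimal
   process, which bounds the lower limit. *)
apply: limn_einf_le => N; apply: le_trans (q_le N) _.
apply: ae_ge0_le_integral => //.
- by move=> g _; exact: trans_prob_ge0.
- exact: m_tr (@ball_fst R).
- apply: (@filterS _ _ (ae_filter_ringOfSetsType nu) _ _ _ ae_rates) => g [e _] _.
  have := exit_lo N (repr g) (lG g); rewrite /q /tr e => hV.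
  by apply: killed_trans_le => //; [exact: lG|exact: rG].
Qed.
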